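(* If $0\le p<2$, then the embedding $\mathcal{Z}\hookrightarrow L^{p+2}_{loc}(\mathbb{R}^2)$ is compact.
   Context: For functions on $\mathbb{R}^2$ with variables $(x,y)$ and dual Fourier variables $(\xi,\eta)$, $D_x^{\pm1/2}$ is defined by $(D_x^{\pm1/2}u)^{\wedge}(\xi,\eta)=|\xi|^{\pm1/2}\widehat{u}(\xi,\eta)$. The space is $$\mathcal{Z}=\{u\in L^2(\mathbb{R}^2):\ D_x^{1/2}u\in L^2(\mathbb{R}^2),\ D_x^{-1/2}u_y\in L^2(\mathbb{R}^2)\},$$ with norm $$\|u\|_{\mathcal{Z}}=\Big(\int_{\mathbb{R}^2}\big(u^2+|D_x^{1/2}u|^2+|D_x^{-1/2}u_y|^2\big)\,dx\,dy\Big)^{1/2}.$$ Compactness of the embedding into $L^{p+2}_{loc}(\mathbb{R}^2)$ means that every bounded sequence in $\mathcal{Z}$ has a subsequence converging in $L^{p+2}_{loc}(\mathbb{R}^2)$, i.e. converging in $L^{p+2}(B)$ for every bounded set $B\subset\mathbb{R}^2$. *)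

(* Defs.v *)
From HB Require Import structures.
From mathcomp Require Import all_boot all_order all_algebra.
From mathcomp Require Import complex.
From mathcomp Require Import all_classical all_reals all_analysis.

Set Implicit Arguments.
Unset Strict Implicit.
Unset Printing Implicit Defensive.

Import Order.TTheory GRing.Theory Num.Theory.
Import numFieldNormedType.Exports.

Local Open Scope classical_set_scope.
Local Open Scope ring_scope.
Local Open Scope complex_scope.

(* Elements of function spaces are real-valued functions on the plane, not
   classes modulo almost everywhere equality.  Points of the physical plane are
   written z = (x, y) and points of the frequency plane k = (xi, eta). *)

Notation lebesgue2 := (lebesgue_measure \x lebesgue_measure)%E.

Section Fourier.
Context {R : realType}.
Implicit Types (u w : R * R -> R) (f v : R * R -> R[i]).

Definition cintegral f : R[i] :=
  (\int[lebesgue2]_z complex.Re (f z)) +i* (\int[lebesgue2]_z complex.Im (f z)).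

(* exp (- i t) *)
Definition cisN (t : R) : R[i] := cos t -i* sin t.

Definition fourier_integral u (k : R * R) : R[i] :=
  cintegral (fun z => (u z)%:C * cisN (z.1 * k.1 + z.2 * k.2)).

Definition square (n : nat) : set (R * R) :=
  `[- n%:R, n%:R]%classic `*` `[- n%:R, n%:R]%classic.

Definition CL2 f : Prop :=
  ((fun k => complex.Re (f k)) \in Lfun lebesgue2 2%:E) /\
  ((fun k => complex.Im (f k)) \in Lfun lebesgue2 2%:E).

Definition CL2norm f : \bar R :=
  Lnorm lebesgue2 2%:E (EFin \o (fun k => Normc.normc (f k))).

(* Plancherel transform: v is the Fourier transform of u in L^2, i.e. the
   limit in the mean of the Fourier integrals of the truncations of u (which
   are integrable).  It determines v up to almost everywhere equality. *)
Definition is_fourier u v : Prop :=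
  [/\ u \in Lfun lebesgue2 2%:E,
      CL2 v
    & CL2norm (fun k => fourier_integral (u \* \1_(square n)) k - v k)
        @[n --> \oo] --> 0%E].

(* w is the element of L^2 with Fourier transform m times that of u.  The
   symbols m used below satisfy m (- k) = (m k)^*, so that the operator maps
   real-valued functions to real-valued functions. *)
Definition is_multiplier (m : R * R -> R[i]) u w : Prop :=
  exists2 v, is_fourier u v & is_fourier w (fun k => m k * v k).

(* |xi|^s; the value on the null set xi = 0 is irrelevant. *)
Definition symbol_Dx (s : R) (k : R * R) : R[i] := (`|k.1| `^ s)%:C.

Definition symbol_dy (k : R * R) : R[i] := 0 +i* k.2.

Definition is_Dx_half : (R * R -> R) -> (R * R -> R) -> Prop :=
  is_multiplier (symbol_Dx 2^-1).

(* u_y is in general only a tempered distribution, with Fourier transform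
   i eta times that of u; D_x^{-1/2} u_y is obtained by applying the symbol
   |xi|^{-1/2} to the latter. *)
Definition is_Dx_mhalf_dy : (R * R -> R) -> (R * R -> R) -> Prop :=
  is_multiplier (fun k => symbol_Dx (- 2^-1) k * symbol_dy k).

Definition Dx_half u : R * R -> R := xget (cst 0) [set w | is_Dx_half u w].

Definition Dx_mhalf_dy u : R * R -> R :=
  xget (cst 0) [set w | is_Dx_mhalf_dy u w].

Definition Zspace : set (R * R -> R) :=
  [set u | [/\ u \in Lfun lebesgue2 2%:E,
               exists w, is_Dx_half u w
             & exists w, is_Dx_mhalf_dy u w]].

Definition Znorm u : R :=
  Num.sqrt (\int[lebesgue2]_z
    ((u z) ^+ 2 + `|Dx_half u z| ^+ 2 + `|Dx_mhalf_dy u z| ^+ 2)).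

End Fourier.

Section Local_Lebesgue.
Context {R : realType}.
Implicit Types (q : R) (u : R * R -> R).

Definition Lloc q : set (R * R -> R) :=
  [set u | forall B : set (R * R), measurable B -> bounded_set B ->
     (u \* \1_B) \in Lfun lebesgue2 q%:E].

Definition cvg_Lloc q (u_ : nat -> R * R -> R) u : Prop :=
  forall B : set (R * R), measurable B -> bounded_set B ->
    Lnorm lebesgue2 q%:E (EFin \o ((u_ n \- u) \* \1_B)%R) @[n --> \oo] --> 0%E.

Definition compact_embedding_Lloc (X : set (R * R -> R))
    (normX : (R * R -> R) -> R) q : Prop :=
  X `<=` Lloc q /\
  forall u_ : nat -> R * R -> R, (forall n, X (u_ n)) ->
    (exists M, forall n, normX (u_ n) <= M) ->
    exists2 phi : nat -> nat, {homo phi : m n / (m < n)%N} &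
    exists2 u, Lloc q u & cvg_Lloc q (u_ \o phi) u.

End Local_Lebesgue.

(* Main.v *)
(* A symbol inequality (AM-GM) gives |xi| + |eta| <= C (|xi| + eta^2 / |xi|), so
   a function u of Z satisfies an H^{1/2}-type estimate.  With Ker_d the product
   of two Poisson kernels, whose Fourier transform is
   wt_d = exp (- d (|xi| + |eta|)), the double integral of
   (u x - u y)^2 Ker_d (x, y) is a multiple of the integral of
   (1 - wt_d) |u^|^2, hence at most C d |u|_Z^2.  (Letting d tend to 0 in the same
   identity yields Plancherel's identity for truncations.)

   Since Ker_d >= d^-2 on squares of side d = 2^-j, the averages E_j u of u over
   the dyadic squares of side 2^-j satisfy |u - E_j u|_2^2 <= C 2^-j and
   |E_{j+1} u - E_j u| <= C 2^(j/2).  Where |u - E_j u| has size 2^(i/2) with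
   i >= j, it is comparable to |u - E_i u|; summing over i, the integral of
   |u - E_j u|^(p+2) is at most C (2^(p/2-1))^j.

   For a bounded sequence all the averages are bounded, so by Tychonoff's theorem
   some subsequence makes finitely many more of them converge at each step.  It
   is Cauchy in L^(p+2) on every square at a geometric rate, hence converges
   almost everywhere, and Fatou's lemma gives the convergence in L^(p+2). *)

Require Import Defs.
From HB Require Import structures.
From mathcomp Require Import all_boot all_order all_algebra.
From mathcomp Require Import complex.
From mathcomp Require Import all_classical all_reals all_analysis.
From mathcomp Require Import measurable_realfun.
From mathcomp Require Import ring lra.

Set Implicit Arguments.
Unset Strict Implicit.
Unset Printing Implicit Defensive.

Import Order.TTheory GRing.Theory Num.Theory.
Import numFieldNormedType.Exports.

Local Open Scope classical_set_scope.
Local Open Scope ring_scope.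

(** * Poisson kernel *)

(** The transform is a limit in mean of Fourier integrals of truncations, so the proof avoids
    inversion formulas. It rests on one exact identity, which Fubini's theorem yields once the
    integrable weight [wt d] is inserted. For d tending to 0, Fatou's lemma turns this identity into
    the upper half of Plancherel. The lower half requires the double integral to vanish in the
    limit; for functions supported in a square this follows by density from indicators of intervals,
    where arctangents give the value. Factors of 2 are given away when passing to the limit in mean,
    so that inequalities suffice for the transform itself.

    The condition on p balances two rates. The mean square error at level i decays like 2^-i, while
    averages at that level may have size 2^(i/2). The part of the deviation of size 2^(i/2) thus
    contributes about 2^(i p/2) 2^-i to the integral of the power p + 2, and these terms form a
    convergent geometric series exactly when p < 2. The same geometric gain makes the truncation to
    finitely many averages uniform along a bounded sequence, which is where compactness comes
    from. *)

Section real_line_integrals.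
Context {R : realType}.
Notation mu := (@lebesgue_measure R).

Lemma integral_is_derive (f F : R -> R) (a b : R) : a < b -> continuous f ->
  (forall x, is_derive x (1:R) F (f x)) ->
  (\int[mu]_(x in `[a, b]) (f x)%:E = (F b - F a)%:E)%E.
Proof.
move=> ab cf dF.
have cF : continuous F.
  move=> x; apply: differentiable_continuous; apply/derivable1_diffP.
  by have [] := dF x.
rewrite (@continuous_FTC2 _ f F)//.
- exact: continuous_subspaceT.
- split.
  + by move=> x _; have [] := dF x.
  + by apply: cvg_at_right_filter; exact: cF.
  + by apply: cvg_at_left_filter; exact: cF.
- by move=> x _; rewrite derive1E; have [_ ->] := dF x.
Qed.

Definition segN (n : nat) : set R := `[- n%:R, n%:R]%classic.

Lemma measurable_segN n : measurable (segN n).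
Proof. exact: measurable_itv. Qed.

Lemma bigcup_itvNn : \bigcup_n segN n = [set: R].
Proof.
rewrite -subTset => x _; exists (Num.truncn `|x|).+1 => //=.
rewrite /segN/= in_itv/= -ler_norml; exact/ltW/truncnS_gt.
Qed.

Lemma nondecreasing_itvNn :
  {homo segN : n m / (n <= m)%N >-> (n <= m)%O}.
Proof.
move=> n m nm; apply/subsetPset => x; rewrite /segN/= !in_itv/= => /andP[h1 h2].
have h : n%:R <= m%:R :> R by rewrite ler_nat.
by rewrite (le_trans h2 h) andbT (le_trans _ h1)// lerN2.
Qed.

Lemma ge0_cvg_integral_itvNn (f : R -> R) : measurable_fun setT f ->
  (forall x, 0 <= f x) ->
  (\int[mu]_(x in segN n) (f x)%:E)%E @[n --> \oo] --> (\int[mu]_x (f x)%:E)%E.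
Proof.
move=> mf f0; rewrite -bigcup_itvNn.
apply: ge0_nondecreasing_set_cvg_integral => //.
- exact: nondecreasing_itvNn.
- by move=> i; exact: measurable_segN.
- by move=> i; apply: measurable_funTS; exact/measurable_EFinP.
- by move=> i x _; rewrite lee_fin.
Qed.

Lemma cvg_integral_itvNn (f : R -> R) : mu.-integrable setT (EFin \o f) ->
  (\int[mu]_(x in segN n) (f x)%:E)%E @[n --> \oo] --> (\int[mu]_x (f x)%:E)%E.
Proof.
move=> fi; have mf := measurable_int _ fi.
under eq_fun do rewrite integral_mkcond.
have := @dominated_convergence _ _ _ mu setT measurableT
  (fun n => ((EFin \o f) \_ (segN n))) (EFin \o f) (abse \o (EFin \o f)).
case=> //.
- move=> n; apply: (measurable_restrictT _ _).1; first exact: measurable_segN.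
  exact: measurable_funTS.
- apply: aeW => x _; have := bigcup_itvNn; rewrite -subTset => /(_ x I)[N _ xN].
  apply: cvg_near_cst; exists N => //= n /= Nn; rewrite patchE mem_set//.
  by have /subsetPset := nondecreasing_itvNn Nn; apply.
- exact: integrable_abse.
- apply: aeW => x n _; rewrite patchE/=; case: ifPn => //=.
  by rewrite normr0 lee_fin.
Qed.

End real_line_integrals.

Section poisson.
Context {R : realType}.
Notation mu := (@lebesgue_measure R).

(** Normalised as the Fourier transform of exp (- d |t|), which gives it mass 2 pi instead of 1. *)
Definition poisson (d t : R) : R := 2 * d / (d ^+ 2 + t ^+ 2).

Lemma poisson_ge0 (d t : R) : 0 < d -> 0 <= poisson d t.
Proof.
move=> d0; rewrite /poisson divr_ge0// ?mulr_ge0// ?ltW// ltr_wpDr ?sqr_ge0// exprn_gt0//.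
Qed.

Lemma poisson_den_gt0 (d t : R) : 0 < d -> 0 < d ^+ 2 + t ^+ 2.
Proof. by move=> d0; rewrite ltr_wpDr ?sqr_ge0// exprn_gt0. Qed.

Lemma poissonN (d t : R) : poisson d (- t) = poisson d t.
Proof. by rewrite /poisson sqrrN. Qed.

Lemma continuous_poisson (d : R) : 0 < d -> continuous (poisson d).
Proof.
move=> d0 t; apply: cvgM; first exact: cvg_cst.
apply: cvgV; first by rewrite gt_eqF// poisson_den_gt0.
by apply: cvgD; [exact: cvg_cst|exact: (@exprn_continuous _ 2%N)].
Qed.

Lemma measurable_poisson (d : R) : 0 < d -> measurable_fun setT (poisson d).
Proof. by move=> d0; apply: continuous_measurable_fun; exact: continuous_poisson. Qed.

Lemma is_derive_poisson (d x t : R) : 0 < d ->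
  is_derive t (1:R) (fun t => 2 * atan ((t - x) / d)) (poisson d (x - t)).
Proof.
move=> d0.
have H : is_derive t (1:R) (fun t => (t - x) / d) d^-1.
  by apply: is_derive_eq; rewrite /GRing.scale/=; ring.
have H2 : is_derive t (1:R) (fun t => atan ((t - x) / d)) ((1 + ((t - x) / d) ^+ 2)^-1 * d^-1).
  exact: (@is_derive1_comp _ atan (fun t => (t - x) / d) _ _ _ (is_derive1_atan _) H).
apply: is_derive_eq.
rewrite /GRing.scale/= /poisson; field.
rewrite !gt_eqF ?poisson_den_gt0//=.
Qed.

Lemma integral_itv_poisson (d x a b : R) : 0 < d -> a < b ->
  (\int[mu]_(t in `[a, b]) (poisson d (x - t))%:E =
   (2 * atan ((b - x) / d) - 2 * atan ((a - x) / d))%:E)%E.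
Proof.
move=> d0 ab.
apply: (@integral_is_derive _ (fun t => poisson d (x - t)) (fun t => 2 * atan ((t - x) / d))) => //.
- move=> t; apply: (@continuous_comp _ _ _ (fun t => x - t) (poisson d)).
    by apply: cvgB; [exact: cvg_cst|exact: cvg_id].
  exact: continuous_poisson.
- by move=> t; exact: is_derive_poisson.
Qed.

Lemma cvg_atan_affine (x d : R) : 0 < d ->
  2 * atan ((n%:R - x) / d) @[n --> \oo] --> pi.
Proof.
move=> d0; rewrite [X in _ --> X](_ : _ = 2 * (pi / 2)); last by field.
apply: cvgMr; apply: (@cvg_comp _ _ _ (fun n => (n%:R - x) / d) atan _ (+oo)); last exact: cvgy_atan.
apply/cvgryPge => A; near=> n.
rewrite ler_pdivlMr// lerBrDr; near: n.
exact: nbhs_infty_ger.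
Unshelve. all: by end_near. Qed.

Lemma integral_poisson (d x : R) : 0 < d ->
  (\int[mu]_t (poisson d (x - t))%:E = (2 * pi)%:E)%E.
Proof.
move=> d0.
apply: (@cvg_unique _ _ ((\int[mu]_(t in segN n) (poisson d (x - t))%:E)%E @[n --> \oo])) => //.
  apply: ge0_cvg_integral_itvNn.
  - apply: continuous_measurable_fun => t.
    apply: (@continuous_comp _ _ _ (fun t => x - t) (poisson d)).
      by apply: cvgB; [exact: cvg_cst|exact: cvg_id].
    exact: continuous_poisson.
  - by move=> t; exact: poisson_ge0.
have : (2 * atan ((n%:R - x) / d) + 2 * atan ((n%:R - - x) / d))%:E @[n --> \oo] --> (2 * pi)%:E.
  apply: cvg_EFin; first exact: nearW.
  rewrite mulr_natl mulr2n; apply: cvgD; exact: cvg_atan_affine.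
apply: cvg_trans; apply: near_eq_cvg; near=> n.
rewrite /segN integral_itv_poisson//.
  by rewrite -opprD mulNr atanN mulrN opprK [n%:R + x]addrC opprK addrC.
rewrite gtrN// ltr0n; near: n; exact: nbhs_infty_gt.
Unshelve. all: by end_near. Qed.

End poisson.

Section damped_cosine.
Context {R : realType}.
Notation mu := (@lebesgue_measure R).
Implicit Types d a b x t : R.

Definition expabs d t : R := expR (- (d * `|t|)).

Lemma expabs_ge0 d t : 0 <= expabs d t. Proof. exact: expR_ge0. Qed.

Lemma expabs_le1 d t : 0 < d -> expabs d t <= 1.
Proof. by move=> d0; rewrite /expabs -expR0 ler_expR oppr_le0 mulr_ge0// ltW. Qed.

Lemma continuous_expabs d : continuous (expabs d).
Proof.
move=> t; apply: (@continuous_comp _ _ _ (fun t => - (d * `|t|)) expR); last exact: continuous_expR.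
by apply: cvgN; apply: cvgMr; exact: norm_continuous.
Qed.

Lemma measurable_expabs d : measurable_fun setT (expabs d).
Proof. by apply: continuous_measurable_fun; exact: continuous_expabs. Qed.

(** The real part of exp ((- d + i a) x + i b) / (- d + i a). The sign of [d] is free, so that [- d]
    serves the negative half-line. The phase [b] makes room for the second variable when the plane
    integral is iterated. *)
Definition damped_primitive d a b x : R :=
  expR (- d * x) * (a * sin (a * x + b) - d * cos (a * x + b)) / (d ^+ 2 + a ^+ 2).

Lemma is_derive_damped d a b x : d != 0 ->
  is_derive x (1:R) (damped_primitive d a b) (expR (- d * x) * cos (a * x + b)).
Proof.
move=> d0; rewrite /damped_primitive; apply: is_derive_eq.
rewrite /GRing.scale/=; field.
by rewrite paddr_eq0 ?sqr_ge0// negb_and sqrf_eq0 d0.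
Qed.

Lemma continuous_damped d a b : continuous (fun x => expR (- d * x) * cos (a * x + b)).
Proof.
move=> x; apply: differentiable_continuous; apply/derivable1_diffP.
exact: ex_derive.
Qed.

Lemma integral_itv_damped d a b (u v : R) : d != 0 -> u < v ->
  (\int[mu]_(x in `[u, v]) (expR (- d * x) * cos (a * x + b))%:E =
   (damped_primitive d a b v - damped_primitive d a b u)%:E)%E.
Proof.
move=> d0 uv; apply: integral_is_derive; [exact: uv|exact: continuous_damped|].
by move=> x; exact: is_derive_damped.
Qed.

Lemma continuous_expabs_cos d a b : continuous (fun x => expabs d x * cos (a * x + b)).
Proof.
move=> x; apply: cvgM; first exact: continuous_expabs.
apply: differentiable_continuous; apply/derivable1_diffP.
exact: ex_derive.
Qed.

Lemma measurable_expabs_cos d a b :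
  measurable_fun setT (fun x => (expabs d x * cos (a * x + b))%:E).
Proof.
by apply/measurable_EFinP; exact: continuous_measurable_fun (@continuous_expabs_cos d a b).
Qed.

Lemma damped_primitive_le d a b x : 0 < d -> 0 <= x ->
  `|damped_primitive d a b x| <= expR (- (d * x)) * ((`|a| + d) / (d ^+ 2 + a ^+ 2)).
Proof.
move=> d0 x0; have D0 := poisson_den_gt0 a d0.
rewrite /damped_primitive mulNr normrM normrM (ger0_norm (expR_ge0 _)) -mulrA.
rewrite ler_wpM2l ?expR_ge0// [X in _ * X <= _]gtr0_norm ?invr_gt0// ler_wpM2r// ?invr_ge0 ?(ltW D0)//.
rewrite (le_trans (ler_normB _ _))// !normrM (gtr0_norm d0) lerD//.
  by rewrite ler_piMr// ler_norml sin_geN1 sin_le1.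
by rewrite ler_piMr ?(ltW d0)// ler_norml cos_geN1 cos_le1.
Qed.

Lemma cvg_damped_primitive d a b : 0 < d ->
  damped_primitive d a b n%:R @[n --> \oo] --> (0 : R).
Proof.
move=> d0; apply/norm_cvg0P.
have : expR (- (d * n%:R)) * ((`|a| + d) / (d ^+ 2 + a ^+ 2)) @[n --> \oo] --> (0:R).
  rewrite -[X in _ --> X](mul0r ((`|a| + d) / (d ^+ 2 + a ^+ 2))).
  apply: cvgMl.
  apply: (@cvg_comp _ _ _ (fun n : nat => d * n%:R) (fun x => expR (- x)) _ (+oo)); last exact: cvgr_expR.
  apply/cvgryPge => A; near=> n.
  rewrite -ler_pdivrMl//; near: n; exact: nbhs_infty_ger.
apply: (@squeeze_cvgr _ _ _ _ (cst 0)); last exact: cvg_cst.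
near=> n; rewrite normr_ge0/=; exact: damped_primitive_le.
Unshelve. all: by end_near. Qed.

Lemma cvg_damped_primitiveN d a b : 0 < d ->
  damped_primitive (- d) a b (- n%:R) @[n --> \oo] --> (0 : R).
Proof.
move=> d0.
have -> : (fun n : nat => damped_primitive (- d) a b (- n%:R)) =
   (fun n => - damped_primitive d a (- b) n%:R).
  apply/funext => n; rewrite /damped_primitive opprK mulrN mulNr sqrrN.
  have -> : a * - n%:R + b = - (a * n%:R - b) by ring.
  by rewrite sinN cosN mulNr; field; rewrite gt_eqF// poisson_den_gt0.
by rewrite -oppr0; apply: cvgN; exact: cvg_damped_primitive.
Qed.

Lemma integral_segN_expabs_cos d a b (n : nat) : (0 < n)%N -> 0 < d ->
  (\int[mu]_(x in segN n) (expabs d x * cos (a * x + b))%:E =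
   (damped_primitive d a b n%:R - damped_primitive (- d) a b (- n%:R)
    + poisson d a * cos b)%:E)%E.
Proof.
move=> n0 d0; have dn0 : d != 0 by rewrite gt_eqF.
have mf := @measurable_expabs_cos d a b.
have n0' : 0 < n%:R :> R by rewrite ltr0n.
rewrite /segN (@itv_bndbnd_setU _ _ _ (BLeft 0)); last 2 first.
- by rewrite bnd_simp oppr_le0 ltW.
- by rewrite bnd_simp ltW.
rewrite integral_setU//=; last 2 first.
- exact: measurable_funTS.
- apply/disj_setPS => x /=; rewrite !in_itv/= => -[/andP[_ x0] /andP[x1 _]].
  by have := le_lt_trans x1 x0; rewrite ltxx.
rewrite integral_itv_bndo_bndc; last exact: measurable_funTS.
have -> : (\int[mu]_(x in `[(- n%:R)%R, 0%R]) (expabs d x * cos (a * x + b))%:E =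
    (damped_primitive (- d) a b 0 - damped_primitive (- d) a b (- n%:R))%:E)%E.
  have dN0 : - d != 0 by rewrite oppr_eq0.
  have n0N : - n%:R < 0 :> R by rewrite oppr_lt0.
  rewrite -(integral_itv_damped a b dN0 n0N).
  - apply: eq_integral => x; rewrite inE/= in_itv/= => /andP[_ x0].
    by rewrite /expabs ler0_norm// mulrN !opprK.
have -> : (\int[mu]_(x in `[0%R, n%:R]) (expabs d x * cos (a * x + b))%:E =
    (damped_primitive d a b n%:R - damped_primitive d a b 0)%:E)%E.
  rewrite -(integral_itv_damped a b dn0 n0').
  - apply: eq_integral => x; rewrite inE/= in_itv/= => /andP[x0 _].
    by rewrite /expabs ger0_norm// mulNr.
rewrite -EFinD; congr EFin.
(* At 0 the sine terms of the two primitives cancel, and the cosine terms add up to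
   [poisson d a * cos b]. *)
have -> : damped_primitive d a b 0 = (a * sin b - d * cos b) / (d ^+ 2 + a ^+ 2).
  by rewrite /damped_primitive !mulr0 add0r expR0 mul1r.
have -> : damped_primitive (- d) a b 0 = (a * sin b + d * cos b) / (d ^+ 2 + a ^+ 2).
  by rewrite /damped_primitive !mulr0 add0r expR0 mul1r sqrrN mulNr opprK.
by rewrite /poisson; field; rewrite gt_eqF// poisson_den_gt0.
Qed.

Lemma cvg_integral_segN_expabs_cos d a b : 0 < d ->
  (\int[mu]_(x in segN n) (expabs d x * cos (a * x + b))%:E)%E @[n --> \oo] -->
  (poisson d a * cos b)%:E.
Proof.
move=> d0.
have : (damped_primitive d a b n%:R - damped_primitive (- d) a b (- n%:R)
    + poisson d a * cos b)%:E @[n --> \oo] --> (poisson d a * cos b)%:E.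
  apply: cvg_EFin; first exact: nearW.
  rewrite -[X in _ --> X]add0r; apply: cvgD; last exact: cvg_cst.
  rewrite -[X in _ --> X]subr0.
  by apply: cvgB; [exact: cvg_damped_primitive|exact: cvg_damped_primitiveN].
apply: cvg_trans; apply: near_eq_cvg; near=> n.
rewrite integral_segN_expabs_cos//; near: n; exact: nbhs_infty_gt.
Unshelve. all: by end_near. Qed.

Lemma integral_expabs d : 0 < d -> (\int[mu]_x (expabs d x)%:E = (poisson d 0)%:E)%E.
Proof.
move=> d0; apply: (@cvg_unique _ _ ((\int[mu]_(t in segN n) (expabs d t)%:E)%E @[n --> \oo])) => //.
  apply: ge0_cvg_integral_itvNn; first exact: measurable_expabs.
  exact: expabs_ge0.
have := @cvg_integral_segN_expabs_cos d 0 0 d0.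
rewrite cos0 mulr1; under eq_fun do under eq_fun do rewrite mul0r add0r cos0 mulr1.
by [].
Qed.

Lemma integrable_expabs d : 0 < d -> mu.-integrable setT (EFin \o expabs d).
Proof.
move=> d0; apply/integrableP; split.
  by apply/measurable_EFinP; exact: measurable_expabs.
under eq_integral do rewrite /= ger0_norm ?expabs_ge0//.
by rewrite integral_expabs// ltry.
Qed.

Lemma integrable_expabs_cos d a b : 0 < d ->
  mu.-integrable setT (fun x => (expabs d x * cos (a * x + b))%:E).
Proof.
move=> d0; apply: le_integrable (integrable_expabs d0) => //.
  exact: measurable_expabs_cos.
move=> x _ /=; rewrite lee_fin normrM ler_piMr//.
by rewrite ler_norml cos_geN1 cos_le1.
Qed.

Lemma integral_expabs_cos d a b : 0 < d ->
  (\int[mu]_x (expabs d x * cos (a * x + b))%:E = (poisson d a * cos b)%:E)%E.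
Proof.
move=> d0; apply: (@cvg_unique _ _ ((\int[mu]_(x in segN n) (expabs d x * cos (a * x + b))%:E)%E @[n --> \oo])) => //.
  exact/cvg_integral_itvNn/integrable_expabs_cos.
exact: cvg_integral_segN_expabs_cos.
Qed.

End damped_cosine.

Ltac meas_proj := lazymatch goal with
  | |- measurable_fun _ (fun _ => fst _) => apply: (measurableT_comp measurable_fst); meas_proj
  | |- measurable_fun _ (fun _ => snd _) => apply: (measurableT_comp measurable_snd); meas_proj
  | |- measurable_fun _ fst => exact: measurable_fst
  | |- measurable_fun _ snd => exact: measurable_snd
  | |- measurable_fun _ (fun x => x) => exact: measurable_id
  | |- _ => idtac end.

(** * Product functions and the kernel on the plane *)

Section tensor.
Context d1 d2 (T1 : measurableType d1) (T2 : measurableType d2) {R : realType}.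
Variables (m1 : {sigma_finite_measure set T1 -> \bar R})
          (m2 : {sigma_finite_measure set T2 -> \bar R}).
Implicit Types (g : T1 -> R) (h : T2 -> R).

Lemma measurable_tensor g h : measurable_fun setT g -> measurable_fun setT h ->
  measurable_fun setT (fun z : T1 * T2 => g z.1 * h z.2).
Proof.
move=> mg mh; apply: measurable_funM.
- exact: (measurableT_comp mg measurable_fst).
- exact: (measurableT_comp mh measurable_snd).
Qed.

Lemma integrable_tensor g h :
  m1.-integrable setT (EFin \o g) -> m2.-integrable setT (EFin \o h) ->
  (m1 \x m2)%E.-integrable setT (fun z => (g z.1 * h z.2)%:E).
Proof.
move=> ig ih.
have mg : measurable_fun setT g by apply/measurable_EFinP; exact: measurable_int ig.
have mh : measurable_fun setT h by apply/measurable_EFinP; exact: measurable_int ih.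
apply/integrable12ltyP; first by apply/measurable_EFinP; exact: measurable_tensor.
under eq_integral => x _.
  under eq_integral => y _ do rewrite /= normrM EFinM.
  rewrite ge0_integralZl//; last by apply/measurable_EFinP; exact: measurableT_comp.
  over.
move: ig ih => /integrableP[_ ig] /integrableP[_ ih].
rewrite ge0_integralZr//; last 2 first.
- by apply/measurable_EFinP; exact: measurableT_comp.
- exact: integral_ge0.
by rewrite lte_mul_pinfty// ?integral_ge0// ge0_fin_numE// integral_ge0.
Qed.

Lemma integral_tensor g h :
  m1.-integrable setT (EFin \o g) -> m2.-integrable setT (EFin \o h) ->
  (\int[m1 \x m2]_z (g z.1 * h z.2)%:E =
   (\int[m1]_x g x)%R%:E * (\int[m2]_y h y)%R%:E)%E.
Proof.
move=> ig ih.
rewrite -integral12_prod_meas1; last exact: integrable_tensor.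
rewrite /fubini_F.
under eq_integral => x _.
  under eq_integral => y _ do rewrite /= EFinM.
  rewrite integralZl//.
  over.
have -> : (\int[m2]_y h y)%R%:E = (\int[m2]_y (h y)%:E)%E.
  by rewrite /Rintegral fineK//; exact: integrable_fin_num.
have -> : (\int[m1]_y g y)%R%:E = (\int[m1]_y (g y)%:E)%E.
  by rewrite /Rintegral fineK//; exact: integrable_fin_num.
have /fineK<- : (\int[m2]_y (h y)%:E)%E \is a fin_num by exact: integrable_fin_num.
rewrite [LHS](_ : _ = \int[m1]_x ((fine (\int[m2]_y (h y)%:E))%:E * (g x)%:E))%E; last first.
  by apply: eq_integral => x _; rewrite muleC.
by rewrite integralZl// muleC.
Qed.

End tensor.

Section kernel.
Context {R : realType}.
Notation mu := (@lebesgue_measure R).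
Notation mu2 := (mu \x mu)%E.
Implicit Types (x y k z : R * R).

Definition Ker (d : R) x y : R := poisson d (x.1 - y.1) * poisson d (x.2 - y.2).
Definition wt (d : R) k : R := expabs d k.1 * expabs d k.2.
Definition phase x k : R := x.1 * k.1 + x.2 * k.2.

Lemma Ker_ge0 d x y : 0 < d -> 0 <= Ker d x y.
Proof. by move=> d0; rewrite mulr_ge0// poisson_ge0. Qed.

Lemma KerC d x y : Ker d x y = Ker d y x.
Proof. by rewrite /Ker -opprB poissonN -(opprB y.2) poissonN. Qed.

Lemma wt_ge0 d k : 0 <= wt d k.
Proof. by rewrite mulr_ge0// expabs_ge0. Qed.

Lemma wt_le1 d k : 0 < d -> wt d k <= 1.
Proof. by move=> d0; rewrite mulr_ile1// ?expabs_ge0// expabs_le1. Qed.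

Lemma measurable_wt d : measurable_fun setT (wt d).
Proof. by apply: measurable_tensor; exact: measurable_expabs. Qed.

Lemma integrable_wt d : 0 < d -> mu2.-integrable setT (EFin \o wt d).
Proof. by move=> d0; apply: integrable_tensor; exact: integrable_expabs. Qed.

Lemma measurable_Ker d : 0 < d -> measurable_fun setT (fun z : (R * R) * (R * R) => Ker d z.1 z.2).
Proof.
move=> d0; apply: measurable_funM; apply: (measurableT_comp (measurable_poisson d0)).
  by apply: measurable_funB; meas_proj.
by apply: measurable_funB; meas_proj.
Qed.

Lemma measurable_Kerl d x : 0 < d -> measurable_fun setT (Ker d x).
Proof.
by move=> d0; exact: measurableT_comp (measurable_Ker d0) (measurable_pair1 x).
Qed.

Lemma poisson_le (d t : R) : 0 < d -> poisson d t <= 2 / d.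
Proof.
move=> d0; rewrite /poisson ler_pdivrMr ?poisson_den_gt0// -mulrA ler_pM2l//.
by rewrite mulrC ler_pdivlMr// -expr2 lerDl sqr_ge0.
Qed.

(** Boundedness of the kernel makes f(x) f(y) [Ker d x y] integrable for every integrable f, which
    the regularised Plancherel identity needs. *)
Lemma Ker_le d x y : 0 < d -> Ker d x y <= (2 / d) ^+ 2.
Proof.
by move=> d0; rewrite /Ker expr2 ler_pM// ?poisson_ge0// poisson_le.
Qed.

(* The constant [1] is the infimum of [d^2 * poisson d s * poisson d t] over the square. *)
Lemma Ker_ge d x y : 0 < d -> `|x.1 - y.1| <= d -> `|x.2 - y.2| <= d ->
  d ^- 2 <= Ker d x y.
Proof.
move=> d0.
have H (t : R) : `|t| <= d -> d^-1 <= poisson d t.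
  move=> td; rewrite /poisson ler_pdivlMr ?poisson_den_gt0// ler_pdivrMl// mulrC.
  rewrite -mulrA -expr2 mulr_natl mulr2n lerD2l -[t ^+ 2]real_normK ?num_real//.
  by rewrite lerXn2r// ?nnegrE// ltW.
move=> /H h1 /H h2; rewrite /Ker expr2 invfM.
by rewrite ler_pM// invr_ge0 ltW.
Qed.

Lemma integral_Ker d x : 0 < d -> (\int[mu2]_y (Ker d x y)%:E = ((2 * pi) ^+ 2)%:E)%E.
Proof.
move=> d0; rewrite fubini_tonelli1//; last 2 first.
- by apply/measurable_EFinP; exact: measurable_Kerl.
- by move=> y; rewrite lee_fin Ker_ge0.
rewrite /fubini_F /Ker /=.
have mp c : measurable_fun setT (fun t : R => (poisson d (c - t))%:E).
  apply/measurable_EFinP; apply: (measurableT_comp (measurable_poisson d0)).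
  by apply: measurable_funB; [exact: measurable_cst|exact: measurable_id].
under eq_integral => s _.
  under eq_integral => t _ do rewrite EFinM.
  rewrite ge0_integralZl//; last 3 first.
  - exact: mp.
  - by move=> t _; rewrite lee_fin poisson_ge0.
  - by rewrite lee_fin poisson_ge0.
  rewrite integral_poisson//; over.
rewrite ge0_integralZr//; last 3 first.
- exact: mp.
- by move=> t _; rewrite lee_fin poisson_ge0.
- by rewrite lee_fin mulr_ge0// pi_ge0.
by rewrite integral_poisson// -EFinM expr2.
Qed.

Lemma integral_wt_cos d a b : 0 < d ->
  (\int[mu2]_k (wt d k * cos (phase (a, b) k))%:E = (poisson d a * poisson d b)%:E)%E.
Proof.
move=> d0.
have mc : measurable_fun setT (fun k : R * R => cos (phase (a, b) k)).
  apply: (measurableT_comp (continuous_measurable_fun (@continuous_cos R))).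
  apply: measurable_funD; apply: measurable_funM; meas_proj; exact: measurable_cst.
(* The inner integral runs over the first frequency, so that [b * k2] is a constant phase in the
   one-dimensional formula. *)
rewrite -integral21_prod_meas1; last first.
  apply: le_integrable (integrable_wt d0) => //.
    by apply/measurable_EFinP; apply: measurable_funM => //; exact: measurable_wt.
  move=> k _ /=; rewrite lee_fin normrM ler_piMr//.
  by rewrite ler_norml cos_geN1 cos_le1.
rewrite /fubini_G /wt /phase /=.
under eq_integral => k2 _.
  under eq_integral => k1 _ do rewrite mulrAC EFinM.
  rewrite integralZr//; last exact: integrable_expabs_cos.
  rewrite integral_expabs_cos// -EFinM -mulrA EFinM -[b * k2]addr0.
  over.
under eq_integral do rewrite [cos _ * _]mulrC.
rewrite integralZl//; last exact: integrable_expabs_cos.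
by rewrite integral_expabs_cos// cos0 mulr1 EFinM.
Qed.

End kernel.

(** * Weighted double integrals of squared differences *)

Section product_sigma_finite.
Context {R : realType} d1 d2 (T1 : measurableType d1) (T2 : measurableType d2).
Variables (m1 : {sigma_finite_measure set T1 -> \bar R})
          (m2 : {sigma_finite_measure set T2 -> \bar R}).

Lemma prod_sigma_finite : sigma_finite setT (m1 \x m2)%E.
Proof.
have /sigma_finiteP[F [TF ndF Foo]] := sigma_finiteT m1.
have /sigma_finiteP[G [TG ndG Goo]] := sigma_finiteT m2.
exists (fun n => F n `*` G n).
  rewrite -setXTT TF TG predeqE => -[x y]; split => [[/= [n _ Fnx] [k _ Gky]]|].
    exists (maxn n k) => //; split.
    - by move: x Fnx; exact/subsetPset/ndF/leq_maxl.
    - by move: y Gky; exact/subsetPset/ndG/leq_maxr.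
  by move=> [n _ []/= ? ?]; split; exists n.
move=> k; have [? ?] := Foo k; have [? ?] := Goo k.
split; first exact: measurableX.
by rewrite product_measure1E// lte_mul_pinfty// ge0_fin_numE.
Qed.

(* [m1 \x m2] itself carries no canonical sigma-finite structure. *)
Definition prodm : set (T1 * T2) -> \bar R := (m1 \x m2)%E.

HB.instance Definition _ := Measure.on prodm.

HB.instance Definition _ := Measure_isSigmaFinite.Build _ _ _ prodm prod_sigma_finite.

End product_sigma_finite.

Section integrable_mul_bounded.
Context {R : realType} d (T : measurableType d) (m : {measure set T -> \bar R}).

Lemma integrable_mul_bounded (f g : T -> R) (C : R) :
  m.-integrable setT (EFin \o f) -> measurable_fun setT g ->
  (forall x : T, `|g x| <= C) ->
  m.-integrable setT (fun x => (f x * g x)%:E).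
Proof.
move=> fi mg gC.
have mf : measurable_fun setT f by apply/measurable_EFinP; exact: measurable_int fi.
have fiC : m.-integrable setT (fun x => (C%:E * (EFin \o f) x)%E) by exact: integrableZl.
apply: le_integrable fiC => //.
  by apply/measurable_EFinP; exact: measurable_funM.
move=> x _ /=; rewrite lee_fin mulrC !normrM ler_wpM2r//.
by rewrite (le_trans (gC x))// ler_norm.
Qed.

End integrable_mul_bounded.

Section gagliardo.
Context {R : realType} d (T : measurableType d) (mu : {sigma_finite_measure set T -> \bar R}).
Implicit Types (f : T -> R) (K : T * T -> R).

(** A squared Gagliardo seminorm with a general kernel in place of a power of the distance. Extended
    values allow it to be written before any finiteness is known. *)
Definition gag K f : \bar R :=
  (\int[mu \x mu]_z ((f z.1 - f z.2) ^+ 2 * K z)%:E)%E.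

Variables (K : T * T -> R) (c : R).
Hypotheses (mK : measurable_fun setT K) (K0 : forall z, 0 <= K z).
Hypotheses (KC : forall x y, K (x, y) = K (y, x)).
Hypothesis (intK : forall x, (\int[mu]_y (K (x, y))%:E = c%:E)%E).

Lemma measurable_gag_integrand f : measurable_fun setT f ->
  measurable_fun setT (fun z : T * T => (f z.1 - f z.2) ^+ 2 * K z).
Proof.
move=> mf; apply: measurable_funM => //.
apply: measurable_funX; apply: measurable_funB; apply: (measurableT_comp mf); meas_proj.
Qed.

Lemma gag_integrand_ge0 f z : 0 <= (f z.1 - f z.2) ^+ 2 * K z.
Proof. by rewrite mulr_ge0// ?sqr_ge0. Qed.

Lemma gag_ge0 f : (0 <= gag K f)%E.
Proof. by apply: integral_ge0 => z _; rewrite lee_fin gag_integrand_ge0. Qed.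

Lemma measurable_sqr1K f : measurable_fun setT f ->
  measurable_fun setT (fun z : T * T => ((f z.1) ^+ 2 * K z)%:E).
Proof.
move=> mf; apply/measurable_EFinP/measurable_funM => //.
by apply: measurable_funX; exact: (measurableT_comp mf measurable_fst).
Qed.

Lemma measurable_sqr2K f : measurable_fun setT f ->
  measurable_fun setT (fun z : T * T => ((f z.2) ^+ 2 * K z)%:E).
Proof.
move=> mf; apply/measurable_EFinP/measurable_funM => //.
by apply: measurable_funX; exact: (measurableT_comp mf measurable_snd).
Qed.

Lemma integral_sqr1K f : measurable_fun setT f ->
  (\int[mu \x mu]_z ((f z.1) ^+ 2 * K z)%:E = c%:E * \int[mu]_x ((f x) ^+ 2)%:E)%E.
Proof.
move=> mf.
have mf2 : measurable_fun setT (fun x => ((f x) ^+ 2)%:E).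
  by apply/measurable_EFinP; exact: measurable_funX.
rewrite fubini_tonelli1//; last 2 first.
- exact: measurable_sqr1K.
- by move=> z; rewrite lee_fin mulr_ge0 ?sqr_ge0.
rewrite /fubini_F/=.
under eq_integral => x _.
  under eq_integral do rewrite EFinM.
  rewrite ge0_integralZl//; last 3 first.
  - by apply/measurable_EFinP; exact: measurableT_comp mK (measurable_pair1 x).
  - by move=> y _; rewrite lee_fin.
  - by rewrite lee_fin sqr_ge0.
  rewrite intK; over.
rewrite ge0_integralZr//; last 2 first.
- by move=> t _; rewrite lee_fin sqr_ge0.
- by rewrite -(intK point); apply: integral_ge0 => y _; rewrite lee_fin.
by rewrite muleC.
Qed.

Lemma integral_sqr2K f : measurable_fun setT f ->
  (\int[mu \x mu]_z ((f z.2) ^+ 2 * K z)%:E = c%:E * \int[mu]_x ((f x) ^+ 2)%:E)%E.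
Proof.
move=> mf; rewrite -(integral_sqr1K mf).
rewrite (@fubini_tonelli1 _ _ _ _ _ _ _ (fun z => ((f z.1) ^+ 2 * K z)%:E)); last 2 first.
- exact: measurable_sqr1K.
- by move=> z; rewrite lee_fin mulr_ge0 ?sqr_ge0.
rewrite (@fubini_tonelli2 _ _ _ _ _ _ _ (fun z => ((f z.2) ^+ 2 * K z)%:E)); last 2 first.
- exact: measurable_sqr2K.
- by move=> z; rewrite lee_fin mulr_ge0 ?sqr_ge0.
rewrite /fubini_F /fubini_G /=.
by apply: eq_integral => x _; apply: eq_integral => y _; rewrite KC.
Qed.

Lemma intK_ge0 : 0 <= c.
Proof. by rewrite -lee_fin -(intK point); apply: integral_ge0 => y _; rewrite lee_fin. Qed.

Lemma integral_sqrK f : measurable_fun setT f ->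
  (\int[mu \x mu]_z (((f z.1) ^+ 2 + (f z.2) ^+ 2) * K z)%:E =
   (2 * c)%:E * \int[mu]_x ((f x) ^+ 2)%:E)%E.
Proof.
move=> mf; under eq_integral do rewrite mulrDl EFinD.
rewrite ge0_integralD//; last 4 first.
- by move=> z _; rewrite lee_fin mulr_ge0 ?sqr_ge0.
- exact: measurable_sqr1K.
- by move=> z _; rewrite lee_fin mulr_ge0 ?sqr_ge0.
- exact: measurable_sqr2K.
rewrite integral_sqr1K// integral_sqr2K// -ge0_muleDl ?lee_fin ?intK_ge0//.
by rewrite -EFinD; congr (_%:E * _)%E; ring.
Qed.

Lemma gag_leD f g : measurable_fun setT f -> measurable_fun setT g ->
  (gag K (f \+ g)%R <= 2%:E * gag K f + 2%:E * gag K g)%E.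
Proof.
move=> mf mg.
have mf' := measurable_gag_integrand mf; have mg' := measurable_gag_integrand mg.
rewrite /gag -!ge0_integralZl//; first last.
- by move=> z _; rewrite lee_fin gag_integrand_ge0.
- exact/measurable_EFinP.
- by move=> z _; rewrite lee_fin gag_integrand_ge0.
- exact/measurable_EFinP.
rewrite -ge0_integralD//; first last.
- by apply: emeasurable_funM => //; exact/measurable_EFinP.
- by move=> z _; rewrite mule_ge0// lee_fin gag_integrand_ge0.
- by apply: emeasurable_funM => //; exact/measurable_EFinP.
- by move=> z _; rewrite mule_ge0// lee_fin gag_integrand_ge0.
apply: ge0_le_integral => //.
- by move=> z _; rewrite lee_fin gag_integrand_ge0.
- by apply/measurable_EFinP; apply: measurable_gag_integrand; exact: measurable_funD.
- by apply: emeasurable_funD; apply: emeasurable_funM => //; exact/measurable_EFinP.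
- move=> z _; rewrite -!EFinM -EFinD lee_fin !mulrA -mulrDl ler_wpM2r//=.
  by have := sqr_ge0 ((f z.1 - f z.2) - (g z.1 - g z.2)); lra.
Qed.

(** The bound sees [K] only through its mass [c], hence is uniform along a family of kernels of
    equal mass. *)
Lemma gag_le f : measurable_fun setT f ->
  (gag K f <= (4 * c)%:E * \int[mu]_x ((f x) ^+ 2)%:E)%E.
Proof.
move=> mf.
have -> : ((4 * c)%:E * \int[mu]_x ((f x) ^+ 2)%:E =
    \int[mu \x mu]_z (2%:E * (((f z.1) ^+ 2 + (f z.2) ^+ 2) * K z)%:E))%E.
  rewrite ge0_integralZl//; last 2 first.
  - under eq_fun do rewrite mulrDl EFinD.
    by apply: emeasurable_funD; [exact: measurable_sqr1K|exact: measurable_sqr2K].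
  - by move=> z _; rewrite lee_fin mulr_ge0// addr_ge0 ?sqr_ge0.
  by rewrite integral_sqrK// muleA -EFinM mulrA; congr (_%:E * _)%E; ring.
apply: ge0_le_integral => //.
- by move=> z _; rewrite lee_fin gag_integrand_ge0.
- by apply/measurable_EFinP; exact: measurable_gag_integrand.
- apply: emeasurable_funM => //; under eq_fun do rewrite mulrDl EFinD.
  by apply: emeasurable_funD; [exact: measurable_sqr1K|exact: measurable_sqr2K].
- move=> z _; rewrite -EFinM lee_fin mulrA ler_wpM2r//.
  by have := sqr_ge0 (f z.1 + f z.2); lra.
Qed.

End gagliardo.

(** * Fourier integrals and the Plancherel transform *)

Section plancherel_identity.
Context {R : realType} d1 d2 (T : measurableType d1) (S : measurableType d2).
Variables (mu : {sigma_finite_measure set T -> \bar R})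
          (nu : {sigma_finite_measure set S -> \bar R}) (ph : T -> S -> R).
Hypothesis mph : measurable_fun setT (fun z : T * S => ph z.1 z.2).
Implicit Types (f : T -> R) (k : S).

Lemma measurable_cos : measurable_fun setT (@cos R).
Proof. exact: continuous_measurable_fun (@continuous_cos R). Qed.

Lemma measurable_sin : measurable_fun setT (@sin R).
Proof. exact: continuous_measurable_fun (@continuous_sin R). Qed.

Lemma measurable_phaser k : measurable_fun setT (fun x => ph x k).
Proof. exact: (measurableT_comp mph (measurable_pair2 k)). Qed.

Definition fourier_cos f k : R := \int[mu]_z (f z * cos (ph z k)).
Definition fourier_sin f k : R := \int[mu]_z (f z * sin (ph z k)).
Definition fourier_sqr f k : R := fourier_cos f k ^+ 2 + fourier_sin f k ^+ 2.

Lemma norm_cos_le1 (t : R) : `|cos t| <= 1.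
Proof. by rewrite ler_norml cos_geN1 cos_le1. Qed.

Lemma norm_sin_le1 (t : R) : `|sin t| <= 1.
Proof. by rewrite ler_norml sin_geN1 sin_le1. Qed.

Lemma integrable_cos f k : mu.-integrable setT (EFin \o f) ->
  mu.-integrable setT (fun z => (f z * cos (ph z k))%:E).
Proof.
move=> fi; apply: (@integrable_mul_bounded _ _ _ _ _ _ 1) => //.
- exact: measurableT_comp measurable_cos (measurable_phaser k).
- by move=> x; exact: norm_cos_le1.
Qed.

Lemma integrable_sin f k : mu.-integrable setT (EFin \o f) ->
  mu.-integrable setT (fun z => (f z * sin (ph z k))%:E).
Proof.
move=> fi; apply: (@integrable_mul_bounded _ _ _ _ _ _ 1) => //.
- exact: measurableT_comp measurable_sin (measurable_phaser k).
- by move=> x; exact: norm_sin_le1.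
Qed.

Lemma fourier_sqrE f k : mu.-integrable setT (EFin \o f) ->
  (fourier_sqr f k)%:E =
  (\int[mu \x mu]_z (f z.1 * f z.2 * cos (ph z.1 k - ph z.2 k))%:E)%E.
Proof.
move=> fi; have ic := integrable_cos k fi; have isn := integrable_sin k fi.
rewrite /fourier_sqr EFinD !expr2 !EFinM.
rewrite -(integral_tensor ic ic) -(integral_tensor isn isn).
rewrite -integralD//=; [|exact: (integrable_tensor ic ic)|exact: (integrable_tensor isn isn)].
apply: eq_integral => z _; rewrite -EFinD; congr EFin.
by rewrite cosB; ring.
Qed.

Variables (w : S -> R) (K : T * T -> R) (c B : R).
Hypotheses (w_int : nu.-integrable setT (EFin \o w)).
Hypothesis wK : forall x y,
  (\int[nu]_k (w k * cos (ph x k - ph y k))%:E = (K (x, y))%:E)%E.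

(** The addition formula for cosine writes the squared modulus of the transform as a double integral
    ([fourier_sqrE]). The weight makes the integrand jointly integrable in k, x and y, so the order
    can be exchanged; integrating first in k produces the kernel. *)
Lemma integral_wt_fourier_sqr f : mu.-integrable setT (EFin \o f) ->
  (\int[nu]_k (w k * fourier_sqr f k)%:E =
   \int[mu \x mu]_z (f z.1 * f z.2 * K z)%:E)%E.
Proof.
move=> fi.
pose H (w' : S * (T * T)) :=
  (w w'.1 * (f w'.2.1 * f w'.2.2) * cos (ph w'.2.1 w'.1 - ph w'.2.2 w'.1))%:E.
have mcos : measurable_fun setT (fun w' : S * (T * T) =>
     cos (ph w'.2.1 w'.1 - ph w'.2.2 w'.1)).
  apply: (measurableT_comp measurable_cos).
  apply: measurable_funB.
  - apply: (@measurableT_comp _ _ _ _ _ _ _ _ (fun w' : S * (T * T) => (w'.2.1, w'.1)) mph).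
    by apply: measurable_fun_pair; meas_proj.
  - apply: (@measurableT_comp _ _ _ _ _ _ _ _ (fun w' : S * (T * T) => (w'.2.2, w'.1)) mph).
    by apply: measurable_fun_pair; meas_proj.
have ffi := integrable_tensor fi fi.
have iH : (nu \x prodm mu mu)%E.-integrable setT H.
  have wff := integrable_tensor (m2 := prodm mu mu) (g := w)
    (h := fun z : T * T => f z.1 * f z.2) w_int ffi.
  apply: (integrable_mul_bounded wff mcos (C := 1)).
  by move=> w'; exact: norm_cos_le1.
have := Fubini iH.
rewrite (_ : (\int[nu]_x _)%E = (\int[nu]_k (w k * fourier_sqr f k)%:E)%E); last first.
  apply: eq_integral => k _.
  under eq_integral do rewrite /H /= -mulrA EFinM.
  rewrite integralZl//; last first.
    apply: (@integrable_mul_bounded _ _ _ _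
      (fun z => (f z.1 * f z.2)) (fun z => cos (ph z.1 k - ph z.2 k)) 1) => //.
    + exact: (measurableT_comp mcos (measurable_pair1 k)).
    + by move=> w'; exact: norm_cos_le1.
  by rewrite -fourier_sqrE// EFinM.
move=> ->; apply: eq_integral => -[x y] _.
under eq_integral do rewrite /H /= mulrAC mulrC EFinM.
rewrite integralZl//; last first.
  apply: (@integrable_mul_bounded _ _ _ _
    w (fun k => cos (ph x k - ph y k)) 1) => //.
  - exact: (measurableT_comp mcos (measurable_pair2 (x, y))).
  - by move=> w'; exact: norm_cos_le1.
by rewrite EFinM wK.
Qed.

Hypotheses (mK : measurable_fun setT K) (K0 : forall z, 0 <= K z).
Hypotheses (KC : forall x y, K (x, y) = K (y, x)) (KB : forall z, K z <= B).
Hypothesis (intK : forall x, (\int[mu]_y (K (x, y))%:E = c%:E)%E).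

(* Plancherel's identity, regularised by the weight [w]. *)
Lemma gag_fourier f :
  mu.-integrable setT (EFin \o f) -> mu.-integrable setT (fun x => ((f x) ^+ 2)%:E) ->
  (gag mu K f + 2%:E * \int[nu]_k (w k * fourier_sqr f k)%:E =
   (2 * c)%:E * \int[mu]_x ((f x) ^+ 2)%:E)%E.
Proof.
move=> fi f2i.
have mf : measurable_fun setT f by apply/measurable_EFinP; exact: measurable_int fi.
have KN z : `|K z| <= B by rewrite ger0_norm.
have iG : (mu \x mu)%E.-integrable setT (fun z => (f z.1 * f z.2 * K z)%:E).
  apply: (@integrable_mul_bounded _ _ _ _ (fun z => f z.1 * f z.2) K B) => //.
  exact: (integrable_tensor fi fi).
have ig : (mu \x mu)%E.-integrable setT (fun z => ((f z.1 - f z.2) ^+ 2 * K z)%:E).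
  apply/integrableP; split.
    by apply/measurable_EFinP; exact: measurable_gag_integrand.
  under eq_integral do rewrite gee0_abs ?lee_fin ?gag_integrand_ge0//.
  apply: le_lt_trans (gag_le mK K0 KC intK mf) _.
  rewrite lte_mul_pinfty// ?lee_fin ?mulr_ge0 ?(intK_ge0 K0 intK)//.
  by have /integrableP[_] := f2i; under eq_integral do rewrite gee0_abs ?lee_fin ?sqr_ge0//.
rewrite integral_wt_fourier_sqr// -integralZl//.
rewrite /gag -integralD//; last exact: integrableZl.
(* Pointwise, (a - b)^2 + 2 a b = a^2 + b^2; the rest is the mass of the kernel. *)
rewrite -(integral_sqrK mK K0 KC intK mf).
apply: eq_integral => z _; rewrite -EFinM -!EFinD; congr EFin; ring.
Qed.

End plancherel_identity.

Lemma cvge0_le {R : realType} (u : nat -> \bar R) : (forall n, (0 <= u n)%E) ->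
  (forall e : R, 0 < e -> \forall n \near \oo, (u n <= e%:E)%E) ->
  u n @[n --> \oo] --> 0%E.
Proof.
move=> u0 H; apply/fine_cvgP; split.
  near=> n; rewrite ge0_fin_numE//; apply: (@le_lt_trans _ _ 1%:E); last exact: ltry.
  by near: n; exact: H.
apply/cvgrPdist_le => e e0; near=> n.
rewrite sub0r normrN ger0_norm ?fine_ge0//.
have h : (u n <= e%:E)%E by near: n; exact: H.
rewrite -lee_fin fineK// ge0_fin_numE//; exact: le_lt_trans h (ltry _).
Unshelve. all: by end_near. Qed.

Lemma cvge0_near_le {R : realType} (u : nat -> \bar R) (e : R) : 0 < e ->
  u n @[n --> \oo] --> 0%E -> \forall n \near \oo, (u n <= e%:E)%E.
Proof.
move=> e0 /fine_cvgP[uf /cvgrPdist_le /(_ e e0)]; apply: filterS2 uf => n uf.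
rewrite sub0r normrN /= => h; rewrite -(fineK uf) lee_fin.
exact: le_trans (ler_norm _) h.
Qed.

(** * Energies with respect to a concentrating kernel *)

Section vanishing.
Import HBNNSimple.
Context {R : realType} d (T : measurableType d) (mu : {sigma_finite_measure set T -> \bar R}).
Variables (K : nat -> T * T -> R) (c : R).
Hypotheses (mK : forall n, measurable_fun setT (K n)) (K0 : forall n z, 0 <= K n z).
Hypotheses (KC : forall n x y, K n (x, y) = K n (y, x)).
Hypothesis (intK : forall n x, (\int[mu]_y (K n (x, y))%:E = c%:E)%E).
Implicit Types (f g : T -> R).

(** A form of continuity of translations in mean when the [K n] concentrate on the diagonal. It
    supplies the lower half of Plancherel's identity. *)
Definition vanishing f := gag mu (K n) f @[n --> \oo] --> 0%E.

Lemma vanishingD f g : measurable_fun setT f -> measurable_fun setT g ->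
  vanishing f -> vanishing g -> vanishing (f \+ g).
Proof.
move=> mf mg vf vg.
have : (2%:E * gag mu (K n) f + 2%:E * gag mu (K n) g)%E @[n --> \oo] --> 0%E.
  rewrite -[X in _ --> X]adde0; apply: cvgeD => //.
    by rewrite -[X in _ --> X](mule0 2%:E); apply: cvgeZl.
  by rewrite -[X in _ --> X](mule0 2%:E); apply: cvgeZl.
apply: (@squeeze_cvge _ _ _ _ (cst 0%E)); last exact: cvg_cst.
by apply: nearW => n; rewrite gag_ge0//= gag_leD.
Qed.

Lemma vanishingZ (r : R) f : measurable_fun setT f -> vanishing f ->
  vanishing (fun x => r * f x).
Proof.
move=> mf vf; rewrite /vanishing.
have E n : gag mu (K n) (fun x => r * f x) = ((r ^+ 2)%:E * gag mu (K n) f)%E.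
  rewrite /gag -ge0_integralZl//; last 3 first.
  - by apply/measurable_EFinP; exact: measurable_gag_integrand.
  - by move=> z _; rewrite lee_fin gag_integrand_ge0.
  - by rewrite lee_fin sqr_ge0.
  by apply: eq_integral => z _; rewrite -EFinM; congr EFin; ring.
rewrite (_ : (fun n => gag mu (K n) (fun x => r * f x)) =
  (fun n => ((r ^+ 2)%:E * gag mu (K n) f)%E)); last exact/funext.
by rewrite -[X in _ --> X](mule0 (r ^+ 2)%:E); apply: cvgeZl.
Qed.

Lemma vanishing0 : vanishing (cst 0).
Proof.
rewrite /vanishing /gag; under eq_fun do under eq_integral do rewrite /= subrr expr0n mul0r.
by under eq_fun do rewrite integral0; exact: cvg_cst.
Qed.

Lemma vanishing_sum (I : Type) (s : seq I) (F : I -> T -> R) :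
  (forall i, measurable_fun setT (F i)) -> (forall i, vanishing (F i)) ->
  vanishing (fun x => \sum_(i <- s) F i x).
Proof.
move=> mF vF; elim: s => [|i s ih].
  by under eq_fun do rewrite big_nil; exact: vanishing0.
under eq_fun do rewrite big_cons.
by apply: vanishingD => //; exact: measurable_sum.
Qed.

(** Vanishing is closed under limits in L^2, because [gag_le] bounds the energy of [f - g] by the
    L^2 norm uniformly in n. *)
Lemma vanishing_approx f : measurable_fun setT f ->
  (forall e : R, 0 < e -> exists g, [/\ measurable_fun setT g, vanishing g &
    (\int[mu]_x ((f x - g x) ^+ 2)%:E <= e%:E)%E]) ->
  vanishing f.
Proof.
move=> mf H; apply: cvge0_le => [n|e e0]; first exact: gag_ge0.
have c0 := intK_ge0 (K0 0%N) (intK 0%N).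
(* The difference [f - g] costs a factor 2 in [gag_leD] and 4 c in [gag_le], so this tolerance
   leaves at most e / 2. Writing [c + 1] keeps the denominator positive when [c] is 0. *)
have [g [mg vg fg]] := H (e / (16 * (c + 1))) ltac:(by rewrite divr_gt0// mulr_gt0// ltr_wpDl).
have e40 : 0 < e / 4 by rewrite divr_gt0.
have := cvge0_near_le e40 vg; apply: filterS => n gn.
have mfg : measurable_fun setT (fun x => f x - g x) by exact: measurable_funB.
have -> : f = (fun x => f x - g x) \+ g by apply/funext => x /=; rewrite subrK.
apply: le_trans (gag_leD mu (mK n) (K0 n) mfg mg) _.
apply: (@le_trans _ _ ((e / 2)%:E + (e / 2)%:E)%E); last by rewrite -EFinD -splitr.
apply: leeD.
  apply: (@le_trans _ _ (2%:E * ((4 * c)%:E * (e / (16 * (c + 1)))%:E))%E).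
    apply: lee_pmul => //; first exact: gag_ge0.
    apply: le_trans (gag_le (mK n) (K0 n) (KC n) (intK n) mfg) _.
    by apply: lee_pmul => //; rewrite ?lee_fin ?mulr_ge0//; apply: integral_ge0 => x _; rewrite lee_fin sqr_ge0.
  rewrite -!EFinM lee_fin.
  rewrite (_ : 2 * _ = e / 2 * (c / (c + 1))); last by field; rewrite gt_eqF// ltr_wpDl.
  by rewrite ler_piMr// ?divr_ge0 ?(ltW e0)// ler_pdivrMr ?ltr_wpDl// mul1r lerDl.
apply: le_trans (lee_pmul _ _ (lexx 2%:E) gn) _ => //; first exact: gag_ge0.
by rewrite -EFinM lee_fin; lra.
Qed.

Variables (G : set (set T)) (Q : set T).
Hypotheses (GE : @measurable _ T = <<s G >>) (GI : setI_closed G).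
Hypotheses (mQ : measurable Q) (Qfin : (mu Q < +oo)%E).
Hypotheses (vQ : vanishing (\1_Q)) (vG : forall A, G A -> vanishing (\1_(A `&` Q))).

Lemma integral_sqr_indic (A : set T) : measurable A ->
  (\int[mu]_x ((\1_A x : R) ^+ 2)%:E = mu A)%E.
Proof.
move=> mA; transitivity (\int[mu]_x (\1_A x)%:E)%E; last by rewrite integral_indic// setIT.
apply: eq_integral => x _.
by rewrite indicE; case: (x \in A); rewrite ?expr1n// expr0n.
Qed.

(** Dynkin's theorem inside [Q]: complements are subtracted from the indicator of [Q], and a
    countable disjoint union is an L^2 limit of its partial unions because [Q] has finite
    measure. *)
Lemma vanishing_indic (A : set T) : measurable A -> vanishing (\1_(A `&` Q)).
Proof.
rewrite GE; apply: (dynkin_induction (P := fun A => vanishing (\1_(A `&` Q))) GE GI) => //.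
- by rewrite setTI.
- move=> S mS vS.
  have -> : \1_(~` S `&` Q) = (\1_Q : T -> R) \+ (fun x => -1 * \1_(S `&` Q) x).
    apply/funext => x /=; rewrite !indicE !in_setI in_setC.
    by case: (x \in S); case: (x \in Q); rewrite /= ?mulr1 ?mulr0 ?addr0 ?subrr.
  have mSQ : measurable_fun setT (\1_(S `&` Q) : T -> R).
    by apply: measurable_indic; exact: measurableI.
  by apply: vanishingD => //; [exact: measurable_funM|exact: vanishingZ].
- move=> F mF tF vF; apply: vanishing_approx => [|e e0].
    by apply: measurable_indic; apply: measurableI => //; exact: bigcup_measurable.
  pose U n := \big[setU/set0]_(i < n) F i.
  have mU n : measurable (U n) by exact: bigsetU_measurable.
  have ndU : nondecreasing_seq U by move=> n m nm; apply/subsetPset; exact: subset_bigsetU.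
  have UE : \bigcup_n U n = \bigcup_k F k.
    rewrite eqEsubset; split => [x [n _]|x [k _ Fk]].
      by rewrite /U -bigcup_mkord => -[k _ Fk]; exists k.
    by exists k.+1 => //; exact: (bigsetU_sup (ltnSn k)).
  (* The squared L^2 distance from the indicator of the union to that of the partial union is this
     measure; continuity from above sends it to 0. *)
  have : mu (~` U n `&` (\bigcup_k F k `&` Q)) @[n --> \oo] --> 0%E.
    rewrite (_ : 0%E = mu (\bigcap_n (~` U n `&` (\bigcup_k F k `&` Q)))); last first.
      rewrite -[LHS](measure0 mu); congr (mu _); apply/esym; rewrite -subset0 => x Ux.
      have [_ [[k _ Fk] _]] := Ux 0%N I.
      have : (\bigcup_n U n) x by rewrite UE; exists k.
      by move=> [n _ Un]; have [] := Ux n I.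
    apply: nonincreasing_cvg_mu => //.
    - apply: le_lt_trans Qfin; apply: le_measure; rewrite ?inE//.
        apply: measurableI; first exact: measurableC.
        by apply: measurableI => //; exact: bigcup_measurable.
      by move=> x [_ []].
    - move=> n; apply: measurableI; first exact: measurableC.
      by apply: measurableI => //; exact: bigcup_measurable.
    - apply: bigcap_measurable => // n _; apply: measurableI; first exact: measurableC.
      by apply: measurableI => //; exact: bigcup_measurable.
    - move=> n m nm; apply/subsetPset => x [nU ?]; split => // Un; apply: nU.
      by move: Un; have /subsetPset := ndU _ _ nm; apply.
  move=> /(cvge0_near_le e0)[N _ /(_ N (leqnn _))/= HN].
  exists (\1_(U N `&` Q)); split.
  + by apply: measurable_indic; exact: measurableI.
  + have -> : \1_(U N `&` Q) = (fun x => \sum_(0 <= i < N) (\1_(F i `&` Q) x : R)).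
      apply/funext => x; rewrite /U.
      elim: N {HN} => [|N ih]; first by rewrite big_ord0 big_geq// set0I indic0.
      rewrite big_nat_recr//= -ih big_ord_recr/= !indicE !in_setI in_setU.
      have : x \in \big[setU/set0]_(i < N) F i -> x \notin F N.
        rewrite -bigcup_mkord inE => -[i/= iN Fi]; apply/negP; rewrite inE => FN.
        have := (trivIsetP.1 tF) i N I I; rewrite neq_ltn iN => /(_ isT) FF.
        by suff : set0 x by []; rewrite -FF.
      case: (x \in \big[setU/set0]_(i < N) F i) => [/(_ isT)/negbTE ->|_].
        by rewrite orTb andFb addr0.
      by rewrite orFb andFb add0r.
    apply: vanishing_sum => i; last exact: vF.
    by apply: measurable_indic; exact: measurableI.
  + apply: le_trans HN; rewrite -integral_sqr_indic; last first.
      apply: measurableI; first exact: measurableC.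
      by apply: measurableI => //; exact: bigcup_measurable.
    rewrite le_eqVlt; apply/orP; left; apply/eqP/eq_integral => x _; congr (_ ^+ 2)%:E.
    rewrite !indicE !in_setI in_setC.
    have : x \in U N -> x \in \bigcup_k F k.
      by rewrite !inE -UE => ?; exists N.
    case: (x \in U N) => [->//|_]; last by rewrite subr0.
    by case: (x \in Q); rewrite subrr.
Qed.

Lemma vanishing_nnsfun (g : {nnsfun T >-> R}) : vanishing (fun x => g x * \1_Q x).
Proof.
pose s := finmap.enum_fset (fset_set (range g)).
pose F (i : 'I_(size s)) (x : T) := s`_i * \1_(g @^-1` [set s`_i] `&` Q) x : R.
have mA i : measurable (g @^-1` [set s`_i] `&` Q) by exact: measurableI.
have -> : (fun x => g x * \1_Q x) = (fun x => \sum_(i <- index_enum 'I_(size s)) F i x).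
  apply/funext => x; rewrite {1}(fimfunEord g x) big_distrl/=; apply: eq_bigr => i _.
  by rewrite /F indicI/= mulrA.
apply: vanishing_sum => i.
- by apply: measurable_funM => //; exact: measurable_indic.
- by apply: vanishingZ; [exact: measurable_indic|exact: vanishing_indic].
Qed.

(** Simple functions increase to [f], and dominated convergence with bound f^2 makes the
    approximation hold in L^2. *)
Lemma vanishing_ge0 f : measurable_fun setT f -> (forall x, 0 <= f x) ->
  mu.-integrable setT (fun x => ((f x) ^+ 2)%:E) -> vanishing (fun x => f x * \1_Q x).
Proof.
move=> mf f0 fi.
have mfE : measurable_fun setT (EFin \o f) by exact/measurable_EFinP.
have m1 : measurable_fun setT (\1_Q : T -> R) by exact: measurable_indic.
have mfQ : measurable_fun setT (fun x => f x * \1_Q x) by exact: measurable_funM.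
apply: vanishing_approx => // e e0.
pose g n := nnsfun_approx measurableT mfE n.
have gf n x : g n x <= f x.
  rewrite -lee_fin nnsfun_approxE.
  by apply: (@le_approx _ _ _ setT (EFin \o f)) => // y _; rewrite lee_fin.
have gc x : g n x @[n --> \oo] --> f x.
  have f0E y : setT y -> (0 <= (EFin \o f) y)%E by rewrite lee_fin.
  by have /fine_cvgP[] := cvg_nnsfun_approx measurableT mfE f0E (I : setT x).
have mgf n : measurable_fun setT (fun x => ((f x - g n x) ^+ 2)%:E).
  by apply/measurable_EFinP; apply: measurable_funX; exact: measurable_funB.
have := @dominated_convergence _ _ _ mu setT measurableT (fun n x => ((f x - g n x) ^+ 2)%:E)
  (cst 0%E) (fun x => ((f x) ^+ 2)%:E) mgf (measurable_cst _).
case => //.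
- apply: aeW => x _; apply: cvg_EFin; first exact: nearW.
  rewrite (_ : 0 = (f x - f x) ^+ 2); last by rewrite subrr expr0n.
  apply: (@cvg_comp _ _ _ (fun n => f x - g n x) (fun t => t ^+ 2) _ (nbhs (f x - f x))).
    by apply: cvgB => //; exact: cvg_cst.
  exact: exprn_continuous.
- apply: aeW => x n _ /=; rewrite lee_fin ger0_norm ?sqr_ge0// lerXn2r ?nnegrE//.
    by rewrite subr_ge0.
  by rewrite lerBlDr lerDl.
move=> _ _; rewrite integral0.
move=> /(cvge0_near_le e0)[N _ /(_ N (leqnn _))/= HN].
exists (fun x => g N x * \1_Q x); split.
- by apply: measurable_funM.
- exact: vanishing_nnsfun.
- apply: le_trans HN; apply: ge0_le_integral => //.
  + by move=> x _; rewrite lee_fin sqr_ge0.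
  + apply/measurable_EFinP; apply: measurable_funX; apply: measurable_funB => //.
    exact: measurable_funM.
  + move=> x _; rewrite lee_fin -mulrBl exprMn indicE.
    by case: (x \in Q); rewrite ?expr1n ?mulr1// expr0n mulr0 sqr_ge0.
Qed.

Lemma vanishing_L2 f : measurable_fun setT f ->
  mu.-integrable setT (fun x => ((f x) ^+ 2)%:E) -> vanishing (fun x => f x * \1_Q x).
Proof.
move=> mf fi.
have H g : measurable_fun setT g -> (forall x, 0 <= g x <= `|f x|) ->
   vanishing (fun x => g x * \1_Q x).
  move=> mg gf; apply: vanishing_ge0 => //; first by move=> x; have /andP[] := gf x.
  apply: le_integrable fi => //.
    by apply/measurable_EFinP; exact: measurable_funX.
  move=> x _ /=; rewrite lee_fin !normrX lerXn2r ?nnegrE//.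
  by have /andP[h1 h2] := gf x; rewrite ger0_norm.
have -> : (fun x => f x * \1_Q x) = (fun x => Num.max (f x) 0 * \1_Q x) \+
   (fun x => -1 * (Num.max (- f x) 0 * \1_Q x)).
  apply/funext => x /=; rewrite mulrA mulN1r -mulrDl; congr (_ * _).
  by case: (lerP (f x) 0) => h; rewrite ?sub0r; case: lerP => h'; lra.
have m1 : measurable_fun setT (fun x => Num.max (f x) 0) by exact: measurable_maxr.
have m2 : measurable_fun setT (fun x => Num.max (- f x) 0).
  by apply: measurable_maxr => //; exact: measurable_funN.
have mQ1 : measurable_fun setT (\1_Q : T -> R) by exact: measurable_indic.
apply: vanishingD.
- exact: measurable_funM.
- by apply: measurable_funM => //; exact: measurable_funM.
- by apply: H => // x; rewrite le_max lexx orbT/= ge_max ler_norm normr_ge0.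
- apply: vanishingZ; first exact: measurable_funM.
  by apply: H => // x; rewrite le_max lexx orbT/= ge_max -normrN ler_norm normr_ge0.
Qed.

End vanishing.

Section tensor_ge0.
Context d1 d2 (T1 : measurableType d1) (T2 : measurableType d2) {R : realType}.
Variables (m1 : {sigma_finite_measure set T1 -> \bar R})
          (m2 : {sigma_finite_measure set T2 -> \bar R}).

Lemma ge0_integral_tensor (g : T1 -> \bar R) (h : T2 -> \bar R) :
  measurable_fun setT g -> measurable_fun setT h ->
  (forall x, 0 <= g x)%E -> (forall x, 0 <= h x)%E ->
  (\int[m1 \x m2]_z (g z.1 * h z.2) = (\int[m1]_x g x) * (\int[m2]_y h y))%E.
Proof.
move=> mg mh g0 h0.
rewrite fubini_tonelli1//=; last 2 first.
- apply: emeasurable_funM.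
    exact: (measurableT_comp mg measurable_fst).
  exact: (measurableT_comp mh measurable_snd).
- by move=> z; exact: mule_ge0.
rewrite /fubini_F/=; under eq_integral do rewrite ge0_integralZl//.
by rewrite ge0_integralZr// integral_ge0.
Qed.

End tensor_ge0.

Section tensor4.
Context d (T : measurableType d) {R : realType}.
Variables (m : {sigma_finite_measure set T -> \bar R}).

(** The pair of points is ((x1, x2), (y1, y2)), whereas [F] sees (x1, y1) and [G] sees (x2, y2).
    Tonelli's theorem regroups the four variables. *)
Lemma ge0_integral_tensor4 (F G : T * T -> R) :
  measurable_fun setT F -> measurable_fun setT G ->
  (forall x, 0 <= F x) -> (forall x, 0 <= G x) ->
  (\int[prodm m m \x prodm m m]_z (F (z.1.1, z.2.1) * G (z.1.2, z.2.2))%:E =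
  (\int[m \x m]_x (F x)%:E) * (\int[m \x m]_y (G y)%:E))%E.
Proof.
move=> mF mG F0 G0.
have mFG : measurable_fun setT (fun z : (T * T) * (T * T) =>
    (F (z.1.1, z.2.1) * G (z.1.2, z.2.2))%:E).
  apply/measurable_EFinP; apply: measurable_funM.
  - apply: (@measurableT_comp _ _ _ _ _ _ _ _ (fun z : (T * T) * (T * T) => (z.1.1, z.2.1)) mF).
    by apply: measurable_fun_pair; meas_proj.
  - apply: (@measurableT_comp _ _ _ _ _ _ _ _ (fun z : (T * T) * (T * T) => (z.1.2, z.2.2)) mG).
    by apply: measurable_fun_pair; meas_proj.
rewrite [LHS](@fubini_tonelli1 _ _ _ _ _ (prodm m m) (prodm m m) _ mFG); last first.
  by move=> z; rewrite lee_fin mulr_ge0.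
pose f x := (\int[m]_y (F (x, y))%:E)%E; pose g x := (\int[m]_y (G (x, y))%:E)%E.
have mf : measurable_fun setT f.
  by apply: (@measurable_fun_fubini_tonelli_F _ _ T T R m (EFin \o F)) => //; exact/measurable_EFinP.
have mg : measurable_fun setT g.
  by apply: (@measurable_fun_fubini_tonelli_F _ _ T T R m (EFin \o G)) => //; exact/measurable_EFinP.
have f0 x : (0 <= f x)%E by apply: integral_ge0 => y _; rewrite lee_fin.
have g0 x : (0 <= g x)%E by apply: integral_ge0 => y _; rewrite lee_fin.
transitivity (\int[m \x m]_z (f z.1 * g z.2))%E.
  apply: eq_integral => -[x1 x2] _; rewrite /fubini_F/=.
  rewrite -ge0_integral_tensor//.
  - by apply/measurable_EFinP; exact: measurableT_comp mF (measurable_pair1 x1).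
  - by apply/measurable_EFinP; exact: measurableT_comp mG (measurable_pair1 x2).
  - by move=> x; rewrite lee_fin.
  - by move=> x; rewrite lee_fin.
rewrite ge0_integral_tensor//; congr (_ * _)%E.
- by rewrite fubini_tonelli1//; exact/measurable_EFinP.
- by rewrite fubini_tonelli1//; exact/measurable_EFinP.
Qed.

(** The coordinates are changed one at a time: the difference of the product indicators is (1_A(x1)
    - 1_A(y1)) 1_B(x2) + 1_A(y1) (1_B(x2) - 1_B(y2)), and the square of a sum costs a factor 2. This
    reduces concentration in the plane to concentration on the line. *)
Lemma gag_tensor_indic (K : T * T -> R) (c : R) (A B : set T) :
  measurable_fun setT K -> (forall z, 0 <= K z) ->
  (forall x y, K (x, y) = K (y, x)) ->
  (forall x, (\int[m]_y (K (x, y))%:E = c%:E)%E) ->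
  measurable A -> measurable B ->
  (gag (prodm m m) (fun z : (T * T) * (T * T) => (K (z.1.1, z.2.1) * K (z.1.2, z.2.2))%R)
     (\1_(A `*` B) : T * T -> R) <=
   2%:E * (gag m K (\1_A) * (c%:E * m B)) + 2%:E * ((c%:E * m A) * gag m K (\1_B)))%E.
Proof.
move=> mK K0 KC intK mA mB.
have m1 (S : set T) : measurable S -> measurable_fun setT (\1_S : T -> R).
  by move=> mS; exact: measurable_indic.
pose F1 (z : T * T) := (\1_A z.1 - \1_A z.2) ^+ 2 * K z : R.
pose G1 (z : T * T) := (\1_B z.1) ^+ 2 * K z : R.
pose F2 (z : T * T) := (\1_A z.2) ^+ 2 * K z : R.
pose G2 (z : T * T) := (\1_B z.1 - \1_B z.2) ^+ 2 * K z : R.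
have mF1 : measurable_fun setT F1 by apply: measurable_gag_integrand => //; exact: m1.
have mG2 : measurable_fun setT G2 by apply: measurable_gag_integrand => //; exact: m1.
have mG1 : measurable_fun setT G1.
  by have /measurable_EFinP := measurable_sqr1K mK (m1 _ mB).
have mF2 : measurable_fun setT F2.
  by have /measurable_EFinP := measurable_sqr2K mK (m1 _ mA).
have F10 z : 0 <= F1 z by rewrite mulr_ge0 ?sqr_ge0.
have F20 z : 0 <= F2 z by rewrite mulr_ge0 ?sqr_ge0.
have G10 z : 0 <= G1 z by rewrite mulr_ge0 ?sqr_ge0.
have G20 z : 0 <= G2 z by rewrite mulr_ge0 ?sqr_ge0.
have IG1 : (\int[m \x m]_z (G1 z)%:E = c%:E * m B)%E.
  by rewrite (integral_sqr1K mK K0 intK (m1 _ mB)) integral_sqr_indic.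
have IF2 : (\int[m \x m]_z (F2 z)%:E = c%:E * m A)%E.
  by rewrite (integral_sqr2K mK K0 KC intK (m1 _ mA)) integral_sqr_indic.
rewrite -IG1 -IF2 {2 3}/gag -(ge0_integral_tensor4 mF1 mG1 F10 G10).
rewrite -(ge0_integral_tensor4 mF2 mG2 F20 G20).
have mt (F G : T * T -> R) : measurable_fun setT F -> measurable_fun setT G ->
  measurable_fun setT (fun z : (T * T) * (T * T) => (F (z.1.1, z.2.1) * G (z.1.2, z.2.2))%:E).
  move=> mF mG; apply/measurable_EFinP; apply: measurable_funM.
  - apply: (@measurableT_comp _ _ _ _ _ _ _ _ (fun z : (T * T) * (T * T) => (z.1.1, z.2.1)) mF).
    by apply: measurable_fun_pair; meas_proj.
  - apply: (@measurableT_comp _ _ _ _ _ _ _ _ (fun z : (T * T) * (T * T) => (z.1.2, z.2.2)) mG).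
    by apply: measurable_fun_pair; meas_proj.
rewrite -ge0_integralZl//; [|exact: mt|by move=> z _; rewrite lee_fin mulr_ge0].
rewrite -ge0_integralZl//; [|exact: mt|by move=> z _; rewrite lee_fin mulr_ge0].
rewrite -ge0_integralD//; last 4 first.
- by move=> z _; rewrite mule_ge0// lee_fin mulr_ge0.
- by apply: emeasurable_funM => //; exact: mt.
- by move=> z _; rewrite mule_ge0// lee_fin mulr_ge0.
- by apply: emeasurable_funM => //; exact: mt.
apply: ge0_le_integral => //.
- by move=> z _; rewrite lee_fin mulr_ge0 ?sqr_ge0// mulr_ge0.
- apply/measurable_EFinP; apply: measurable_gag_integrand.
    by apply/measurable_EFinP; exact: mt.
  by apply: measurable_indic; exact: measurableX.
- by apply: emeasurable_funD; apply: emeasurable_funM => //; exact: mt.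
- move=> -[[x1 x2] [y1 y2]] _; rewrite -!EFinM -EFinD lee_fin /F1 /F2 /G1 /G2/=.
  rewrite [leRHS](_ : _ = 2 * ((\1_A x1 - \1_A y1) ^+ 2 * \1_B x2 ^+ 2
     + \1_A y1 ^+ 2 * (\1_B x2 - \1_B y2) ^+ 2) * (K (x1, y1) * K (x2, y2))); last by ring.
  rewrite ler_wpM2r ?mulr_ge0// !indicE !in_setX/=.
  by case: (x1 \in A); case: (x2 \in B); case: (y1 \in A); case: (y2 \in B) => /=; lra.
Qed.

End tensor4.

(** * Concentration of the Poisson kernel on the diagonal *)

Section poisson_vanishing.
Context {R : realType}.
Notation mu := (@lebesgue_measure R).

Definition eps (n : nat) : R := n.+1%:R^-1.

Lemma eps_gt0 n : 0 < eps n. Proof. by rewrite invr_gt0. Qed.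

Definition poissonK (d : R) (z : R * R) : R := poisson d (z.1 - z.2).

Lemma measurable_poissonK d : 0 < d -> measurable_fun setT (poissonK d).
Proof.
move=> d0; apply: (measurableT_comp (measurable_poisson d0)).
by apply: measurable_funB; meas_proj.
Qed.

Lemma poissonK_ge0 d z : 0 < d -> 0 <= poissonK d z.
Proof. by move=> d0; exact: poisson_ge0. Qed.

Lemma poissonKC d x y : poissonK d (x, y) = poissonK d (y, x).
Proof. by rewrite /poissonK/= -opprB poissonN. Qed.

Lemma integral_poissonK d x : 0 < d -> (\int[mu]_y (poissonK d (x, y))%:E = (2 * pi)%:E)%E.
Proof. exact: integral_poisson. Qed.

Lemma cvg_atan_eps (t : R) : 0 < t -> 2 * atan (t / eps n) @[n --> \oo] --> pi.
Proof.
move=> t0; rewrite [X in _ --> X](_ : _ = 2 * (pi / 2)); last by field.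
apply: cvgMr; apply: (@cvg_comp _ _ _ (fun n => t / eps n) atan _ (+oo)); last exact: cvgy_atan.
apply/cvgryPge => A; near=> n.
rewrite invrK -ler_pdivrMl//; apply: (@le_trans _ _ n%:R); last by rewrite ler_nat.
near: n; exact: nbhs_infty_ger.
Unshelve. all: by end_near. Qed.

(** Expanding the square, the energy is twice the total mass 2 pi (b - a) minus twice [J n], the
    part of the mass of the kernel that stays in the square of the interval. The inner integral in
    [J n] is an explicit difference of arctangents. *)
Lemma vanishing_itv (a b : R) : a < b ->
  vanishing mu (fun n => poissonK (eps n)) (\1_(`]a, b]%classic)).
Proof.
move=> ab; set I := `]a, b]%classic.
have mI : measurable I by exact: measurable_itv.
have m1 : measurable_fun setT (\1_I : R -> R) by exact: measurable_indic.
have muI : mu I = (b - a)%:E by rewrite /I lebesgue_measure_itv/= lte_fin ab.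
pose g n x : R := 2 * atan ((b - x) / eps n) - 2 * atan ((a - x) / eps n).
(* The interval is opened because [g n x] tends to 2 pi only at interior points; at an endpoint the
   limit is pi. *)
pose J n : \bar R := (\int[mu]_(x in `]a, b[) (g n x)%:E)%E.
have mp n x : measurable_fun setT (fun t : R => (poisson (eps n) (x - t))%:E).
  apply/measurable_EFinP; apply: (measurableT_comp (measurable_poisson (eps_gt0 n))).
  by apply: measurable_funB; [exact: measurable_cst|exact: measurable_id].
have mg n : measurable_fun setT (g n).
  have ma (c : R) : measurable_fun setT (fun x : R => 2 * atan ((c - x) / eps n)).
    apply: measurable_funM => //; apply: (measurableT_comp (f := @atan R)).
      exact: continuous_measurable_fun (@continuous_atan R).
    by apply: measurable_funM => //; exact: measurable_funB.
  exact: measurable_funB.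
have mgE n D : measurable_fun D (EFin \o g n).
  by apply: measurable_funTS; apply/measurable_EFinP; exact: mg.
have mIK n : measurable_fun setT (fun z : R * R => (\1_I z.1 * \1_I z.2 * poissonK (eps n) z)%:E).
  apply/measurable_EFinP; apply: measurable_funM.
    by apply: measurable_tensor.
  exact: measurable_poissonK (eps_gt0 n).
have IK0 n z : 0 <= \1_I z.1 * \1_I z.2 * poissonK (eps n) z.
  by rewrite mulr_ge0 ?poissonK_ge0 ?eps_gt0// mulr_ge0.
have JE n : J n = (\int[mu \x mu]_z (\1_I z.1 * \1_I z.2 * poissonK (eps n) z)%:E)%E.
  rewrite /J integral_itv_bndo_bndc; last by apply: measurable_funTS; exact/measurable_EFinP.
  rewrite integral_mkcond fubini_tonelli1; [|exact: mIK|by move=> z; rewrite lee_fin].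
  apply: eq_integral => x _; rewrite /fubini_F patchE /=.
  case: ifPn => xI; last first.
    by rewrite -[LHS](integral0 mu setT); apply: eq_integral => y _; rewrite indicE (negbTE xI) !mul0r.
  transitivity (\int[mu]_(y in I) (poisson (eps n) (x - y))%:E)%E.
    rewrite integral_itv_obnd_cbnd; last exact: measurable_funTS.
    by rewrite integral_itv_poisson// eps_gt0.
  rewrite integral_mkcond; apply: eq_integral => y _; rewrite patchE /poissonK/= !indicE xI mul1r.
  by case: ifPn => _; rewrite ?mul1r ?mul0r.
have gagJ n : (gag mu (poissonK (eps n)) (\1_I) + 2%:E * J n =
    (2 * (2 * pi))%:E * (b - a)%:E)%E.
  have e0 := eps_gt0 n.
  rewrite -muI -(integral_sqr_indic mu mI).
  rewrite -(@integral_sqrK _ _ _ mu (poissonK (eps n))); last 5 first.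
  - exact: measurable_poissonK.
  - by move=> z; exact: poissonK_ge0.
  - exact: poissonKC.
  - by move=> x; exact: integral_poissonK.
  - exact: m1.
  rewrite JE -ge0_integralZl//; [|exact: mIK|by move=> z _; rewrite lee_fin].
  rewrite /gag -ge0_integralD//; last 4 first.
  - by move=> z _; rewrite lee_fin mulr_ge0 ?sqr_ge0// poissonK_ge0.
  - apply/measurable_EFinP; apply: measurable_gag_integrand => //.
    exact: measurable_poissonK.
  - by move=> z _; rewrite mule_ge0// lee_fin.
  - by apply: emeasurable_funM => //; exact: mIK.
  by apply: eq_integral => z _; rewrite -EFinM -EFinD; congr EFin; ring.
have Jlim : J n @[n --> \oo] --> ((2 * pi) * (b - a))%:E.
  have mD : measurable `]a, b[%classic by exact: measurable_itv.
  have muD : mu `]a, b[%classic = (b - a)%:E by rewrite lebesgue_measure_itv/= lte_fin ab.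
  have icst (r : R) : (\int[mu]_(x in `]a, b[) (cst r%:E) x = (r * (b - a))%:E)%E.
    by rewrite EFinM -muD; exact: integral_cst.
  have := @dominated_convergence _ _ _ mu _ mD (fun n x => (g n x)%:E) (cst (2 * pi)%:E) (cst (2 * pi)%:E).
  case.
  - by move=> n; exact: mgE.
  - exact: measurable_cst.
  - apply: aeW => x; rewrite /= in_itv/= => /andP[ax xb]; apply: cvg_EFin; first exact: nearW.
    have h1 : 2 * atan ((b - x) / eps n) @[n --> \oo] --> pi.
      by apply: cvg_atan_eps; rewrite subr_gt0.
    have h2 : 2 * atan ((a - x) / eps n) @[n --> \oo] --> - pi.
      have -> : (fun n => 2 * atan ((a - x) / eps n)) = (fun n => - (2 * atan ((x - a) / eps n))).
        by apply/funext => n; rewrite -(opprB x) mulNr atanN mulrN.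
      by apply: cvgN; apply: cvg_atan_eps; rewrite subr_gt0.
    rewrite (_ : 2 * pi = pi - - pi); last by ring.
    exact: (cvgB h1 h2).
  - apply/integrableP; split; first exact: measurable_cst.
    under eq_integral do rewrite /=.
    by have -> := icst `|2 * pi|; exact: ltry.
  - apply: aeW => x n _; rewrite /= lee_fin /g.
    have := atan_gtNpi2 ((b - x) / eps n); have := atan_ltpi2 ((b - x) / eps n).
    have := atan_gtNpi2 ((a - x) / eps n); have := atan_ltpi2 ((a - x) / eps n).
    by rewrite ler_norml; lra.
  - by rewrite icst.
rewrite /vanishing.
have [Jf jl] := (fine_cvgP _ _).1 Jlim.
have : (2 * (2 * pi) * (b - a) - 2 * fine (J n))%:E @[n --> \oo] --> 0%E.
  apply: cvg_EFin; first exact: nearW.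
  rewrite [X in _ --> X](_ : _ = 2 * (2 * pi) * (b - a) - 2 * (2 * pi * (b - a))); last by ring.
  by apply: cvgB; [exact: cvg_cst|exact: cvgMr].
apply: cvg_trans; apply: near_eq_cvg; apply: filterS Jf => n Jn.
rewrite EFinB EFinM -(gagJ n) EFinM fineK// addeK//.
by rewrite fin_numM.
Qed.

(** Half-open, so that the rays []x, +oo[] generating the Borel sets meet it in intervals of the
    form []a, b]] again; [m.+1] keeps it nonempty for every m. *)
Definition hseg (m : nat) : set R := `](- m.+1%:R), m.+1%:R]%classic.

Lemma measurable_hseg m : measurable (hseg m).
Proof. exact: measurable_itv. Qed.

Lemma hseg_fin m : (mu (hseg m) < +oo)%E.
Proof. by rewrite /hseg lebesgue_measure_itv/=; case: ifP => _; rewrite -?EFinB ltry. Qed.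

Lemma vanishing_hseg m (A : set R) : measurable A ->
  vanishing mu (fun n => poissonK (eps n)) (\1_(A `&` hseg m)).
Proof.
have m0 : - m.+1%:R < m.+1%:R :> R by rewrite gtrN.
apply: (@vanishing_indic _ _ _ mu (fun n => poissonK (eps n)) (2 * pi) _ _ _ _ (@RGenOInfty.G R)).
- by move=> n; exact: measurable_poissonK (eps_gt0 n).
- by move=> n z; exact: poissonK_ge0 (eps_gt0 n).
- by move=> n x y; exact: poissonKC.
- by move=> n x; exact: integral_poissonK (eps_gt0 n).
- exact: RGenOInfty.measurableE.
- move=> _ _ [x ->] [y ->]; exists (Num.max x y).
  apply/seteqP; split => z; rewrite /= !in_itv/= !andbT gt_max.
    by move=> [-> ->].
  by move=> /andP[].
- exact: measurable_hseg.
- exact: hseg_fin.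
- exact: vanishing_itv.
- move=> _ [x ->].
  have -> : `]x, +oo[ `&` hseg m = `](Num.max x (- m.+1%:R)), m.+1%:R]%classic.
    apply/seteqP; split => y; rewrite /hseg /= !in_itv/= andbT gt_max.
      by move=> [-> /andP[-> ->]].
    by move=> /andP[/andP[-> ->] ->].
  have [xm|xm] := ltP (Num.max x (- m.+1%:R)) m.+1%:R; first exact: vanishing_itv.
  by rewrite set_itv_ge ?bnd_simp -?leNgt// indic0; exact: vanishing0.
Qed.

Notation mu2 := (prodm mu mu).

Definition KerK (d : R) (z : (R * R) * (R * R)) : R := Ker d z.1 z.2.

Definition hsquare m := hseg m `*` hseg m.

Lemma measurable_hsquare m : measurable (hsquare m).
Proof. by apply: measurableX; exact: measurable_hseg. Qed.

Lemma hsquare_fin m : (mu2 (hsquare m) < +oo)%E.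
Proof.
rewrite /prodm product_measure1E; [|exact: measurable_hseg..].
by rewrite lte_mul_pinfty// ?hseg_fin// ge0_fin_numE// hseg_fin.
Qed.

Lemma vanishing_rect m (A B : set R) : measurable A -> measurable B ->
  vanishing mu2 (fun n => KerK (eps n)) (\1_((A `&` hseg m) `*` (B `&` hseg m))).
Proof.
move=> mA mB.
have mAQ : measurable (A `&` hseg m) by apply: measurableI => //; exact: measurable_hseg.
have mBQ : measurable (B `&` hseg m) by apply: measurableI => //; exact: measurable_hseg.
have fQ (S : set R) : measurable S -> mu (S `&` hseg m) \is a fin_num.
  move=> mS; rewrite ge0_fin_numE//; apply: le_lt_trans (hseg_fin m).
  apply: le_measure; rewrite ?inE//; [|exact: measurable_hseg].
  by apply: measurableI => //; exact: measurable_hseg.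
have vA := vanishing_hseg m mA; have vB := vanishing_hseg m mB.
rewrite /vanishing.
have : (2%:E * (gag mu (poissonK (eps n)) (\1_(A `&` hseg m)) * ((2 * pi)%:E * mu (B `&` hseg m))) +
  2%:E * (((2 * pi)%:E * mu (A `&` hseg m)) * gag mu (poissonK (eps n)) (\1_(B `&` hseg m))))%E
  @[n --> \oo] --> 0%E.
  have f2 (S : set R) : measurable S -> ((2 * pi)%:E * mu (S `&` hseg m))%E \is a fin_num.
    by move=> mS; rewrite fin_numM// fQ.
  rewrite -[X in _ --> X]adde0; apply: cvgeD => //.
    rewrite -[X in _ --> X](mule0 2%:E); apply: cvgeZl => //.
    rewrite -[X in _ --> X](mul0e ((2 * pi)%:E * mu (B `&` hseg m))).
    by apply: cvgeZr => //; exact: f2.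
  rewrite -[X in _ --> X](mule0 2%:E); apply: cvgeZl => //.
  rewrite -[X in _ --> X](mule0 ((2 * pi)%:E * mu (A `&` hseg m))).
  by apply: cvgeZl => //; exact: f2.
apply: (@squeeze_cvge _ _ _ _ (cst 0%E)); last exact: cvg_cst.
apply: nearW => n; rewrite gag_ge0/=; last first.
  by move=> z; rewrite /KerK Ker_ge0// eps_gt0.
apply: (@gag_tensor_indic _ _ _ mu (poissonK (eps n)) (2 * pi)) => //.
- exact: measurable_poissonK (eps_gt0 n).
- by move=> z; exact: poissonK_ge0 (eps_gt0 n).
- exact: poissonKC.
- by move=> x; exact: integral_poissonK (eps_gt0 n).
Qed.

Lemma vanishing_Ker m (f : R * R -> R) : measurable_fun setT f ->
  mu2.-integrable setT (fun x => ((f x) ^+ 2)%:E) ->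
  vanishing mu2 (fun n => KerK (eps n)) (fun x => f x * \1_(hsquare m) x).
Proof.
move=> mf fi.
apply: (@vanishing_L2 _ _ _ mu2 (fun n => KerK (eps n)) ((2 * pi) ^+ 2) _ _ _ _
   [set A `*` B | A in measurable & B in measurable]) => //.
- by move=> n; exact: measurable_Ker (eps_gt0 n).
- by move=> n z; rewrite /KerK Ker_ge0// eps_gt0.
- by move=> n x y; exact: KerC.
- by move=> n x; exact: integral_Ker (eps_gt0 n).
- exact: measurable_prod_measurableType.
- move=> X Y [X1 mX1 [X2 mX2 <-{X}]] [Y1 mY1 [Y2 mY2 <-{Y}]].
  exists (X1 `&` Y1); first exact: measurableI.
  by exists (X2 `&` Y2); [exact: measurableI|rewrite setXI].
- exact: measurable_hsquare.
- exact: hsquare_fin.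
- by have := @vanishing_rect m setT setT measurableT measurableT; rewrite !setTI.
- move=> _ [A mA [B mB <-]]; rewrite -setXI.
  exact: vanishing_rect.
Qed.

End poisson_vanishing.

Lemma limn_einf_le {R : realType} (u : nat -> \bar R) (l : \bar R) :
  (\forall n \near \oo, (u n <= l)%E) -> (limn_einf u <= l)%E.
Proof.
move=> [N _ Hu]; rewrite limn_einf_lim; apply: lime_le; first exact: is_cvg_einfs.
apply: nearW => n; apply: (@le_trans _ _ (u (maxn n N))); last by apply: Hu => /=; rewrite leq_maxr.
by apply: ereal_inf_lbound; exists (maxn n N) => //=; rewrite leq_maxl.
Qed.

Section fatou_le.
Context {R : realType} d (T : measurableType d) (m : {measure set T -> \bar R}).

(** The bound is asked only eventually and up to any slack [e], the form in which limits in mean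
    provide it. *)
Lemma fatou_le (f : nat -> T -> R) (g : T -> R) (B : \bar R) :
  (forall n, measurable_fun setT (f n)) -> (forall n x, 0 <= f n x) ->
  (forall x, f n x @[n --> \oo] --> g x) ->
  (forall e : R, 0 < e ->
     \forall n \near \oo, (\int[m]_x (f n x)%:E <= B + e%:E)%E) ->
  (\int[m]_x (g x)%:E <= B)%E.
Proof.
move=> mf f0 fg H; apply/lee_addgt0Pr => e e0.
have := fatou m measurableT (fun n => (measurable_EFinP _ _).2 (mf n)) (fun n x _ => f0 n x).
have -> : (\int[m]_x limn_einf (fun n => (EFin \o f n) x) = \int[m]_x (g x)%:E)%E.
  apply: eq_integral => x _.
  have [-> _] : (limn_einf (fun n => (f n x)%:E) = (g x)%:E) * (limn_esup (fun n => (f n x)%:E) = (g x)%:E).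
    by apply: cvg_limn_einf_sup; apply: cvg_EFin; [exact: nearW|exact: fg].
  by [].
move=> /le_trans; apply; apply: limn_einf_le; exact: H.
Qed.

End fatou_le.

(** * Plancherel's identity for functions supported in a square *)

Section plancherel.
Context {R : realType}.
Notation mu := (@lebesgue_measure R).
Notation mu2 := (prodm mu mu).
Implicit Types (f u : R * R -> R) (k : R * R) (d : R).

Lemma measurable_phase :
  measurable_fun setT (fun z : (R * R) * (R * R) => phase z.1 z.2).
Proof. by apply: measurable_funD; apply: measurable_funM; meas_proj. Qed.

Definition fcos f k : R := fourier_cos mu2 phase f k.
Definition fsin f k : R := fourier_sin mu2 phase f k.
Definition fsqr f k : R := fcos f k ^+ 2 + fsin f k ^+ 2.

Lemma fsqr_ge0 f k : 0 <= fsqr f k. Proof. by rewrite addr_ge0 ?sqr_ge0. Qed.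

(** Measurability comes from Fubini's theorem, but the integrand need not be integrable in (k, z),
    the frequency plane having infinite measure. The positive weight [wt 1] is inserted to make it
    so, and its inverse exp (|xi| + |eta|) removes it afterwards. *)
Lemma measurable_fourier (F : R -> R) f : measurable_fun setT F ->
  (forall t, `|F t| <= 1) ->
  mu2.-integrable setT (EFin \o f) ->
  measurable_fun setT (fun k => \int[mu2]_z (f z * F (phase z k))).
Proof.
move=> mF F1 fi.
have wi : mu2.-integrable setT (EFin \o wt 1) by exact: integrable_wt ltr01.
have iw := integrable_tensor wi fi.
have mFp : measurable_fun setT (fun z : (R * R) * (R * R) => F (phase z.2 z.1)).
  apply: (measurableT_comp mF).
  by apply: measurable_funD; apply: measurable_funM; meas_proj.
have iH := integrable_mul_bounded iw mFp (fun z => F1 _).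
have /(_ _ _)/= mH := measurable_fubini_F iH.
have -> : (fun k => \int[mu2]_z (f z * F (phase z k))) =
   (fun k => fine (fubini_F mu2 (fun x : (R * R) * (R * R) =>
       (wt 1 x.1 * f x.2 * F (phase x.2 x.1))%:E) k) * (expR `|k.1| * expR `|k.2|)).
  apply/funext => k; rewrite /fubini_F/=.
  under [in RHS]eq_integral do rewrite -mulrA EFinM.
  rewrite integralZl//; last first.
    apply: (integrable_mul_bounded (C := 1) fi) => //.
    exact: (measurableT_comp mF (measurableT_comp measurable_phase (measurable_pair2 k))).
  rewrite fineM//=; last first.
    apply: integrable_fin_num => //.
    apply: (integrable_mul_bounded (C := 1) fi) => //.
    exact: (measurableT_comp mF (measurableT_comp measurable_phase (measurable_pair2 k))).
  rewrite mulrC mulrA -[LHS]mul1r; congr (_ * _).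
  by rewrite /wt /expabs !mul1r mulrACA -!expRD -[LHS]expR0; congr expR; ring.
apply: measurable_funM; first exact: measurableT_comp.
have me : measurable_fun setT (fun t : R => expR `|t|).
  apply: (measurableT_comp (continuous_measurable_fun (@continuous_expR R))).
  exact: normr_measurable.
exact: (measurable_tensor me me).
Qed.

Lemma measurable_fcos f : mu2.-integrable setT (EFin \o f) -> measurable_fun setT (fcos f).
Proof. by apply: (measurable_fourier measurable_cos); exact: norm_cos_le1. Qed.

Lemma measurable_fsin f : mu2.-integrable setT (EFin \o f) -> measurable_fun setT (fsin f).
Proof. by apply: (measurable_fourier measurable_sin); exact: norm_sin_le1. Qed.

Lemma measurable_fsqr f : mu2.-integrable setT (EFin \o f) -> measurable_fun setT (fsqr f).
Proof.
move=> fi; apply: measurable_funD; apply: measurable_funX.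
- exact: measurable_fcos.
- exact: measurable_fsin.
Qed.

Lemma gag_KerK d f : 0 < d ->
  mu2.-integrable setT (EFin \o f) -> mu2.-integrable setT (fun x => ((f x) ^+ 2)%:E) ->
  (gag mu2 (KerK d) f + 2%:E * \int[mu2]_k (wt d k * fsqr f k)%:E =
   (2 * (2 * pi) ^+ 2)%:E * \int[mu2]_x ((f x) ^+ 2)%:E)%E.
Proof.
move=> d0 fi f2i.
apply: (@gag_fourier _ _ _ _ _ mu2 mu2 phase measurable_phase (wt d) (KerK d) ((2 * pi) ^+ 2)
  ((2 / d) ^+ 2)) => //.
- exact: integrable_wt.
- move=> x y; rewrite -integral_wt_cos//; apply: eq_integral => k _.
  by congr (_ * cos _)%:E; rewrite /phase/=; ring.
- exact: measurable_Ker.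
- by move=> z; exact: Ker_ge0.
- by move=> x y; exact: KerC.
- by move=> z; exact: Ker_le.
- by move=> x; exact: integral_Ker.
Qed.

Lemma measurable_wt_fsqr d f : mu2.-integrable setT (EFin \o f) ->
  measurable_fun setT (fun k => (wt d k * fsqr f k)%:E).
Proof.
move=> fi; apply/measurable_EFinP; apply: measurable_funM.
- exact: measurable_wt.
- exact: measurable_fsqr.
Qed.

Lemma cvg_eps : eps n @[n --> \oo] --> (0 : R).
Proof. exact: cvg_harmonic. Qed.

Lemma cvg_wt_eps k : wt (eps n) k @[n --> \oo] --> (1 : R).
Proof.
have ce t : expabs (eps n) t @[n --> \oo] --> (1 : R).
  have h : - (eps n * `|t|) @[n --> \oo] --> (0 : R).
    rewrite -[X in _ --> X]oppr0; apply: cvgN; rewrite -[X in _ --> X](mul0r `|t|).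
    by apply: cvgMl; exact: cvg_eps.
  rewrite -[X in _ --> X]expR0; apply: (cvg_comp _ _ h); exact: continuous_expR.
by rewrite -[X in _ --> X](mulr1 1); apply: cvgM; exact: ce.
Qed.

Lemma integral_sqr_fin f : mu2.-integrable setT (fun x => ((f x) ^+ 2)%:E) ->
  (\int[mu2]_x ((f x) ^+ 2)%:E)%E \is a fin_num.
Proof. by move=> fi; exact: integrable_fin_num. Qed.

Lemma integral_wt_fsqr_le d f : 0 < d ->
  mu2.-integrable setT (EFin \o f) -> mu2.-integrable setT (fun x => ((f x) ^+ 2)%:E) ->
  (\int[mu2]_k (wt d k * fsqr f k)%:E <=
   ((2 * pi) ^+ 2)%:E * \int[mu2]_x ((f x) ^+ 2)%:E)%E.
Proof.
move=> d0 fi f2i.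
rewrite -(@lee_pmul2l _ 2%:E)// muleA -EFinM -(gag_KerK d0 fi f2i).
by rewrite leeDr// gag_ge0// => z; exact: Ker_ge0.
Qed.

Lemma plancherel_le f :
  mu2.-integrable setT (EFin \o f) -> mu2.-integrable setT (fun x => ((f x) ^+ 2)%:E) ->
  (\int[mu2]_k (fsqr f k)%:E <= ((2 * pi) ^+ 2)%:E * \int[mu2]_x ((f x) ^+ 2)%:E)%E.
Proof.
move=> fi f2i; apply: (@fatou_le _ _ _ mu2 (fun n k => wt (eps n) k * fsqr f k)).
- by move=> n; apply/measurable_EFinP; exact: measurable_wt_fsqr.
- by move=> n k; rewrite mulr_ge0 ?wt_ge0// fsqr_ge0.
- move=> k; rewrite -[X in _ --> X]mul1r; apply: cvgMl; exact: cvg_wt_eps.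
- move=> e e0; apply: nearW => n; apply: le_trans (integral_wt_fsqr_le (eps_gt0 n) fi f2i) _.
  by rewrite leeDl// lee_fin ltW.
Qed.

(** In [gag_KerK] the energy becomes arbitrarily small along [eps n], since [f] is square integrable
    and carried by a square, and [wt] is at most 1. The support condition is an equation so that
    [vanishing_Ker] applies by rewriting. *)
Lemma plancherel_ge m f : (f = fun x => f x * \1_(hsquare m) x) ->
  mu2.-integrable setT (EFin \o f) -> mu2.-integrable setT (fun x => ((f x) ^+ 2)%:E) ->
  (((2 * pi) ^+ 2)%:E * \int[mu2]_x ((f x) ^+ 2)%:E <= \int[mu2]_k (fsqr f k)%:E)%E.
Proof.
move=> fE fi f2i.
have mf : measurable_fun setT f by apply/measurable_EFinP; exact: measurable_int fi.
have := vanishing_Ker m mf f2i; rewrite -fE => vf.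
apply/lee_addgt0Pr => e e0.
have := cvge0_near_le e0 vf => -[N _ /(_ N (leqnn N))/= HN].
rewrite -(@lee_pmul2l _ 2%:E)// muleA -EFinM -(gag_KerK (eps_gt0 N) fi f2i).
have I0 : (0 <= \int[mu2]_k (fsqr f k)%:E)%E.
  by apply: integral_ge0 => k _; rewrite lee_fin fsqr_ge0.
rewrite addeC [leRHS]ge0_muleDr//; last by rewrite lee_fin ltW.
apply: leeD; last by rewrite -EFinM; apply: le_trans HN _; rewrite lee_fin; lra.
rewrite lee_pmul2l//; apply: ge0_le_integral => //.
- by move=> k _; rewrite lee_fin mulr_ge0 ?wt_ge0 ?fsqr_ge0.
- exact: measurable_wt_fsqr.
- by apply/measurable_EFinP; exact: measurable_fsqr.
- by move=> k _; rewrite lee_fin ler_piMl ?fsqr_ge0// wt_le1// eps_gt0.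
Qed.

(** By [gag_KerK] the energy is a multiple of the squared L^2 norm minus the weighted integral of
    the transform; [plancherel_ge] replaces that norm by the unweighted integral. Subtraction in
    [\bar R] requires the weighted integral to be finite, whence [Wf]. *)
Lemma gag_le_fsqr m d f : 0 < d -> (f = fun x => f x * \1_(hsquare m) x) ->
  mu2.-integrable setT (EFin \o f) -> mu2.-integrable setT (fun x => ((f x) ^+ 2)%:E) ->
  (gag mu2 (KerK d) f <= 2%:E * \int[mu2]_k ((1 - wt d k) * fsqr f k)%:E)%E.
Proof.
move=> d0 fE fi f2i.
have If := integral_sqr_fin f2i.
have Wf : (\int[mu2]_k (wt d k * fsqr f k)%:E)%E \is a fin_num.
  rewrite ge0_fin_numE; last by apply: integral_ge0 => k _; rewrite lee_fin mulr_ge0 ?wt_ge0 ?fsqr_ge0.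
  apply: le_lt_trans (integral_wt_fsqr_le d0 fi f2i) _.
  by rewrite ltey_eq fin_numM.
rewrite -(@leeD2rE _ (2%:E * \int[mu2]_k (wt d k * fsqr f k)%:E)%E); last by rewrite fin_numM.
rewrite (gag_KerK d0 fi f2i) -ge0_muleDr; last 2 first.
- apply: integral_ge0 => k _; rewrite lee_fin mulr_ge0 ?fsqr_ge0// subr_ge0; exact: wt_le1.
- by apply: integral_ge0 => k _; rewrite lee_fin mulr_ge0 ?wt_ge0 ?fsqr_ge0.
rewrite EFinM -muleA lee_pmul2l//.
apply: le_trans (plancherel_ge fE fi f2i) _.
rewrite -ge0_integralD//; last 4 first.
- move=> k _; rewrite lee_fin mulr_ge0 ?fsqr_ge0// subr_ge0; exact: wt_le1.
- apply/measurable_EFinP; apply: measurable_funM; last exact: measurable_fsqr.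
  by apply: measurable_funB => //; exact: measurable_wt.
- by move=> k _; rewrite lee_fin mulr_ge0 ?wt_ge0 ?fsqr_ge0.
- exact: measurable_wt_fsqr.
rewrite le_eqVlt; apply/orP; left; apply/eqP/eq_integral => k _.
by rewrite -EFinD; congr EFin; ring.
Qed.

End plancherel.

Lemma ae_monotone {R : realType} d (T : measurableType d) (m : set T -> \bar R) (P Q : T -> Prop) :
  (forall x, P x -> Q x) -> {ae m, forall x, P x} -> {ae m, forall x, Q x}.
Proof.
move=> PQ [N [mN N0 NP]]; exists N; split => // x /= nQ; apply: NP => /= /PQ; exact: nQ.
Qed.

(** * The Plancherel transform as a limit in mean *)

Section plancherel_transform.
Context {R : realType}.
Notation mu := (@lebesgue_measure R).
Notation mu2 := (prodm mu mu).
Implicit Types (f u w : R * R -> R) (k : R * R) (d : R).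

Lemma measurable_Lfun (q : \bar R) f : f \in Lfun lebesgue2 q -> measurable_fun setT f.
Proof. by rewrite inE => /andP[+ _]; rewrite inE. Qed.

Lemma integrable_sqr_Lfun2 f : f \in Lfun lebesgue2 2%:E ->
  mu2.-integrable setT (fun x => ((f x) ^+ 2)%:E).
Proof. exact: Lfun2_integrable_sqr. Qed.

Lemma fourier_integralE u k : mu2.-integrable setT (EFin \o u) ->
  fourier_integral u k = (fcos u k +i* - fsin u k)%C.
Proof.
move=> ui; rewrite /fourier_integral /cintegral /fcos /fsin /fourier_cos /fourier_sin.
congr Complex.
  by apply: eq_Rintegral => z _ /=; rewrite mul0r subr0.
have ks := integrable_sin (mu := mu2) (ph := phase) measurable_phase k ui.
transitivity (\int[mu2]_z (-1 * (u z * sin (phase z k)))).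
  by apply: eq_Rintegral => z _ /=; rewrite mul0r addr0 mulrN mulN1r.
by rewrite RintegralZl// mulN1r.
Qed.

Lemma measurable_square n : measurable (@square R n).
Proof. by apply: measurableX; exact: measurable_itv. Qed.

Lemma square_hsquare n : @square R n `<=` hsquare n.
Proof.
move=> [x y]; rewrite /square /hsquare /hseg /= !in_itv/= => -[/andP[h1 h2] /andP[h3 h4]].
have hn : n%:R < n.+1%:R :> R by rewrite ltr_nat.
by split; apply/andP; split; lra.
Qed.

Definition trunc u n : R * R -> R := u \* \1_(square n).

Lemma trunc_hsquare u n : trunc u n = fun x => trunc u n x * \1_(hsquare n) x.
Proof.
apply/funext => x; rewrite /trunc /= -mulrA; congr (_ * _).
rewrite !indicE; have [xs|] := boolP (x \in square n); last by rewrite mul0r.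
rewrite (_ : x \in hsquare n) ?mulr1// inE; apply: square_hsquare.
by rewrite inE in xs.
Qed.

Lemma trunc_sqr_le u n x : (trunc u n x) ^+ 2 <= (u x) ^+ 2.
Proof.
rewrite /trunc /= exprMn indicE.
by case: (x \in _); rewrite ?expr1n ?mulr1// expr0n mulr0 sqr_ge0.
Qed.

Lemma measurable_trunc u n : measurable_fun setT u -> measurable_fun setT (trunc u n).
Proof.
move=> mu'; apply: measurable_funM => //.
by apply: measurable_indic; exact: measurable_square.
Qed.

Lemma integrable_trunc_sqr u n : measurable_fun setT u ->
  mu2.-integrable setT (fun x => ((u x) ^+ 2)%:E) ->
  mu2.-integrable setT (fun x => ((trunc u n x) ^+ 2)%:E).
Proof.
move=> mu' ui; apply: le_integrable ui => //.
  by apply/measurable_EFinP; apply: measurable_funX; exact: measurable_trunc.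
move=> x _ /=; rewrite lee_fin !ger0_norm ?sqr_ge0//; exact: trunc_sqr_le.
Qed.

Lemma integrable_trunc u n : measurable_fun setT u ->
  mu2.-integrable setT (fun x => ((u x) ^+ 2)%:E) ->
  mu2.-integrable setT (EFin \o trunc u n).
Proof.
move=> mu' ui.
(* The dominating function is u^2 plus the indicator of a square, by 2 |u| <= u^2 + 1. *)
have i1 : mu2.-integrable setT (EFin \o (\1_(hsquare n) : R * R -> R)).
  apply/integrableP; split.
    by apply/measurable_EFinP; apply: measurable_indic; exact: measurable_hsquare.
  under eq_integral do rewrite /= ger0_norm//.
  rewrite integral_indic ?setIT//; [exact: hsquare_fin|exact: measurable_hsquare].
have i2 := integrableD measurableT ui i1.
apply: le_integrable i2 => //.
  by apply/measurable_EFinP; exact: measurable_trunc.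
move=> x _; rewrite [X in (_ <= `|X|)%E](_ : _ = ((u x) ^+ 2 + \1_(hsquare n) x)%:E)//.
rewrite /= lee_fin [leRHS]ger0_norm ?addr_ge0 ?sqr_ge0// /trunc/= !indicE.
have [xs|_] := boolP (x \in square n); last by rewrite mulr0 normr0 addr_ge0 ?sqr_ge0.
rewrite (_ : x \in hsquare n); last by rewrite inE; apply: square_hsquare; rewrite inE in xs.
rewrite mulr1; have := sqr_ge0 (`|u x| - 1); rewrite sqrrB real_normK ?num_real//=.
by have := normr_ge0 (u x); lra.
Qed.

Lemma cvg_trunc u x : trunc u n x @[n --> \oo] --> u x.
Proof.
apply: cvg_near_cst.
have [n1 n1P] : exists n : nat, `|x.1| <= n%:R.
  by exists (Num.truncn `|x.1|).+1; exact/ltW/truncnS_gt.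
have [n2 n2P] : exists n : nat, `|x.2| <= n%:R.
  by exists (Num.truncn `|x.2|).+1; exact/ltW/truncnS_gt.
near=> n; rewrite /trunc /= indicE mem_set ?mulr1// /square/= !in_itv/= -!ler_norml.
split.
- by apply: le_trans n1P _; rewrite ler_nat; near: n; exact: nbhs_infty_ge.
- by apply: le_trans n2P _; rewrite ler_nat; near: n; exact: nbhs_infty_ge.
Unshelve. all: by end_near. Qed.

Lemma Lnorm_sqr (g : R * R -> R) :
  (Lnorm lebesgue2 2%:E (EFin \o g) `^ 2 = \int[mu2]_x ((g x) ^+ 2)%:E)%E.
Proof.
rewrite powR_Lnorm ?pnatr_eq0//; apply: eq_integral => x _ /=.
by rewrite powR_mulrn// real_normK ?num_real.
Qed.

Lemma cvg_Lnorm_sqr (g : nat -> R * R -> R) :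
  Lnorm lebesgue2 2%:E (EFin \o g n) @[n --> \oo] --> 0%E ->
  (\int[mu2]_x ((g n x) ^+ 2)%:E)%E @[n --> \oo] --> 0%E.
Proof.
move=> h; apply: cvge0_le => [n|e e0].
  by apply: integral_ge0 => x _; rewrite lee_fin sqr_ge0.
have s0 : 0 < Num.sqrt e by rewrite sqrtr_gt0.
have := cvge0_near_le s0 h; apply: filterS => n hn.
rewrite -Lnorm_sqr -(sqr_sqrtr (ltW e0)) -powR_mulrn ?sqrtr_ge0// -poweR_EFin.
apply: gt0_ler_poweR => //.
- by rewrite in_itv/= leey andbT; exact: Lnorm_ge0.
- by rewrite in_itv/= leey andbT lee_fin sqrtr_ge0.
Qed.

Definition vsq (v : R * R -> R[i]) k : R := complex.Re (v k) ^+ 2 + complex.Im (v k) ^+ 2.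

(** The squared modulus of the error in [is_fourier]. The second sign is a plus because the Fourier
    integral has imaginary part [- fsin]. *)
Definition ferr u (v : R * R -> R[i]) n k : R :=
  (fcos (trunc u n) k - complex.Re (v k)) ^+ 2 + (fsin (trunc u n) k + complex.Im (v k)) ^+ 2.

Lemma vsq_ge0 v k : 0 <= vsq v k. Proof. by rewrite addr_ge0 ?sqr_ge0. Qed.

Lemma ferr_ge0 u v n k : 0 <= ferr u v n k. Proof. by rewrite addr_ge0 ?sqr_ge0. Qed.

Lemma normc_sqr (a : R[i]) : Normc.normc a ^+ 2 = complex.Re a ^+ 2 + complex.Im a ^+ 2.
Proof. by case: a => a b; rewrite /= sqr_sqrtr// addr_ge0 ?sqr_ge0. Qed.

Lemma is_fourier_measurable u v : is_fourier u v ->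
  [/\ measurable_fun setT u, mu2.-integrable setT (fun x => ((u x) ^+ 2)%:E),
      measurable_fun setT (fun k => complex.Re (v k))
    & measurable_fun setT (fun k => complex.Im (v k))].
Proof.
move=> [uL [rL iL] _]; split; [exact: measurable_Lfun uL|exact: integrable_sqr_Lfun2|..].
- exact: measurable_Lfun rL.
- exact: measurable_Lfun iL.
Qed.

Lemma is_fourier_ferr u v : is_fourier u v ->
  (\int[mu2]_k (ferr u v n k)%:E)%E @[n --> \oo] --> 0%E.
Proof.
move=> uv; have [mu' ui _ _] := is_fourier_measurable uv; have [_ _ h] := uv.
rewrite (_ : (fun n => _) = (fun n => \int[mu2]_k
   ((Normc.normc (fourier_integral (u \* \1_(square n)) k - v k)) ^+ 2)%:E)%E).
  exact: cvg_Lnorm_sqr h.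
apply/funext => n; apply: eq_integral => k _; congr EFin.
rewrite normc_sqr fourier_integralE; last exact: integrable_trunc.
rewrite /ferr.
by case: (v k) => a b /=; congr (_ + _); ring.
Qed.

Lemma is_fourier_measurable_vsq u v : is_fourier u v -> measurable_fun setT (vsq v).
Proof.
move=> /is_fourier_measurable[_ _ mr mi].
by apply: measurable_funD; apply: measurable_funX.
Qed.

Lemma is_fourier_measurable_ferr u v n : is_fourier u v -> measurable_fun setT (ferr u v n).
Proof.
move=> /is_fourier_measurable[mu' ui mr mi].
apply: measurable_funD; apply: measurable_funX.
- by apply: measurable_funB => //; apply: measurable_fcos; exact: integrable_trunc.
- by apply: measurable_funD => //; apply: measurable_fsin; exact: integrable_trunc.
Qed.

Lemma ge0_integralDM (a b : R) (F G : R * R -> R) : 0 <= a -> 0 <= b ->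
  measurable_fun setT F -> measurable_fun setT G ->
  (forall k, 0 <= F k) -> (forall k, 0 <= G k) ->
  (\int[mu2]_k (a * F k + b * G k)%:E =
   a%:E * \int[mu2]_k (F k)%:E + b%:E * \int[mu2]_k (G k)%:E)%E.
Proof.
move=> a0 b0 mF mG F0 G0.
rewrite -!ge0_integralZl//; last 4 first.
- exact/measurable_EFinP.
- by move=> x _; rewrite lee_fin.
- exact/measurable_EFinP.
- by move=> x _; rewrite lee_fin.
rewrite -ge0_integralD//; last 4 first.
- by move=> x _; rewrite lee_fin mulr_ge0.
- by apply/measurable_EFinP; exact: measurable_funM.
- by move=> x _; rewrite lee_fin mulr_ge0.
- by apply/measurable_EFinP; exact: measurable_funM.
Qed.

Lemma ge0_integral_leDM (a b : R) (H F G : R * R -> R) : 0 <= a -> 0 <= b ->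
  measurable_fun setT H -> measurable_fun setT F -> measurable_fun setT G ->
  (forall k, 0 <= H k) -> (forall k, 0 <= F k) -> (forall k, 0 <= G k) ->
  {ae mu2, forall k, H k <= a * F k + b * G k} ->
  (\int[mu2]_k (H k)%:E <=
   a%:E * \int[mu2]_k (F k)%:E + b%:E * \int[mu2]_k (G k)%:E)%E.
Proof.
move=> a0 b0 mH mF mG H0 F0 G0 hle.
rewrite -ge0_integralDM//; apply: ae_ge0_le_integral => //.
- by move=> x _; rewrite lee_fin.
- exact/measurable_EFinP.
- by move=> x _; rewrite lee_fin addr_ge0// mulr_ge0.
- by apply/measurable_EFinP; apply: measurable_funD; exact: measurable_funM.
- by apply: ae_monotone hle => x hx _; rewrite lee_fin.
Qed.

(** [plancherel_le] for a truncation, transferred to the limit by |v|^2 <= 2 |f^|^2 + 2 |f^ - v|^2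
    with f^ the transform of the truncation; this is the origin of the extra factor 2. *)
Lemma is_fourier_vsq_le u v : is_fourier u v ->
  (\int[mu2]_k (vsq v k)%:E <= (2 * (2 * pi) ^+ 2)%:E * \int[mu2]_x ((u x) ^+ 2)%:E)%E.
Proof.
move=> uv; have [mu' ui mr mi] := is_fourier_measurable uv.
apply/lee_addgt0Pr => e e0.
have e20 : 0 < e / 2 by rewrite divr_gt0.
have [N _ /(_ N (leqnn N))/= HN] := cvge0_near_le e20 (is_fourier_ferr uv).
have iN := integrable_trunc N mu' ui; have i2N := integrable_trunc_sqr N mu' ui.
apply: (@le_trans _ _ (2%:E * \int[mu2]_k (fsqr (trunc u N) k)%:E
    + 2%:E * \int[mu2]_k (ferr u v N k)%:E)%E).
  apply: ge0_integral_leDM => //.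
  - exact: is_fourier_measurable_vsq uv.
  - exact: measurable_fsqr.
  - exact: is_fourier_measurable_ferr.
  - exact: vsq_ge0.
  - exact: fsqr_ge0.
  - exact: ferr_ge0.
  - apply: aeW => k; rewrite /vsq /fsqr /ferr.
    have := sqr_ge0 (fcos (trunc u N) k *+ 2 - complex.Re (v k)).
    have := sqr_ge0 (fsin (trunc u N) k *+ 2 + complex.Im (v k)).
    by move=> *; nra.
apply: leeD.
  rewrite EFinM -muleA lee_pmul2l//; apply: le_trans (plancherel_le iN i2N) _.
  rewrite lee_pmul2l ?lte_fin ?exprn_gt0 ?mulr_gt0 ?pi_gt0//.
  apply: ge0_le_integral => //.
  - by move=> x _; rewrite lee_fin sqr_ge0.
  - by apply/measurable_EFinP; apply: measurable_funX; exact: measurable_trunc.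
  - by apply/measurable_EFinP; exact: measurable_funX.
  - by move=> x _; rewrite lee_fin trunc_sqr_le.
apply: le_trans (lee_pmul _ _ (lexx 2%:E) HN) _ => //.
  by apply: integral_ge0 => k _; rewrite lee_fin ferr_ge0.
by rewrite -EFinM lee_fin mulrC divfK.
Qed.

(** Truncations converge pointwise to [u], so Fatou's lemma carries [gag_le_fsqr] over. Of the
    factor 4, one 2 is already in that bound and the other comes from replacing the transform of the
    truncation by [v]. *)
Lemma is_fourier_gag_le d u v : 0 < d -> is_fourier u v ->
  (gag mu2 (KerK d) u <= 4%:E * \int[mu2]_k ((1 - wt d k) * vsq v k)%:E)%E.
Proof.
move=> d0 uv; have [mu' ui mr mi] := is_fourier_measurable uv.
have mK : measurable_fun setT (KerK d) := measurable_Ker d0.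
have mv := is_fourier_measurable_vsq uv.
have m1w : measurable_fun setT (fun k => 1 - wt d k).
  by apply: measurable_funB => //; exact: measurable_wt.
have w1 k : 0 <= 1 - wt d k by rewrite subr_ge0 wt_le1.
apply: (@fatou_le _ _ _ (mu2 \x mu2)%E
  (fun n z => (trunc u n z.1 - trunc u n z.2) ^+ 2 * KerK d z)).
- move=> n; apply: measurable_gag_integrand => //; exact: measurable_trunc.
- by move=> n z; rewrite mulr_ge0 ?sqr_ge0// Ker_ge0.
- move=> z; apply: cvgMl.
  apply: (cvg_comp (fun n => trunc u n z.1 - trunc u n z.2) (fun t => t ^+ 2)).
    by apply: cvgB; exact: cvg_trunc.
  exact: exprn_continuous.
move=> e e0; have e40 : 0 < e / 4 by rewrite divr_gt0.
have := cvge0_near_le e40 (is_fourier_ferr uv); apply: filterS => n Hn.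
have iN := integrable_trunc n mu' ui; have i2N := integrable_trunc_sqr n mu' ui.
apply: le_trans (gag_le_fsqr d0 (trunc_hsquare u n) iN i2N) _.
apply: (@le_trans _ _ (2%:E * (2%:E * \int[mu2]_k ((1 - wt d k) * vsq v k)%:E
    + 2%:E * \int[mu2]_k (ferr u v n k)%:E))%E).
  rewrite lee_pmul2l//; apply: ge0_integral_leDM => //.
  - by apply: measurable_funM => //; exact: measurable_fsqr.
  - exact: measurable_funM.
  - exact: is_fourier_measurable_ferr.
  - by move=> k; rewrite mulr_ge0 ?fsqr_ge0.
  - by move=> k; rewrite mulr_ge0 ?vsq_ge0.
  - exact: ferr_ge0.
  - apply: aeW => k.
    have H : fsqr (trunc u n) k <= 2 * vsq v k + 2 * ferr u v n k.
      rewrite /vsq /fsqr /ferr.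
      have := sqr_ge0 (fcos (trunc u n) k - complex.Re (v k) *+ 2).
      have := sqr_ge0 (fsin (trunc u n) k + complex.Im (v k) *+ 2).
      by move=> *; nra.
    apply: le_trans (ler_wpM2l (w1 k) H) _; rewrite mulrDr mulrCA lerD2l.
    by rewrite ler_piMl ?mulr_ge0 ?ferr_ge0// gerBl wt_ge0.
have I1 : (0 <= \int[mu2]_k ((1 - wt d k) * vsq v k)%:E)%E.
  by apply: integral_ge0 => k _; rewrite lee_fin mulr_ge0 ?vsq_ge0.
have I2 : (0 <= \int[mu2]_k (ferr u v n k)%:E)%E.
  by apply: integral_ge0 => k _; rewrite lee_fin ferr_ge0.
rewrite ge0_muleDr ?mule_ge0// !muleA -!EFinM.
apply: leeD; first by rewrite -natrM.
apply: le_trans (lee_pmul _ _ (lexx _) Hn) _ => //.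
by rewrite -EFinM lee_fin -natrM mulrC divfK.
Qed.

(** [is_Dx_half] and [is_Dx_mhalf_dy] each provide their own transform of [u]; the two symbols can
    be combined only after these are identified. *)
Lemma is_fourier_unique u v1 v2 : is_fourier u v1 -> is_fourier u v2 ->
  {ae mu2, forall k, complex.Re (v1 k) = complex.Re (v2 k) /\ complex.Im (v1 k) = complex.Im (v2 k)}.
Proof.
move=> uv1 uv2.
have [mu' ui mr1 mi1] := is_fourier_measurable uv1.
have [_ _ mr2 mi2] := is_fourier_measurable uv2.
pose D k := (complex.Re (v1 k) - complex.Re (v2 k)) ^+ 2 +
  (complex.Im (v1 k) - complex.Im (v2 k)) ^+ 2.
have D0 k : 0 <= D k by rewrite addr_ge0 ?sqr_ge0.
have mD : measurable_fun setT D.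
  by apply: measurable_funD; apply: measurable_funX; exact: measurable_funB.
have ID : (\int[mu2]_k (D k)%:E = 0)%E.
  apply/eqP; rewrite eq_le integral_ge0 ?andbT; last by move=> k _; rewrite lee_fin.
  apply/lee_addgt0Pr => e e0; rewrite add0e.
  have e40 : 0 < e / 4 by rewrite divr_gt0.
  have [N1 _ H1] := cvge0_near_le e40 (is_fourier_ferr uv1).
  have [N2 _ H2] := cvge0_near_le e40 (is_fourier_ferr uv2).
  pose n := maxn N1 N2; have h1 := H1 n (leq_maxl _ _); have h2 := H2 n (leq_maxr _ _).
  apply: (@le_trans _ _ (2%:E * \int[mu2]_k (ferr u v1 n k)%:E
    + 2%:E * \int[mu2]_k (ferr u v2 n k)%:E)%E).
    apply: ge0_integral_leDM => //.
    - exact: is_fourier_measurable_ferr.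
    - exact: is_fourier_measurable_ferr.
    - exact: ferr_ge0.
    - exact: ferr_ge0.
    - apply: aeW => k; rewrite /D /ferr.
      have := sqr_ge0 (fcos (trunc u n) k *+ 2 - complex.Re (v1 k) - complex.Re (v2 k)).
      have := sqr_ge0 (fsin (trunc u n) k *+ 2 + complex.Im (v1 k) + complex.Im (v2 k)).
      by move=> *; nra.
  apply: (@le_trans _ _ (2%:E * (e / 4)%:E + 2%:E * (e / 4)%:E)%E).
    by apply: leeD; apply: lee_pmul => //; apply: integral_ge0 => k _; rewrite lee_fin ferr_ge0.
  by rewrite -EFinM -EFinD lee_fin; lra.
have : ae_eq mu2 setT (EFin \o D) (cst 0%E).
  apply/ae_eq_integral_abs => //; first exact/measurable_EFinP.
  by rewrite -[RHS]ID; apply: eq_integral => k _ /=; rewrite ger0_norm.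
apply: ae_monotone => k /(_ I) /= [] /eqP.
rewrite paddr_eq0 ?sqr_ge0// !sqrf_eq0 !subr_eq0 => /andP[/eqP -> /eqP ->].
by [].
Qed.

End plancherel_transform.

(** * Functions of the anisotropic space *)

Section Zspace_estimate.
Context {R : realType}.
Notation mu := (@lebesgue_measure R).
Notation mu2 := (prodm mu mu).
Implicit Types (u w : R * R -> R) (k : R * R) (d : R).

Lemma vsq_mul (m v : R * R -> R[i]) k : vsq (fun k => m k * v k) k = vsq m k * vsq v k.
Proof. by rewrite /vsq; case: (m k) => a b; case: (v k) => a' b' /=; ring. Qed.

Lemma vsq_symbol_Dx_half k : vsq (symbol_Dx 2^-1) k = `|k.1|.
Proof. by rewrite /vsq /symbol_Dx /= powR12_sqrt// sqr_sqrtr// expr0n addr0. Qed.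

Lemma vsq_symbol_Dx_mhalf_dy k : k.1 != 0 ->
  vsq (fun k => symbol_Dx (- 2^-1) k * symbol_dy k) k = k.2 ^+ 2 / `|k.1|.
Proof.
move=> k1; rewrite vsq_mul /vsq /symbol_Dx /symbol_dy /= powRN powR12_sqrt//.
by rewrite expr0n/= addr0 add0r exprVn sqr_sqrtr// mulrC.
Qed.

Lemma negligible_axis : {ae mu2, forall k, k.1 != 0}.
Proof.
exists ([set 0] `*` setT); split.
- exact: measurableX.
- by rewrite /prodm product_measure1E// [X in (X * _)%E](lebesgue_measure_set1 0) mul0e.
- by move=> k /= /negP; rewrite negbK => /eqP.
Qed.

Lemma one_sub_wt_le d k : 0 < d -> 1 - wt d k <= d * (`|k.1| + `|k.2|).
Proof.
move=> d0; rewrite /wt /expabs -expRD -opprD -mulrDr.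
by have := expR_ge1Dx (- (d * (`|k.1| + `|k.2|))); lra.
Qed.

Lemma ae_and (P Q : R * R -> Prop) : {ae mu2, forall k, P k} -> {ae mu2, forall k, Q k} ->
  {ae mu2, forall k, P k /\ Q k}.
Proof.
move=> [A [mA A0 PA]] [B [mB B0 QB]]; exists (A `|` B); split.
- exact: measurableU.
- by rewrite null_set_setU.
- move=> k /= /not_andP[nP|nQ]; [left; exact: PA|right; exact: QB].
Qed.

(** The symbol bound is |xi| + |eta| <= 3/2 |xi| + 1/2 eta^2 / |xi|. With both coefficients enlarged
    to 3/2, the constant is 4 ([is_fourier_gag_le]) times 3/2 times 2 (2 pi)^2
    ([is_fourier_vsq_le]). *)
Lemma gag_Zspace_le d u w1 w2 : 0 < d -> is_Dx_half u w1 -> is_Dx_mhalf_dy u w2 ->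
  (gag mu2 (KerK d) u <= (12 * (2 * pi) ^+ 2 * d)%:E *
    (\int[mu2]_x ((w1 x) ^+ 2)%:E + \int[mu2]_x ((w2 x) ^+ 2)%:E))%E.
Proof.
move=> d0 [v1 uv1 wv1] [v2 uv2 wv2].
apply: le_trans (is_fourier_gag_le d0 uv1) _.
have mv1 := is_fourier_measurable_vsq uv1.
have m1 := is_fourier_measurable_vsq wv1; have m2 := is_fourier_measurable_vsq wv2.
have w1k k : 0 <= 1 - wt d k by rewrite subr_ge0 wt_le1.
apply: (@le_trans _ _ (4%:E * ((3 / 2 * d)%:E * \int[mu2]_k (vsq (fun k => symbol_Dx 2^-1 k * v1 k) k)%:E
  + (d / 2)%:E * \int[mu2]_k (vsq (fun k => symbol_Dx (- 2^-1) k * symbol_dy k * v2 k) k)%:E))%E).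
  rewrite lee_pmul2l//; apply: ge0_integral_leDM.
  - by rewrite mulr_ge0// ltW.
  - by rewrite divr_ge0// ltW.
  - apply: measurable_funM => //; apply: measurable_funB => //; exact: measurable_wt.
  - exact: m1.
  - exact: m2.
  - by move=> k; rewrite mulr_ge0// vsq_ge0.
  - exact: vsq_ge0.
  - exact: vsq_ge0.
  - apply: ae_monotone (ae_and negligible_axis (is_fourier_unique uv1 uv2)) => k [k1 [er ei]].
    have ev : vsq v2 k = vsq v1 k by rewrite /vsq er ei.
    rewrite (vsq_mul (fun k => symbol_Dx (- 2^-1) k * symbol_dy k)) vsq_mul ev.
    rewrite vsq_symbol_Dx_half vsq_symbol_Dx_mhalf_dy//.
    rewrite [leRHS](_ : _ = (3 / 2 * d * `|k.1| + d / 2 * (k.2 ^+ 2 / `|k.1|)) * vsq v1 k); last by ring.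
    rewrite ler_wpM2r ?vsq_ge0// (le_trans (one_sub_wt_le k d0))//.
    have k10 : 0 < `|k.1| by rewrite normr_gt0.
    (* AM-GM: [2 |eta| <= |xi| + eta^2 / |xi|] *)
    have amgm : 2 * `|k.2| <= `|k.1| + k.2 ^+ 2 / `|k.1|.
      rewrite -(ler_pM2r k10) [leRHS]mulrDl divfK ?gt_eqF// -[k.2 ^+ 2]real_normK ?num_real//.
      by have := sqr_ge0 (`|k.1| - `|k.2|); lra.
    have := ler_wpM2l (ltW d0) amgm; lra.
have I1 : (0 <= \int[mu2]_x ((w1 x) ^+ 2)%:E)%E by apply: integral_ge0 => x _; rewrite lee_fin sqr_ge0.
have I2 : (0 <= \int[mu2]_x ((w2 x) ^+ 2)%:E)%E by apply: integral_ge0 => x _; rewrite lee_fin sqr_ge0.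
have h1 := is_fourier_vsq_le wv1; have h2 := is_fourier_vsq_le wv2.
have c0 : 0 <= 2 * (2 * pi) ^+ 2 :> R by rewrite mulr_ge0// sqr_ge0.
apply: (@le_trans _ _ (4%:E * ((3 / 2 * d)%:E * ((2 * (2 * pi) ^+ 2)%:E * \int[mu2]_x ((w1 x) ^+ 2)%:E)
  + (3 / 2 * d)%:E * ((2 * (2 * pi) ^+ 2)%:E * \int[mu2]_x ((w2 x) ^+ 2)%:E)))%E).
  rewrite lee_pmul2l//; apply: leeD.
    by apply: lee_wpmul2l h1; rewrite lee_fin mulr_ge0// ltW.
  apply: lee_pmul h2.
  - by rewrite lee_fin divr_ge0// ltW.
  - by apply: integral_ge0 => k _; rewrite lee_fin vsq_ge0.
  - by rewrite lee_fin; lra.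
rewrite !(muleA (3 / 2 * d)%:E) -ge0_muleDr// muleA -!EFinM.
by rewrite (_ : 4 * _ = 12 * (2 * pi) ^+ 2 * d)//; field.
Qed.

Lemma Zspace_bound u : Zspace u ->
  [/\ measurable_fun setT u, mu2.-integrable setT (fun x => ((u x) ^+ 2)%:E),
   (\int[mu2]_x ((u x) ^+ 2)%:E <= ((Znorm u) ^+ 2)%:E)%E &
   forall d, 0 < d ->
     (gag mu2 (KerK d) u <= (12 * (2 * pi) ^+ 2 * d * (Znorm u) ^+ 2)%:E)%E].
Proof.
move=> [uL ew1 ew2].
have mu' := measurable_Lfun uL; have ui := integrable_sqr_Lfun2 uL.
(* Membership in [Zspace] ensures that [xget] returns a genuine multiplier image instead of falling
   back on its default. *)
have w1P : is_Dx_half u (Dx_half u) by exact: (xgetPex (cst 0) ew1).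
have w2P : is_Dx_mhalf_dy u (Dx_mhalf_dy u) by exact: (xgetPex (cst 0) ew2).
have [m1 i1] : measurable_fun setT (Dx_half u) /\ mu2.-integrable setT (fun x => ((Dx_half u x) ^+ 2)%:E).
  by have [v _ /is_fourier_measurable[]] := w1P.
have [m2 i2] : measurable_fun setT (Dx_mhalf_dy u) /\ mu2.-integrable setT (fun x => ((Dx_mhalf_dy u x) ^+ 2)%:E).
  by have [v _ /is_fourier_measurable[]] := w2P.
have NE : ((Znorm u ^+ 2)%:E = \int[mu2]_x ((u x) ^+ 2)%:E +
   (\int[mu2]_x ((Dx_half u x) ^+ 2)%:E + \int[mu2]_x ((Dx_mhalf_dy u x) ^+ 2)%:E))%E.
  rewrite -integralD// -integralD//; last exact: integrableD.
  rewrite /Znorm sqr_sqrtr; last first.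
    by apply: Rintegral_ge0 => x _; rewrite !addr_ge0// sqr_ge0.
  (* [fine] sends an infinite integral to 0, so finiteness is what lets [Znorm] control the extended
     integrals. *)
  rewrite /Rintegral fineK; last first.
    apply: integrable_fin_num => //.
    have := integrableD measurableT (integrableD measurableT ui i1) i2.
    apply: eq_integrable => // x _ /=.
    by rewrite -!EFinD !real_normK ?num_real.
  by apply: eq_integral => x _ /=; rewrite -!EFinD !real_normK ?num_real// addrA.
have I0 (f : R * R -> R) : (0 <= \int[mu2]_x ((f x) ^+ 2)%:E)%E.
  by apply: integral_ge0 => x _; rewrite lee_fin sqr_ge0.
split => //; first by rewrite NE leeDl// adde_ge0.
move=> d d0; apply: le_trans (gag_Zspace_le d0 w1P w2P) _.
rewrite [leRHS]EFinM NE; apply: lee_wpmul2l; first by rewrite lee_fin mulr_ge0 ?(ltW d0)// mulr_ge0// sqr_ge0.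
by rewrite leeDr.
Qed.

End Zspace_estimate.

(** * Averages over the cells of nested partitions *)

Section average.
Context d (T : measurableType d) {R : realType} (m : {measure set T -> \bar R}).
Implicit Types (f : T -> R) (Q : set T) (r c : R).

Lemma integrable_cst_fin Q r c : measurable Q -> m Q = r%:E ->
  m.-integrable Q (EFin \o (fun=> c)).
Proof.
move=> mQ mr; apply/integrableP; split; first exact: measurable_cst.
rewrite (eq_integral (cst `|c|%:E))// integral_cst// mr -EFinM ltry//.
Qed.

Lemma integrable_of_sqr Q r f : measurable Q -> m Q = r%:E -> measurable_fun Q f ->
  m.-integrable Q (EFin \o (fun x => (f x) ^+ 2)) -> m.-integrable Q (EFin \o f).
Proof.
move=> mQ mr mf fi.
have i2 := integrableD mQ fi (integrable_cst_fin 1 mQ mr).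
apply: le_integrable i2 => //; first exact/measurable_EFinP.
move=> x _; rewrite [X in (_ <= `|X|)%E](_ : _ = ((f x) ^+ 2 + 1)%:E)//.
rewrite /= lee_fin [leRHS]ger0_norm ?addr_ge0 ?sqr_ge0//.
have := sqr_ge0 (`|f x| - 1); rewrite sqrrB real_normK ?num_real//=.
by have := normr_ge0 (f x); lra.
Qed.

Lemma integrable_sqrB Q r c f : measurable Q -> m Q = r%:E -> measurable_fun Q f ->
  m.-integrable Q (EFin \o (fun x => (f x) ^+ 2)) ->
  m.-integrable Q (EFin \o (fun x => (f x - c) ^+ 2)).
Proof.
move=> mQ mr mf fi.
have i1 := integrable_of_sqr mQ mr mf fi.
have i2 := integrableD mQ (integrableD mQ fi (integrableZl mQ (- (2 * c)) i1))
  (integrable_cst_fin (c ^+ 2) mQ mr).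
apply: eq_integrable i2 => // x _ /=; rewrite -EFinM -!EFinD; congr EFin; ring.
Qed.

(** The real number [r] stands for the measure of [Q]; the lemmas assume [m Q = r%:E], which keeps
    [fine] out of the formulas. *)
Definition average Q r f := r^-1 * \int[m]_(x in Q) f x.

Lemma averageB Q r c f : measurable Q -> m Q = r%:E -> 0 < r ->
  m.-integrable Q (EFin \o f) -> average Q r (fun x => f x - c) = average Q r f - c.
Proof.
move=> mQ mr r0 fi; rewrite /average.
rewrite [X in _ * X = _](RintegralB mQ fi (integrable_cst_fin c mQ mr)).
by rewrite Rintegral_cst// mr /= mulrBr; congr (_ - _); field; rewrite gt_eqF.
Qed.

Lemma EFin_Rintegral Q f : measurable Q -> m.-integrable Q (EFin \o f) ->
  (\int[m]_(x in Q) f x)%:E = (\int[m]_(x in Q) (f x)%:E)%E.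
Proof. by move=> mQ fi; rewrite /Rintegral fineK//; exact: integrable_fin_num. Qed.

(* Jensen: expand the integral over [Q] of [(f - average)^2 >= 0]. *)
Lemma sqr_average_le Q r f : measurable Q -> m Q = r%:E -> 0 < r -> measurable_fun Q f ->
  m.-integrable Q (EFin \o (fun x => (f x) ^+ 2)) ->
  (((average Q r f) ^+ 2)%:E <= (r^-1)%:E * \int[m]_(x in Q) ((f x) ^+ 2)%:E)%E.
Proof.
move=> mQ mr r0 mf fi; rewrite -EFin_Rintegral// -EFinM lee_fin.
have i1 := integrable_of_sqr mQ mr mf fi.
set a := average Q r f.
have h : 0 <= \int[m]_(x in Q) ((f x - a) ^+ 2) by apply: Rintegral_ge0 => x _; exact: sqr_ge0.
have e : \int[m]_(x in Q) ((f x - a) ^+ 2) =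
   \int[m]_(x in Q) ((f x) ^+ 2) - (2 * a) * \int[m]_(x in Q) (f x) + a ^+ 2 * r.
  transitivity (\int[m]_(x in Q) (((f x) ^+ 2 - (2 * a) * f x) + a ^+ 2)).
    by apply: eq_Rintegral => x _; ring.
  have iZ := integrableZl mQ (2 * a) i1.
  rewrite (RintegralD mQ (integrableB mQ fi iZ) (integrable_cst_fin (a ^+ 2) mQ mr)).
  by rewrite (RintegralB mQ fi iZ) RintegralZl// Rintegral_cst// mr.
have ea : \int[m]_(x in Q) (f x) = r * a by rewrite /a /average mulVKf// gt_eqF.
rewrite -(ler_pM2l r0) mulVKf ?gt_eqF//; move: h; rewrite e ea; lra.
Qed.

End average.

Section cells.
Context d (T : measurableType d) {R : realType} (m : {sigma_finite_measure set T -> \bar R}).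
Variables (I : countType) (c : nat -> T -> I) (v : nat -> R).
(** A partition is encoded by a labelling [c j] into a countable type, its cells being the fibres.
    Hypothesis [refc] below says that level j + 1 refines level j. *)
Definition cell j x := c j @^-1` [set c j x].
Hypotheses (mc : forall j i, measurable (c j @^-1` [set i])) (v0 : forall j, 0 < v j)
  (mv : forall j i, m (c j @^-1` [set i]) = (v j)%:E)
  (refc : forall j x y, c j.+1 x = c j.+1 y -> c j x = c j y).
Implicit Types (u : T -> R).

(** The conditional expectation of [u] given the partition of level j, all of whose cells have
    measure [v j]. *)
Definition cexp j u x := average m (cell j x) (v j) u.

Lemma measurable_cell j x : measurable (cell j x). Proof. exact: mc. Qed.

Lemma cexp_cell j u x y : c j y = c j x -> cexp j u y = cexp j u x.
Proof. by rewrite /cexp /cell => ->. Qed.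

Lemma measurable_cells j (S : set I) : measurable (c j @^-1` S).
Proof.
rewrite (_ : _ @^-1` _ = \bigcup_(i in S) c j @^-1` [set i]).
  rewrite bigcup_mkcond; apply: countable_bigcupT_measurable => // i.
  by case: ifP => // _; exact: mc.
by apply/seteqP; split => [x Sx|x [i Si /= ->]//]; exists (c j x).
Qed.

Lemma measurable_cexp j u : measurable_fun setT (cexp j u).
Proof.
move=> _ Y mY; rewrite setTI.
rewrite (_ : _ @^-1` _ = c j @^-1` [set i | exists2 x, c j x = i & Y (cexp j u x)]).
  exact: measurable_cells.
apply/seteqP; split => [x Yx|x [y yx]]; first by exists x.
by rewrite /= (cexp_cell u yx).
Qed.

Section sqr.
Variable u : T -> R.
Hypotheses (mu : measurable_fun setT u) (ui : m.-integrable setT (fun x => ((u x) ^+ 2)%:E)).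

Let ucell j x : m.-integrable (cell j x) (EFin \o (fun x => (u x) ^+ 2)).
Proof. by apply: (integrableS measurableT) => //; exact: measurable_cell. Qed.

Let mucell (f : T -> R) j x : measurable_fun setT f -> measurable_fun (cell j x) f.
Proof. exact: measurable_funS. Qed.

Lemma average_cell_sqr_le j i :
  (((average m (c j @^-1` [set i]) (v j) u) ^+ 2)%:E <= (v j)^-1%:E * \int[m]_x ((u x) ^+ 2)%:E)%E.
Proof.
have iQ : m.-integrable (c j @^-1` [set i]) (EFin \o (fun x => (u x) ^+ 2)).
  exact: (integrableS measurableT).
apply: le_trans.
  exact: (sqr_average_le (mc j i) (mv j i) (v0 j) (measurable_funS measurableT (@subsetT _ _) mu) iQ).
apply: lee_wpmul2l; first by rewrite lee_fin invr_ge0 ltW.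
apply: ge0_subset_integral => //.
  by case/integrableP : ui.
by move=> y _; rewrite lee_fin sqr_ge0.
Qed.

(** A Poincare inequality: by Jensen, (u x - E_j u x)^2 is at most the mean of (u x - u y)^2 over y
    in the cell of x, and there [K] dominates the density 1 / [v j] of that mean. Letting y range
    over the whole space only increases the integral. *)
Lemma sqr_sub_cexp_le j (K : T * T -> R) : measurable_fun setT K ->
  (forall z, 0 <= K z) -> (forall x y, c j x = c j y -> (v j)^-1 <= K (x, y)) ->
  (\int[m]_x ((u x - cexp j u x) ^+ 2)%:E <= gag m K u)%E.
Proof.
move=> mK K0 cK; rewrite /gag fubini_tonelli1//; last 2 first.
  by apply/measurable_EFinP; exact: measurable_gag_integrand.
  by move=> z; rewrite lee_fin mulr_ge0 ?sqr_ge0.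
have mGz : measurable_fun setT (fun z => ((u z.1 - u z.2) ^+ 2 * K z)%:E).
  by apply/measurable_EFinP; exact: measurable_gag_integrand.
apply: ge0_le_integral => //.
- by move=> x _; rewrite lee_fin sqr_ge0.
- apply/measurable_EFinP; apply: measurable_funX; apply: measurable_funB => //.
  exact: measurable_cexp.
- apply: measurable_fun_fubini_tonelli_F mGz _ => z.
  by rewrite lee_fin mulr_ge0 ?sqr_ge0.
move=> x _.
have mQ := measurable_cell j x.
have i1 := integrable_of_sqr mQ (mv j (c j x)) (mucell mu) (ucell j x).
have i2 := integrable_sqrB (u x) mQ (mv j (c j x)) (mucell mu) (ucell j x).
have mB : measurable_fun setT (fun y => u y - u x) by exact: measurable_funB.
rewrite -sqrrN opprB /cexp -(averageB _ mQ (mv j (c j x)) (v0 j) i1).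
apply: le_trans.
  exact: (sqr_average_le mQ (mv j (c j x)) (v0 j) (mucell mB) i2).
rewrite -ge0_integralZl//; last 3 first.
- by apply/measurable_EFinP; apply: measurable_funX; exact: mucell.
- by move=> y _; rewrite lee_fin sqr_ge0.
- by rewrite lee_fin invr_ge0 ltW.
have mx : measurable_fun setT (fun y => ((u x - u y) ^+ 2 * K (x, y))%:E).
  exact: measurableT_comp mGz (measurable_pair1 x).
apply: (@le_trans _ _ (\int[m]_(y in cell j x) ((u x - u y) ^+ 2 * K (x, y))%:E)%E).
  apply: ge0_le_integral => //.
  - by move=> y _; rewrite -EFinM lee_fin mulr_ge0 ?sqr_ge0// invr_ge0 ltW.
  - apply: measurable_funeM; apply/measurable_EFinP; apply: measurable_funX; exact: mucell.
  - exact: measurable_funS mx.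
  - move=> y /= yx; rewrite -EFinM lee_fin mulrC -sqrrN opprB ler_wpM2l ?sqr_ge0//; exact: cK.
apply: ge0_subset_integral => //.
by move=> y _; rewrite lee_fin mulr_ge0 ?sqr_ge0.
Qed.

(* [cexp j u] is constant on the cells of level [j + 1], so that its increment
   there is the average of [u - cexp j u]. *)
Lemma cexp_incr_sqr_le j x :
  (((cexp j.+1 u x - cexp j u x) ^+ 2)%:E <=
   (v j.+1)^-1%:E * \int[m]_x ((u x - cexp j u x) ^+ 2)%:E)%E.
Proof.
have mQ := measurable_cell j.+1 x.
have i1 := integrable_of_sqr mQ (mv j.+1 (c j.+1 x)) (mucell mu) (ucell j.+1 x).
have i2 := integrable_sqrB (cexp j u x) mQ (mv j.+1 (c j.+1 x)) (mucell mu) (ucell j.+1 x).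
have mB : measurable_fun setT (fun y => u y - cexp j u x) by exact: measurable_funB.
have mE : measurable_fun setT (fun y => ((u y - cexp j u y) ^+ 2)%:E).
  by apply/measurable_EFinP; apply: measurable_funX; apply: measurable_funB => //; exact: measurable_cexp.
have := averageB (cexp j u x) mQ (mv j.+1 (c j.+1 x)) (v0 _) i1; rewrite -[average _ _ _ u]/(cexp _ _ _) => <-.
apply: le_trans.
  exact: (sqr_average_le mQ (mv j.+1 (c j.+1 x)) (v0 _) (mucell mB) i2).
apply: lee_wpmul2l; first by rewrite lee_fin invr_ge0 ltW.
rewrite (eq_integral (fun y => ((u y - cexp j u y) ^+ 2)%:E)); last first.
  by move=> y; rewrite inE /cell/= => yx; rewrite (@cexp_cell j u x y)//; exact: refc.
apply: ge0_subset_integral => //.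
by move=> y _; rewrite lee_fin sqr_ge0.
Qed.

End sqr.
End cells.

Section sqrt2.
Context {R : realType}.
Implicit Types (p K x : R) (b : nat -> R).
Local Notation s := (Num.sqrt 2 : R).

Lemma sqrt2_sqr : s ^+ 2 = 2. Proof. exact: sqr_sqrtr. Qed.

Lemma sqrt2_gt1 : 1 < s.
Proof. by rewrite -[ltLHS]sqrtr1 ltr_sqrt// ltr1n. Qed.

Lemma sqrt2_gt0 : 0 < s. Proof. by rewrite sqrtr_gt0. Qed.

Lemma exists_le_sqrt2X K x : 0 < K -> exists i, x <= K * s ^+ i.+1.
Proof.
move=> K0; pose n := (Num.truncn `|x / K|).+1; exists n.*2.
have h1 : x / K <= s ^+ n.*2.
  rewrite -mul2n exprM sqrt2_sqr; apply: (@le_trans _ _ n%:R).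
    exact: le_trans (ler_norm _) (ltW (truncnS_gt _)).
  by rewrite -natrX ler_nat ltnW// ltn_expl.
rewrite -ler_pdivrMl// mulrC (le_trans h1)// ler_weXn2l//.
exact/ltW/sqrt2_gt1.
Qed.

(** This is where p < 2 makes the ratio 2^(p/2 - 1) of the geometric series less than 1. *)
Lemma sqrt2_powR_lt p : p < 2 -> s `^ p < 2.
Proof.
move=> p2; have s0 := sqrt2_gt0; rewrite -[ltRHS]sqrt2_sqr -powR_mulrn ?ltW//.
by rewrite /powR gt_eqF// ltr_expR ltr_pM2r// ln_gt0// sqrt2_gt1.
Qed.

(* [i] is least such that [b 0 <= 2 K s^(i+1)]. *)
Lemma exists_powR_le p K b : 0 <= p -> 0 < K -> (forall i, 0 <= b i) ->
  (forall i, b 0%N <= b i + K * s ^+ i) ->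
  exists i, b 0%N `^ (p + 2) <= 4 * (2 * K * s ^+ i.+1) `^ p * b i ^+ 2.
Proof.
move=> p0 K0 b0 bK; have s0 := sqrt2_gt0.
have ex : exists i, b 0%N <= 2 * K * s ^+ i.+1 by apply: exists_le_sqrt2X; rewrite mulr_gt0.
have h x y : 0 <= x -> x <= y -> x `^ (p + 2) <= y `^ p * x ^+ 2.
  move=> x0 xy; rewrite -powR_mulrn// powRD; last by apply/implyP => /eqP; lra.
  by rewrite ler_wpM2r ?powR_ge0// ge0_ler_powR// nnegrE// (le_trans x0).
have [i ile imin] := ex_minnP ex; exists i.
apply: le_trans (h _ _ (b0 0%N) ile) _.
rewrite [leRHS](_ : _ = (2 * K * s ^+ i.+1) `^ p * (4 * b i ^+ 2)); last by ring.
rewrite ler_wpM2l ?powR_ge0//.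
have -> : 4 * b i ^+ 2 = (2 * b i) ^+ 2 by ring.
rewrite ler_pXn2r ?nnegrE//; last by rewrite mulr_ge0.
(* It remains to see that [b 0 <= 2 * b i]. For a positive index, minimality gives
   [2 * K * s ^+ i < b 0] at that index, so the deviation [K * s ^+ i] absorbs at most half of
   [b 0]. *)
case: i ile imin => [|i] ile imin; first by have := b0 0%N; lra.
have := bK i.+1.
have : 2 * K * s ^+ i.+1 < b 0%N by rewrite ltNge; apply/negP => /imin; rewrite ltnn.
lra.
Qed.

Lemma nneseries_geometric_le (C r : R) : 0 <= C -> 0 < r < 1 ->
  (\sum_(0 <= i <oo) (C * r ^+ i)%:E <= (C / (1 - r))%:E)%E.
Proof.
move=> C0 /andP[r0 r1]; apply: lime_le.
  by apply: is_cvg_nneseries => n _ _; rewrite lee_fin mulr_ge0// exprn_ge0// ltW.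
apply: nearW => n; rewrite sumEFin lee_fin.
have := @geometric_le_lim R n C r C0 r0; rewrite gtr0_norm// => /(_ r1).
by rewrite /series /geometric.
Qed.

End sqrt2.

(** * Higher powers of the deviation from the averages *)

Section cells_power.
Context d (T : measurableType d) {R : realType} (m : {sigma_finite_measure set T -> \bar R}).
Variables (I : countType) (c : nat -> T -> I).
Let v j : R := (4 ^+ j)^-1.
Hypotheses (mc : forall j i, measurable (c j @^-1` [set i]))
  (mv : forall j i, m (c j @^-1` [set i]) = (v j)%:E)
  (refc : forall j x y, c j.+1 x = c j.+1 y -> c j x = c j y).
Local Notation E := (cexp m c v).
Local Notation s := (Num.sqrt 2 : R).

Let v0 j : 0 < v j. Proof. by rewrite /v invr_gt0 exprn_gt0. Qed.

Lemma sqrt2_sub1_gt0 : 0 < s - 1. Proof. by rewrite subr_gt0 sqrt2_gt1. Qed.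

Section one.
Variables (u : T -> R) (A : R).
Hypotheses (mu : measurable_fun setT u) (ui : m.-integrable setT (fun x => ((u x) ^+ 2)%:E))
  (A0 : 0 < A) (uA : forall j, (\int[m]_x ((u x - E j u x) ^+ 2)%:E <= (A / 2 ^+ j)%:E)%E).

(** The squared increment is at most 4^(j+1) A / 2^j = (2 sqrt A s^j)^2: the inverse cell measure
    beats the decay of the mean square error by a factor 2 per level. *)
Lemma cexp_incr_le j x : `|E j.+1 u x - E j u x| <= 2 * Num.sqrt A * s ^+ j.
Proof.
have s0 := @sqrt2_gt0 R; have := cexp_incr_sqr_le mc v0 mv refc mu ui j x.
have h : ((v j.+1)^-1%:E * \int[m]_x ((u x - E j u x) ^+ 2)%:E <= (4 ^+ j.+1 * (A / 2 ^+ j))%:E)%E.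
  by rewrite EFinM /v invrK; apply: lee_wpmul2l (uA j); rewrite lee_fin exprn_ge0.
move/le_trans => /(_ _ h); rewrite lee_fin => {}h.
have B0 : 0 <= 2 * Num.sqrt A * s ^+ j.
  by apply: mulr_ge0; [rewrite mulr_ge0// sqrtr_ge0|rewrite exprn_ge0// ltW].
rewrite -(ler_pXn2r (n := 2))// ?nnegrE//.
rewrite real_normK ?num_real// (le_trans h)// !exprMn sqr_sqrtr ?(ltW A0)// -exprM mulnC exprM sqrt2_sqr.
rewrite exprS (_ : 4 ^+ j = 2 ^+ j * 2 ^+ j :> R); last by rewrite -exprMn; congr (_ ^+ _); ring.
by rewrite le_eqVlt; apply/orP; left; apply/eqP; field; rewrite expf_neq0.
Qed.

(** Increments grow geometrically, so the last one governs their sum. The constant K = 2 sqrt A / (s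
    - 1) solves 2 sqrt A + K = K s, which closes the induction. *)
Lemma cexp_dist_le j i x :
  `|E (j + i) u x - E j u x| <= 2 * Num.sqrt A / (s - 1) * s ^+ (j + i).
Proof.
have s0 := @sqrt2_gt0 R; have s1 := sqrt2_sub1_gt0.
elim: i => [|i IH].
  rewrite addn0 subrr normr0; apply: mulr_ge0; last by rewrite exprn_ge0// ltW.
  by rewrite divr_ge0 ?(ltW s1)// mulr_ge0// sqrtr_ge0.
rewrite addnS.
have -> : E (j + i).+1 u x - E j u x = (E (j + i).+1 u x - E (j + i) u x) + (E (j + i) u x - E j u x).
  by rewrite addrA subrK.
rewrite (le_trans (ler_normD _ _))// (le_trans (lerD (cexp_incr_le _ _) IH))// exprS.
rewrite le_eqVlt; apply/orP; left; apply/eqP; field; exact: lt0r_neq0.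
Qed.

Lemma integral_sub_cexp_powR_le p j : 0 <= p -> p < 2 ->
  (\int[m]_x (`|u x - E j u x| `^ (p + 2))%:E <=
   (4 * (2 * (2 * Num.sqrt A / (s - 1)) * s) `^ p * A / (1 - s `^ p / 2) * (s `^ p / 2) ^+ j)%:E)%E.
Proof.
move=> p0 p2; set K := 2 * Num.sqrt A / (s - 1).
have s0 := @sqrt2_gt0 R; have s1 := sqrt2_sub1_gt0.
have K0 : 0 < K by rewrite divr_gt0// mulr_gt0// sqrtr_gt0.
have r0 : 0 < s `^ p / 2 by rewrite divr_gt0// powR_gt0.
have r1 : s `^ p / 2 < 1 by rewrite ltr_pdivrMr// mul1r sqrt2_powR_lt.
have mE i : measurable_fun setT (fun x => (u x - E i u x)).
  by apply: measurable_funB => //; exact: measurable_cexp.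
(* The bound of [exists_powR_le] for the sequence |u x - E_(j+i) u x|. The index it selects depends
   on x; summing over all i removes this dependence, and each term is then integrated with [uA]. *)
pose g i x := 4 * (2 * (K * s ^+ j) * s ^+ i.+1) `^ p * (u x - E (j + i) u x) ^+ 2.
have g0 i x : 0 <= g i x by rewrite mulr_ge0 ?sqr_ge0// mulr_ge0 ?powR_ge0.
have mg i : measurable_fun setT (fun x => (g i x)%:E).
  by apply/measurable_EFinP; apply: measurable_funM => //; apply: measurable_funX.
apply: (@le_trans _ _ (\int[m]_x (\sum_(0 <= i <oo) (g i x)%:E)%E)%E).
  apply: ge0_le_integral => //.
  - apply/measurable_EFinP.
    apply: (measurableT_comp (measurable_powR (p + 2))).
    by apply: measurableT_comp => //.
  - apply: ge0_emeasurable_sum => // i x _ _; exact: g0.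
  move=> x _.
  have Ks0 : 0 < K * s ^+ j by rewrite mulr_gt0// exprn_gt0.
  have [|k] := @exists_powR_le R p _ (fun i => `|u x - E (j + i) u x|) p0 Ks0 (fun i => normr_ge0 _).
    move=> k; rewrite addn0 -mulrA -exprD -lerBlDl.
    rewrite (le_trans (lerB_dist _ _))// (le_trans _ (cexp_dist_le j k x))//.
    by rewrite le_eqVlt; apply/orP; left; apply/eqP; congr `|_|; ring.
  rewrite /= addn0 real_normK ?num_real// => h.
  apply: le_trans (nneseries_lim_ge k.+1 _); last by move=> i _ _; rewrite lee_fin.
  rewrite big_nat_recr//= -[leLHS]add0e; apply: leeD; last by rewrite lee_fin.
  by apply: sume_ge0 => i _; rewrite lee_fin.
rewrite integral_nneseries//; last by move=> i x _; rewrite lee_fin.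
apply: (@le_trans _ _ (\sum_(0 <= i <oo) (4 * (2 * K * s) `^ p * A * (s `^ p / 2) ^+ j * (s `^ p / 2) ^+ i)%:E)%E).
  apply: lee_nneseries => i; first by move=> _ _; apply: integral_ge0 => x _; rewrite lee_fin.
  move=> _.
  under eq_integral do rewrite EFinM.
  rewrite ge0_integralZl//; last 3 first.
  - by apply/measurable_EFinP; apply: measurable_funX.
  - by move=> x _; rewrite lee_fin sqr_ge0.
  - by rewrite lee_fin mulr_ge0// powR_ge0.
  apply: (@le_trans _ _ ((4 * (2 * (K * s ^+ j) * s ^+ i.+1) `^ p)%:E * (A / 2 ^+ (j + i))%:E)%E).
    by apply: lee_wpmul2l (uA _); rewrite lee_fin mulr_ge0// powR_ge0.
  rewrite -EFinM lee_fin.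
  have -> : 2 * (K * s ^+ j) * s ^+ i.+1 = (2 * K * s) * s ^+ (j + i).
    by rewrite exprD exprS; ring.
  rewrite [X in 4 * X]powRM; last 2 first.
    exact/ltW/mulr_gt0/s0/mulr_gt0.
    by rewrite exprn_ge0// ltW.
  have -> : (s ^+ (j + i)) `^ p = (s `^ p) ^+ (j + i).
    by rewrite -powR_mulrn ?ltW// -powRrM mulrC powRrM powR_mulrn// powR_ge0.
  rewrite le_eqVlt; apply/orP; left; apply/eqP; rewrite !expr_div_n !exprD.
  by field; rewrite !expf_neq0.
apply: le_trans (nneseries_geometric_le _ _) _.
- by rewrite !mulr_ge0 ?powR_ge0 ?exprn_ge0 ?(ltW r0) ?(ltW A0).
- by rewrite r0.
by rewrite lee_fin le_eqVlt; apply/orP; left; apply/eqP; ring.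
Qed.

End one.
End cells_power.

(** * Extraction of locally convergent subsequences *)

(** [J] is arbitrary, so compactness of the product yields a cluster point and not a convergent
    subsequence. Its neighbourhoods constrain finitely many coordinates at a time, which is all that
    the later selection asks for. *)
Lemma exists_cluster_seq {R : realType} {J : eqType} (g : nat -> J -> R) :
  (forall j, exists M, forall n, `|g n j| <= M) ->
  exists a : J -> R, forall (s : seq J) (e : J -> R) N, (forall j, 0 < e j) ->
    exists2 n, (N <= n)%N & forall j, j \in s -> `|g n j - a j| < e j.
Proof.
move=> /choice[M gM].
have cA (j : J) : compact (`[- M j, M j] : set R) by exact: segment_compact.
have [] := tychonoff cA (F := g @ \oo).
  exists 0%N => // n _ j /=; rewrite in_itv/= -ler_norml; exact: gM.
move=> a [_ ca]; exists a => s e N e0.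
have [||f [[n Nn <-] fs]] := ca (g @` [set n | (N <= n)%N]) [set f | forall j, j \in s -> `|f j - a j| < e j].
- by exists N => // n /= Nn; exists n.
- elim: s => [|j s IH]; first by apply: filterS filterT => f _ j; rewrite in_nil.
  have h : nbhs a [set f | `|a j - f j| < e j].
    exact: (@proj_continuous J (fun=> R : topologicalType) j a _ (nbhsx_ballx (a j) _ (e0 j))).
  move: IH h; apply: filterS2 => f fs fj i; rewrite inE => /orP[/eqP->|/fs//].
  by rewrite distrC.
by exists n.
Qed.

Lemma cvg_norm_powR {R : realType} (y : nat -> R) (l q : R) : 0 < q ->
  y n @[n --> \oo] --> l -> `|y n| `^ q @[n --> \oo] --> `|l| `^ q.
Proof.
move=> q0 yl; have [l0|l0] := eqVneq l 0.
  rewrite l0 in yl *.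
  rewrite normr0 powR0 ?gt_eqF//; apply/cvgrPdist_le => e e0.
  have d0 : 0 < e `^ q^-1 by rewrite powR_gt0.
  move/cvgrPdist_le : yl => /(_ _ d0); apply: filterS => n.
  rewrite !sub0r !normrN => h; rewrite ger0_norm ?powR_ge0//.
  rewrite -[leRHS]powRr1 ?(ltW e0)// -(mulVf (lt0r_neq0 q0)) powRrM.
  by apply: ge0_ler_powR => //; rewrite ?nnegrE ?(ltW q0)// ltW.
have l1 : 0 < `|l| by rewrite normr_gt0.
have := is_derive1_powR q l1 => -[/derivable1_diffP/differentiable_continuous cq _].
exact: cvg_comp (cvg_norm yl) cq.
Qed.

Section local_limit.
Context d (T : measurableType d) {R : realType} (m : {measure set T -> \bar R}).
Variables (S : nat -> set T) (w : nat -> T -> R) (q B r : R).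
Hypotheses (mS : forall k, measurable (S k)) (Sle : {homo S : k l / (k <= l)%N >-> k `<=` l})
  (ST : forall x, exists k, S k x) (mw : forall k, measurable_fun setT (w k))
  (q1 : 1 <= q) (q4 : q <= 4) (B0 : 0 <= B) (r0 : 0 < r) (r1 : r < 1)
  (wB : forall k l, (k <= l)%N ->
    (\int[m]_x (\1_(S k) x * `|w k x - w l x| `^ q)%:E <= (B * r ^+ k)%:E)%E).

Let q0 : 0 < q. Proof. exact: lt_le_trans ltr01 q1. Qed.

(** A ratio with r < lam^3 < 1, so that both lam^k and r^k / lam^(3 k) are summable. The cube fits q
    - 1 <= 3, as used in [dist_le]. *)
Let lam : R := 1 - (1 - r) / 4.
Let lam0 : 0 < lam. Proof. by move: r0 r1; rewrite /lam; lra. Qed.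
Let lam1 : lam < 1. Proof. by move: r0 r1; rewrite /lam; lra. Qed.
Let rlam : r < lam ^+ 3.
Proof.
have e : lam ^+ 3 - r = (1 - r) / 4 + ((1 - r) / 4) ^+ 2 * (3 - (1 - r) / 4).
  by rewrite /lam; field.
have h : 0 <= ((1 - r) / 4) ^+ 2 * (3 - (1 - r) / 4) by apply: mulr_ge0; [exact: sqr_ge0|move: r0 r1; lra].
by rewrite -subr_gt0 e; move: r1; lra.
Qed.

Let g k x := \1_(S k) x * `|w k x - w k.+1 x| `^ q / lam ^+ (3 * k).

Let g0 k x : 0 <= g k x.
Proof. by rewrite /g !mulr_ge0 ?powR_ge0 ?invr_ge0 ?exprn_ge0 ?(ltW lam0). Qed.

Lemma measurable_norm_powR (f : T -> R) : measurable_fun setT f ->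
  measurable_fun setT (fun x => `|f x| `^ q).
Proof.
move=> mf; apply: (measurableT_comp (measurable_powR q)).
by apply: measurableT_comp => //.
Qed.

Let mD k l : measurable_fun setT (fun x => \1_(S k) x * `|w k x - w l x| `^ q).
Proof.
by apply: measurable_funM => //; apply: measurable_norm_powR; exact: measurable_funB.
Qed.

Let mg k : measurable_fun setT (g k).
Proof. by apply: measurable_funM => //; exact: mD. Qed.

Let ae_sum_fin : {ae m, forall x, (\sum_(0 <= k <oo) (g k x)%:E < +oo)%E}.
Proof.
have mgs : measurable_fun setT (fun x => \sum_(0 <= k <oo) (g k x)%:E)%E.
  apply: ge0_emeasurable_sum => k; first by move=> x _ _; rewrite lee_fin.
  by move=> _; exact/measurable_EFinP.
have gs0 x : (0 <= \sum_(0 <= k <oo) (g k x)%:E)%E by apply: nneseries_ge0 => k _ _; rewrite lee_fin.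
have ig : m.-integrable setT (fun x => \sum_(0 <= k <oo) (g k x)%:E)%E.
  apply/integrableP; split => //.
  under eq_integral do rewrite gee0_abs//.
  rewrite integral_nneseries//; last 2 first.
    by move=> k; exact/measurable_EFinP.
    by move=> k x _; rewrite lee_fin.
  apply: (@le_lt_trans _ _ (\sum_(0 <= k <oo) (B * (r / lam ^+ 3) ^+ k)%:E)%E).
    apply: lee_nneseries => k; first by move=> _ _; apply: integral_ge0 => x _; rewrite lee_fin.
    move=> _; under eq_integral do rewrite /g mulrC EFinM.
    rewrite ge0_integralZl//; last 2 first.
    - by apply/measurable_EFinP; exact: mD.
    - by rewrite lee_fin invr_ge0 exprn_ge0// ltW.
    apply: le_trans.
      by apply: lee_wpmul2l (wB (leqnSn k)); rewrite lee_fin invr_ge0 exprn_ge0// ltW.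
    by rewrite -EFinM lee_fin expr_div_n -exprM mulrCA [X in B * X]mulrC.
  apply: le_lt_trans (nneseries_geometric_le B0 _) (ltry _).
  by rewrite divr_gt0 ?exprn_gt0//= ltr_pdivrMr ?exprn_gt0// mul1r.
have := integrable_ae measurableT ig.
by apply: ae_monotone => x /(_ I); rewrite ge0_fin_numE.
Qed.

(** Let t be the increment. If t exceeds lam^k, then t^(q - 1) >= lam^(k (q - 1)) >= lam^(3 k)
    because q <= 4 and lam <= 1, whence t <= t^q / lam^(3 k). *)
Let dist_le k x : S k x -> `|w k.+1 x - w k x| <= lam ^+ k + g k x.
Proof.
move=> Skx; rewrite distrC /g indicE mem_set// mul1r.
set t := `|_|; have [h|h] := leP t (lam ^+ k).
  rewrite (le_trans h)// lerDl; apply: divr_ge0; first exact: powR_ge0.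
  exact/exprn_ge0/ltW/lam0.
have lk0 : 0 < lam ^+ k by rewrite exprn_gt0.
have t0 : 0 < t by exact: lt_trans h.
rewrite ler_wpDl ?(ltW lk0)// ler_pdivlMr ?exprn_gt0// mulnC exprM.
rewrite -[q](subrK 1) powRD; last by apply/implyP => _; exact: lt0r_neq0.
rewrite powRr1 ?(ltW t0)// mulrC ler_wpM2r ?(ltW t0)//.
apply: (@le_trans _ _ ((lam ^+ k) `^ (q - 1))).
  rewrite -powR_mulrn ?(ltW lk0)//; apply: ger_powR; last by move: q4; lra.
  by rewrite lk0/=; exact: exprn_ile1 (ltW lam0) (ltW lam1).
by apply: ge0_ler_powR; rewrite ?nnegrE ?(ltW lk0) ?(ltW t0) ?(ltW h)// subr_ge0.
Qed.

Let is_cvg_w x : (\sum_(0 <= k <oo) (g k x)%:E < +oo)%E -> cvgn (w ^~ x).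
Proof.
move=> gfin; have [k0 Sx] := ST x.
(* [g k] controls the increment only on [S k], so the sequence is shifted to start once x has
   entered these sets. *)
have S0 k : S (k + k0)%N x by apply: Sle Sx; rewrite leq_addl.
pose y n := w (n + k0)%N x.
have yE n : y n = y 0%N + series (fun i => y i.+1 - y i) n.
  by rewrite /series /= telescope_sumr// addrC subrK.
suff cs : cvgn (series (fun i => y i.+1 - y i)).
  have cy : cvgn y.
    rewrite (_ : y = (fun n => y 0%N + series (fun i => y i.+1 - y i) n)); last exact/funext.
    by apply: is_cvgD => //; exact: is_cvg_cst.
  apply/cvg_ex; exists (limn y); rewrite -(cvg_shiftn k0); exact: cy.
apply: normed_cvg; apply: nondecreasing_is_cvgn.
  by apply: nondecreasing_series => i _ _; exact: normr_ge0.
exists (1 / (1 - lam) + fine (\sum_(0 <= k <oo) (g k x)%:E)) => _ [n _ <-].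
have h1 : series (fun i => `|y i.+1 - y i|) n <= \sum_(0 <= i < n) (lam ^+ i + g (i + k0)%N x).
  rewrite /series /=; apply: ler_sum => i _.
  rewrite (le_trans (dist_le (S0 i)))// lerD2r exprD ler_piMr ?exprn_ge0 ?(ltW lam0)//.
  exact: exprn_ile1 (ltW lam0) (ltW lam1).
rewrite (le_trans h1)// big_split/=; apply: lerD.
  have := @geometric_le_lim R n 1 lam ler01 lam0; rewrite gtr0_norm// => /(_ lam1).
  by rewrite /series /geometric /=; under eq_bigr do rewrite mul1r.
rewrite -lee_fin fineK; last first.
  by rewrite ge0_fin_numE//; apply: nneseries_ge0 => k _ _; rewrite lee_fin.
apply: le_trans (nneseries_lim_ge (n + k0) _); last by move=> k _ _; rewrite lee_fin.
rewrite sumEFin lee_fin [leRHS](big_cat_nat (leq0n k0) (leq_addl n k0))/= -[leLHS]add0r lerD ?sumr_ge0//.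
by rewrite -{2}[k0]add0n big_addn addnK.
Qed.

(* The series of the [g k] has finite integral, and
   [|w (k + 1) - w k| <= lam ^ k + g k] on [S k], so [w] converges almost
   everywhere; the integral bounds pass to the limit by Fatou's lemma. *)
Lemma exists_local_limit : exists2 u : T -> R, measurable_fun setT u &
  forall k, (\int[m]_x (\1_(S k) x * `|w k x - u x| `^ q)%:E <= (B * r ^+ k)%:E)%E.
Proof.
have [N [mN N0 NP]] := ae_sum_fin.
(* Setting the sequence to 0 on the exceptional null set makes it converge everywhere, as the
   measurability of the limit and [fatou_le] require. *)
pose w' k x := \1_(~` N) x * w k x.
have mN1 : measurable_fun setT (\1_(~` N) : T -> R).
  by apply: measurable_indic; exact: measurableC.
have mw' k : measurable_fun setT (w' k) by exact: measurable_funM.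
have w'N x : N x -> forall k, w' k x = 0.
  by move=> Nx k; rewrite /w' indicE memNset ?mul0r//; apply/not_notP.
have w'E x : ~ N x -> forall k, w' k x = w k x.
  by move=> Nx k; rewrite /w' indicE mem_set ?mul1r.
pose u x := limn (w' ^~ x).
have w'u x : w' k x @[k --> \oo] --> u x.
  have [Nx|Nx] := pselect (N x).
    by apply: cvgP; rewrite (_ : w' ^~ x = cst 0); [exact: cvg_cst|apply/funext => k; exact: w'N].
  apply/cvg_ex; rewrite (_ : w' ^~ x = w ^~ x); last by apply/funext => k; exact: w'E.
  apply/cvg_ex/is_cvg_w; apply/not_notP => h; exact/Nx/NP.
have mu : measurable_fun setT u by apply: (measurable_fun_cvg mw') => x _; exact: w'u.
exists u => // k.
have mk (f : T -> R) : measurable_fun setT f -> measurable_fun setT (fun x => (\1_(S k) x * `|w k x - f x| `^ q)%:E).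
  move=> mf; apply/measurable_EFinP.
  by apply: measurable_funM => //; apply: measurable_norm_powR; exact: measurable_funB.
have mk' (f : T -> R) : measurable_fun setT f -> measurable_fun setT (fun x => (\1_(S k) x * `|w' k x - f x| `^ q)%:E).
  move=> mf; apply/measurable_EFinP.
  by apply: measurable_funM => //; apply: measurable_norm_powR; exact: measurable_funB.
have k0 (f1 f2 : T -> R) x : (0 <= (\1_(S k) x * `|f1 x - f2 x| `^ q)%:E)%E.
  by rewrite lee_fin mulr_ge0 ?powR_ge0.
have aeN (P : T -> Prop) : (forall x, ~ N x -> P x) -> {ae m, forall x, P x}.
  by move=> h; exists N; split => // x /= nP; apply/not_notP => /h.
rewrite (@ge0_ae_eq_integral _ _ _ _ _ _ (fun x => (\1_(S k) x * `|w' k x - u x| `^ q)%:E))//.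
- apply: (@fatou_le _ _ _ _ (fun l x => \1_(S k) x * `|w' k x - w' l x| `^ q)).
  + by move=> l; apply/measurable_EFinP; exact: mk'.
  + by move=> l x; rewrite mulr_ge0 ?powR_ge0.
  + move=> x; apply: cvgMr => //; apply: cvg_norm_powR => //.
    by apply: cvgB => //; exact: cvg_cst.
  move=> e e0; exists k => // l /= kl.
  rewrite (@ge0_ae_eq_integral _ _ _ _ _ _ (fun x => (\1_(S k) x * `|w k x - w l x| `^ q)%:E))//.
  + by apply: le_trans (wB kl) _; rewrite leeDl// lee_fin ltW.
  + exact: mk'.
  + exact: mk.
  + by apply: aeN => x Nx _; rewrite !w'E.
- exact: mk.
- exact: mk'.
- by apply: aeN => x Nx _; rewrite w'E.
Qed.

End local_limit.

(** The sum is at most three times its largest term in absolute value. *)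
Lemma powR_norm_add3_le {R : realType} (q a b e : R) : 0 <= q ->
  `|a + b + e| `^ q <= 3 `^ q * (`|a| `^ q + `|b| `^ q + `|e| `^ q).
Proof.
move=> q0; pose M := Num.max (Num.max `|a| `|b|) `|e|.
have [am bm em] : [/\ `|a| <= M, `|b| <= M & `|e| <= M].
  by rewrite /M !le_max !lexx !orbT.
have M0 : 0 <= M by exact: le_trans (normr_ge0 a) am.
apply: (@le_trans _ _ ((3 * M) `^ q)).
  apply: ge0_ler_powR => //; rewrite ?nnegrE ?mulr_ge0//.
  by have := ler_normD (a + b) e; have := ler_normD a b; lra.
rewrite powRM// ler_wpM2l ?powR_ge0//.
have := powR_ge0 `|a| q; have := powR_ge0 `|b| q; have := powR_ge0 `|e| q.
have [->|->|->] : [\/ M = `|a|, M = `|b| | M = `|e|]; try lra.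
rewrite /M maxEle; case: ifP => _; first by constructor 3.
by rewrite maxEle; case: ifP => _; [constructor 2|constructor 1].
Qed.

Section cells_compactness.
Context d (T : measurableType d) {R : realType} (m : {sigma_finite_measure set T -> \bar R}).
Variables (I : countType) (c : nat -> T -> I) (v : nat -> R) (S : nat -> set T)
  (u_ : nat -> T -> R) (q C r : R).
Local Notation E := (cexp m c v).
Hypotheses (mc : forall j i, measurable (c j @^-1` [set i]))
  (mS : forall k, measurable (S k)) (Sle : {homo S : k l / (k <= l)%N >-> k `<=` l})
  (ST : forall x, exists k, S k x) (Sfin : forall k, (m (S k) < +oo)%E)
  (cS : forall j k, finite_set (c j @` S k))
  (mu_ : forall k, measurable_fun setT (u_ k))
  (q1 : 1 <= q) (q4 : q <= 4) (C0 : 0 <= C) (r0 : 0 < r) (r1 : r < 1)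
  (uC : forall n j, (\int[m]_x (`|u_ n x - E j (u_ n) x| `^ q)%:E <= (C * r ^+ j)%:E)%E)
  (avgM : forall j i, exists M, forall n, `|average m (c j @^-1` [set i]) (v j) (u_ n)| <= M).

Let q0 : 0 <= q. Proof. exact: le_trans ler01 q1. Qed.

(** Two averages, each within [eps k] of a common value, differ by at most [2 * eps k]. As this is
    at most 1 and q >= 1, its power q is no larger than itself, and the denominator then absorbs the
    measure of [S k], giving [epsP]. *)
Let eps k := r ^+ k / (2 * (1 + fine (m (S k)))).

Let M0 k : 0 <= fine (m (S k)). Proof. exact/fine_ge0/measure_ge0. Qed.

Let eps0 k : 0 < eps k.
Proof.
by rewrite /eps divr_gt0 ?exprn_gt0// mulr_gt0// ltr_pwDl.
Qed.

Let epsP k : (((2 * eps k) `^ q)%:E * m (S k) <= (r ^+ k)%:E)%E.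
Proof.
rewrite -[m (S k)]fineK; last by rewrite ge0_fin_numE.
rewrite -EFinM lee_fin; have Mk := M0 k.
have e2 : 2 * eps k = r ^+ k / (1 + fine (m (S k))).
  by rewrite /eps; field; rewrite lt0r_neq0// ltr_pwDl.
have e0 : 0 < 2 * eps k by rewrite mulr_gt0.
have e1 : 2 * eps k <= 1.
  rewrite e2 ler_pdivrMr ?ltr_pwDl// mul1r (@le_trans _ _ 1) ?lerDl//.
  exact: exprn_ile1 (ltW r0) (ltW r1).
apply: (@le_trans _ _ (2 * eps k * fine (m (S k)))).
  rewrite ler_wpM2r// -[leRHS]powRr1 ?(ltW e0)//.
  by apply: ger_powR => //; rewrite e0.
rewrite e2 mulrAC ler_pdivrMr ?ltr_pwDl// ler_wpM2l ?exprn_ge0 ?(ltW r0)//.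
by rewrite lerDr.
Qed.

(** At stage l only the levels j <= l and the cells meeting [S l] are constrained, a finite set by
    [cS]. The tolerance [eps j] depends on the level and not on the stage: level k is used only to
    compare stage k with later ones. *)
Let exists_selection : exists a : nat * I -> R, exists phi : nat -> nat,
  {homo phi : k l / (k < l)%N} /\ forall j l x, (j <= l)%N -> S l x ->
    `|E j (u_ (phi l)) x - a (j, c j x)| < eps j.
Proof.
pose g n (ji : nat * I) := average m (c ji.1 @^-1` [set ji.2]) (v ji.1) (u_ n).
have [a aP] := exists_cluster_seq (g := g) (fun ji => avgM ji.1 ji.2).
have sel (lN : nat * nat) : exists n, (lN.2 <= n)%N /\
    forall j x, (j <= lN.1)%N -> S lN.1 x -> `|E j (u_ n) x - a (j, c j x)| < eps j.
  case: lN => l N /=.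
  have /choice[s sP] j : exists s : seq I, c j @` S l = [set` s] by exact/finite_seqP.
  have [n Nn nP] := aP (flatten [seq [seq (j, i) | i <- s j] | j <- iota 0 l.+1])
    (fun ji => eps ji.1) N (fun ji => eps0 ji.1).
  exists n; split => // j x jl Slx; apply: (nP (j, c j x)).
  apply/flatten_mapP; exists j; first by rewrite mem_iota.
  apply: map_f; have : (c j @` S l) (c j x) by exists x.
  by rewrite sP.
have [f fP] := choice sel.
pose phi := fix phi k := if k is k'.+1 then f (k, (phi k').+1) else f (0%N, 0%N).
exists a, phi; split.
  apply: homo_ltn => [y x z|k]; first exact: ltn_trans.
  by have [] := fP (k.+1, (phi k).+1).
by move=> j [|l] x jl Sx; [have [_] := fP (0%N, 0%N)|have [_] := fP (l.+1, (phi l).+1)]; exact.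
Qed.

(** For k <= l, the difference of [u_ (phi k)] and [u_ (phi l)] splits into their two deviations
    from the level k averages, each costing C r^k, and the difference of these averages, costing r^k
    on [S k] by [epsP]. Hence 2 C + 1, with 3^q from the power of a sum of three terms. *)
Lemma exists_cvg_subseq : exists2 phi : nat -> nat, {homo phi : k l / (k < l)%N} &
  exists2 u : T -> R, measurable_fun setT u & forall k,
    (\int[m]_x (\1_(S k) x * `|u_ (phi k) x - u x| `^ q)%:E <=
     (3 `^ q * (2 * C + 1) * r ^+ k)%:E)%E.
Proof.
have [a [phi [phiP aP]]] := exists_selection.
exists phi => //; apply: (exists_local_limit mS Sle ST) => //.
  by rewrite mulr_ge0 ?powR_ge0// addr_ge0// mulr_ge0.
move=> k l kl.
have mE n : measurable_fun setT (fun x => (`|u_ n x - E k (u_ n) x| `^ q)%:E).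
  apply/measurable_EFinP; apply: measurable_norm_powR.
  by apply: measurable_funB => //; exact: measurable_cexp.
have mI : measurable_fun setT (\1_(S k) : T -> R) by exact: measurable_indic.
have mI2 : measurable_fun setT (fun x => ((2 * eps k) `^ q * \1_(S k) x)%:E).
  by apply/measurable_EFinP; exact: measurable_funM.
apply: (@le_trans _ _ (\int[m]_x ((3 `^ q)%:E *
   ((`|u_ (phi k) x - E k (u_ (phi k)) x| `^ q)%:E +
    (`|u_ (phi l) x - E k (u_ (phi l)) x| `^ q)%:E + ((2 * eps k) `^ q * \1_(S k) x)%:E)))%E).
  apply: ge0_le_integral => //.
  - apply/measurable_EFinP; apply: measurable_funM => //.
    by apply: measurable_norm_powR; exact: measurable_funB.
  - by apply: measurable_funeM; apply: emeasurable_funD => //; exact: emeasurable_funD.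
  move=> x _; rewrite -!EFinD -EFinM lee_fin indicE.
  have [|_] := boolP (x \in S k); last first.
    by rewrite mul0r mulr_ge0 ?powR_ge0// !addr_ge0 ?powR_ge0 ?mulr0.
  rewrite inE mul1r mulr1 => Sx.
  have e2 : `|E k (u_ (phi k)) x - E k (u_ (phi l)) x| <= 2 * eps k.
    have h1 := aP k k x (leqnn k) Sx; have h2 := aP k l x kl (Sle kl Sx).
    rewrite -(subrKA (a (k, c k x))) (le_trans (ler_normD _ _))//.
    by rewrite [`|a _ - _|]distrC; lra.
  have := powR_norm_add3_le (u_ (phi k) x - E k (u_ (phi k)) x)
    (E k (u_ (phi l)) x - u_ (phi l) x) (E k (u_ (phi k)) x - E k (u_ (phi l)) x) q0.
  rewrite [X in `|X| `^ q <= _ -> _](_ : _ = u_ (phi k) x - u_ (phi l) x); last by ring.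
  move=> /le_trans; apply; rewrite ler_wpM2l ?powR_ge0//.
  rewrite [`|E k (u_ (phi l)) x - u_ (phi l) x|]distrC lerD2l.
  by apply: ge0_ler_powR => //; rewrite nnegrE// (le_trans _ e2).
have p0 n x : (0 <= (`|u_ n x - E k (u_ n) x| `^ q)%:E)%E by rewrite lee_fin powR_ge0.
have i0 x : (0 <= ((2 * eps k) `^ q * \1_(S k) x)%:E)%E by rewrite lee_fin mulr_ge0 ?powR_ge0.
rewrite ge0_integralZl//; last 2 first.
- by apply: emeasurable_funD => //; exact: emeasurable_funD.
- by move=> x _; rewrite !adde_ge0.
rewrite ge0_integralD//; last 2 first.
- by move=> x _; rewrite adde_ge0.
- exact: emeasurable_funD.
rewrite ge0_integralD//.
under [X in (_ * (_ + X))%E]eq_integral do rewrite EFinM.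
rewrite ge0_integralZl//; last 2 first.
- exact/measurable_EFinP.
- by rewrite lee_fin powR_ge0.
rewrite integral_indic// setIT -mulrA EFinM; apply: lee_wpmul2l; first by rewrite lee_fin powR_ge0.
rewrite (_ : (2 * C + 1) * r ^+ k = C * r ^+ k + C * r ^+ k + r ^+ k); last by ring.
by rewrite !EFinD; apply: leeD => //; apply: leeD.
Qed.

End cells_compactness.

(** * Dyadic squares *)

Section dyadic.
Context {R : realType}.
Notation mu := (@lebesgue_measure R).
Notation mu2 := (prodm mu mu).
Implicit Types (s t : R) (x y : R * R) (j : nat).

Definition dyadic_index j t : int := Num.floor (2 ^+ j * t).

Definition dyadic_cell j x : int * int := (dyadic_index j x.1, dyadic_index j x.2).

Let pow0 j : 0 < 2 ^+ j :> R. Proof. by rewrite exprn_gt0. Qed.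

Lemma dyadic_index_preimage j (a : int) :
  dyadic_index j @^-1` [set a] = `[a%:~R / 2 ^+ j, (a + 1)%:~R / 2 ^+ j[%classic :> set R.
Proof.
apply/seteqP; split => t /=; rewrite in_itv/= ler_pdivrMr// ltr_pdivlMr// ![t * _]mulrC.
  by move=> <-; exact: floor_itv.
exact: floor_def.
Qed.

Lemma measurable_dyadic_index j a : measurable (dyadic_index j @^-1` [set a] : set R).
Proof. by rewrite dyadic_index_preimage; exact: measurable_itv. Qed.

Lemma lebesgue_dyadic_index j a :
  mu (dyadic_index j @^-1` [set a]) = ((2 ^+ j)^-1)%:E.
Proof.
rewrite dyadic_index_preimage lebesgue_measure_itv/= lte_fin ltr_pM2r ?invr_gt0//.
by rewrite ltr_int ltzD1 lexx -EFinB -mulrBl -rmorphB/= addrAC subrr add0r mul1r.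
Qed.

(** Twice the level j index is an integer below 2^(j+1) times the point, hence below the level j + 1
    index. This gives one inequality, and symmetry the other. *)
Lemma dyadic_index_refine j s t :
  dyadic_index j.+1 s = dyadic_index j.+1 t -> dyadic_index j s = dyadic_index j t.
Proof.
have h s' t' : dyadic_index j.+1 s' = dyadic_index j.+1 t' ->
    (dyadic_index j s' <= dyadic_index j t')%R.
  move=> e; rewrite {2}/dyadic_index floor_ge_int.
  have : (2 * dyadic_index j s' <= dyadic_index j.+1 s')%R.
    rewrite [X in (_ <= X)%R]/dyadic_index floor_ge_int intrM exprS -mulrA ler_pM2l//.
    by have /andP[] := floor_itv (2 ^+ j * s').
  by rewrite e /dyadic_index floor_ge_int intrM exprS -mulrA ler_pM2l.
by move=> e; apply/le_anti; rewrite !h.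
Qed.

Lemma dyadic_index_dist j s t : dyadic_index j s = dyadic_index j t ->
  `|s - t| <= (2 ^+ j)^-1.
Proof.
move=> e; have /andP[] := floor_itv (2 ^+ j * s); have /andP[] := floor_itv (2 ^+ j * t).
rewrite -/(dyadic_index j s) -/(dyadic_index j t) e intrD.
set k := _%:~R => h1 h2 h3 h4.
have : 2 ^+ j * `|s - t| <= 1.
  by rewrite -{1}(gtr0_norm (pow0 j)) -normrM mulrBr ler_norml; apply/andP; split; lra.
by rewrite -ler_pdivlMl// mulr1.
Qed.

Lemma measurable_dyadic_cell j a : measurable (dyadic_cell j @^-1` [set a]).
Proof.
rewrite (_ : _ @^-1` _ = (dyadic_index j @^-1` [set a.1]) `*` (dyadic_index j @^-1` [set a.2])).
  by apply: measurableX; exact: measurable_dyadic_index.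
by apply/seteqP; split => x /=; case: a => a b; [case|case => /= <- <-].
Qed.

Lemma lebesgue_dyadic_cell j a : mu2 (dyadic_cell j @^-1` [set a]) = ((4 ^+ j)^-1)%:E.
Proof.
rewrite (_ : _ @^-1` _ = (dyadic_index j @^-1` [set a.1]) `*` (dyadic_index j @^-1` [set a.2])).
  rewrite /prodm product_measure1E; [|exact: measurable_dyadic_index..].
  transitivity (((2 ^+ j)^-1)%:E * ((2 ^+ j)^-1)%:E : \bar R)%E.
    by congr (_ * _)%E; exact: lebesgue_dyadic_index.
  by rewrite -EFinM -invfM -exprMn -natrM.
by apply/seteqP; split => x /=; case: a => a b; [case|case => /= <- <-].
Qed.

Lemma dyadic_cell_refine j x y : dyadic_cell j.+1 x = dyadic_cell j.+1 y ->
  dyadic_cell j x = dyadic_cell j y.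
Proof. by case=> /dyadic_index_refine e1 /dyadic_index_refine e2; rewrite /dyadic_cell e1 e2. Qed.

(** With d equal to the side 2^-j, the lower bound d^-2 of [Ker_ge] is exactly the inverse area of a
    cell. *)
Lemma dyadic_cell_KerK j x y : dyadic_cell j x = dyadic_cell j y ->
  ((4 ^+ j)^-1)^-1 <= KerK (2 ^+ j)^-1 (x, y).
Proof.
case=> /dyadic_index_dist h1 /dyadic_index_dist h2.
have d0 : 0 < (2 ^+ j)^-1 :> R by rewrite invr_gt0.
apply: le_trans (Ker_ge d0 h1 h2).
rewrite exprVn !invrK -exprM mulnC exprM (_ : 2 ^+ 2 = 4 :> R)//; ring.
Qed.

Lemma hsquare_dyadic_cell_finite j k : finite_set (dyadic_cell j @` hsquare k).
Proof.
pose N := (2 ^ j * k.+1)%N.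
have fN : finite_set [set a : int | (- N%:Z <= a <= N%:Z)%R].
  apply: (@sub_finite_set _ _ ((fun n : nat => n%:Z - N%:Z) @` `I_(N + N).+1)).
    move=> a /andP[a1 a2]; exists (absz (a + N%:Z)); rewrite /= ?ltnS; last first.
      by rewrite gez0_abs ?addrK// -lerBlDr sub0r.
    by rewrite -lez_nat gez0_abs ?PoszD ?lerD2r// -lerBlDr sub0r.
  exact/finite_image/finite_II.
apply: sub_finite_set (finite_setX fN fN) => _ [x [x1 x2] <-].
have h t : hseg k t -> (- N%:Z <= dyadic_index j t <= N%:Z)%R.
  rewrite /hseg/= in_itv/= => /andP[t1 t2]; rewrite /dyadic_index floor_ge_int.
  have e : (N%:Z)%:~R = 2 ^+ j * k.+1%:R :> R by rewrite /N -pmulrn natrM natrX.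
  rewrite rmorphN /= e -mulrN ler_pM2l// (ltW t1)/= -(ler_int R) e.
  by rewrite (le_trans (floor_le_tmp _))// ler_pM2l// ltW.
by split; exact: h.
Qed.

Lemma hsquare_le : {homo @hsquare R : k l / (k <= l)%N >-> k `<=` l}.
Proof.
move=> k l kl; have h : hseg k `<=` (hseg l : set R).
  have : k.+1%:R <= l.+1%:R :> R by rewrite ler_nat.
  by move=> kl' t; rewrite /hseg/= !in_itv/= => /andP[h1 h2]; apply/andP; split; lra.
by move=> x [/h x1 /h x2].
Qed.

Lemma hsquare_norm k x : `|x| <= k%:R -> hsquare k x.
Proof.
rewrite prod_normE ge_max => /andP[]; rewrite !ler_norml => /andP[h1 h2] /andP[h3 h4].
have hk : k%:R < k.+1%:R :> R by rewrite ltr_nat.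
by split; rewrite /hseg/= in_itv/=; apply/andP; split; lra.
Qed.

Lemma bounded_hsquare (B : set (R * R)) : bounded_set B -> exists k, B `<=` hsquare k.
Proof.
move=> [M [_ MB]]; exists (Num.truncn `|M + 1|).+1 => x Bx; apply: hsquare_norm.
apply: MB => //; apply: (@lt_trans _ _ (M + 1)); first by rewrite ltrDl.
exact: le_lt_trans (ler_norm _) (truncnS_gt _).
Qed.

Lemma hsquare_cover x : exists k, hsquare k x.
Proof. by exists (Num.truncn `|x|).+1; apply: hsquare_norm; exact/ltW/truncnS_gt. Qed.

End dyadic.

Section Lfun_powR.
Context d (T : measurableType d) {R : realType} (m : {measure set T -> \bar R}) (q : R).
Hypothesis q0 : 0 < q.

Lemma Lfun_powR (f : T -> R) : measurable_fun setT f ->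
  (\int[m]_x (`|f x| `^ q)%:E < +oo)%E -> f \in Lfun m q%:E.
Proof.
move=> mf fq; rewrite inE; apply/andP; split; rewrite inE//=.
apply: (@lty_poweRy _ _ q); first exact: lt0r_neq0.
by rewrite powR_Lnorm//; exact: lt0r_neq0.
Qed.

Lemma Lnorm_powR_le (f : T -> R) (e : R) : 0 <= e ->
  (\int[m]_x (`|f x| `^ q)%:E <= (e `^ q)%:E)%E -> (Lnorm m q%:E (EFin \o f) <= e%:E)%E.
Proof.
move=> e0 fe; have q1 : q != 0 by exact: lt0r_neq0.
have N0 : (0 <= Lnorm m q%:E (EFin \o f))%E by exact: Lnorm_ge0.
have h : (Lnorm m q%:E (EFin \o f) `^ q <= (e `^ q)%:E)%E by rewrite powR_Lnorm.
have Nfin : Lnorm m q%:E (EFin \o f) \is a fin_num.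
  by rewrite ge0_fin_numE//; apply: lty_poweRy q1 _; exact: le_lt_trans h (ltry _).
move: h N0; rewrite -(fineK Nfin) poweR_EFin !lee_fin => h N0.
by rewrite leNgt; apply/negP => /(gt0_ltr_powR q0); rewrite !nnegrE ltNge h => /(_ e0 N0).
Qed.

End Lfun_powR.

(** * Compactness of the embedding *)

Section compactness.
Context {R : realType}.
Notation mu := (@lebesgue_measure R).
Notation mu2 := (prodm mu mu).
Local Notation s := (Num.sqrt 2 : R).
Implicit Types (p : R) (u : R * R -> R).

Let v j : R := (4 ^+ j)^-1.
Local Notation E := (cexp mu2 dyadic_cell v).

Let v0 j : 0 < v j. Proof. by rewrite /v invr_gt0 exprn_gt0. Qed.

(** The kernel is taken with d = 2^-j, the side of the cells. The [+ 1] keeps the constant positive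
    even for M = 0, as the threshold argument of [exists_powR_le] requires. *)
Lemma Zspace_sub_cexp_sqr_le u M j : Zspace u -> Znorm u <= M ->
  (\int[mu2]_x ((u x - E j u x) ^+ 2)%:E <= ((12 * (2 * pi) ^+ 2 * M ^+ 2 + 1) / 2 ^+ j)%:E)%E.
Proof.
move=> uZ uM; have [mu' ui _ gagu] := Zspace_bound uZ.
have d0 : 0 < (2 ^+ j)^-1 :> R by rewrite invr_gt0 exprn_gt0.
apply: (le_trans (sqr_sub_cexp_le (m := mu2) (c := dyadic_cell) (v := v)
  (K := KerK (2 ^+ j)^-1) measurable_dyadic_cell v0 lebesgue_dyadic_cell mu' ui _ _ _)).
- exact: measurable_Ker.
- by move=> z; exact: Ker_ge0.
- by move=> x y; exact: dyadic_cell_KerK.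
apply: le_trans (gagu _ d0) _; rewrite lee_fin.
rewrite mulrAC ler_pM2r// (@le_trans _ _ (12 * (2 * pi) ^+ 2 * M ^+ 2)) ?lerDl//.
by apply: ler_wpM2l; [rewrite mulr_ge0// sqr_ge0|rewrite ler_pXn2r ?nnegrE ?sqrtr_ge0// (le_trans _ uM)// sqrtr_ge0].
Qed.

(** [C] and [r] are fixed before [u] and [j]; this uniformity over a ball of the space drives the
    compactness. *)
Lemma Zspace_sub_cexp_powR_le p M : 0 <= p -> p < 2 ->
  exists C r, [/\ 0 <= C, 0 < r, r < 1 & forall u j, Zspace u -> Znorm u <= M ->
    (\int[mu2]_x (`|u x - E j u x| `^ (p + 2))%:E <= (C * r ^+ j)%:E)%E].
Proof.
move=> p0 p2; pose A := 12 * (2 * pi) ^+ 2 * M ^+ 2 + 1 : R.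
have A0 : 0 < A by rewrite ltr_wpDl// mulr_ge0 ?sqr_ge0// mulr_ge0// sqr_ge0.
have sp : 0 < s `^ p by rewrite powR_gt0// sqrt2_gt0.
have r1 : s `^ p / 2 < 1 by rewrite ltr_pdivrMr// mul1r sqrt2_powR_lt.
exists (4 * (2 * (2 * Num.sqrt A / (s - 1)) * s) `^ p * A / (1 - s `^ p / 2)), (s `^ p / 2).
split => //.
- by rewrite divr_ge0 ?subr_ge0 ?(ltW r1)// mulr_ge0 ?(ltW A0)// mulr_ge0// powR_ge0.
move=> u j uZ uM; have [mu' ui _ _] := Zspace_bound uZ.
apply: (integral_sub_cexp_powR_le (m := mu2) (c := dyadic_cell) measurable_dyadic_cell lebesgue_dyadic_cell dyadic_cell_refine mu' ui A0) => // k.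
exact: Zspace_sub_cexp_sqr_le.
Qed.

Lemma Zspace_average_le u M j i : Zspace u -> Znorm u <= M ->
  `|average mu2 (dyadic_cell j @^-1` [set i]) (v j) u| <= 2 ^+ j * M.
Proof.
move=> uZ uM; have [mu' ui uN _] := Zspace_bound uZ.
have N0 : 0 <= Znorm u by exact: sqrtr_ge0.
have M0 : 0 <= M by exact: le_trans uM.
have := average_cell_sqr_le (m := mu2) (c := dyadic_cell) (v := v) measurable_dyadic_cell v0 lebesgue_dyadic_cell mu' ui j i.
have h : ((v j)^-1%:E * \int[mu2]_x ((u x) ^+ 2)%:E <= ((v j)^-1 * M ^+ 2)%:E)%E.
  rewrite EFinM; apply: lee_wpmul2l; first by rewrite lee_fin invr_ge0 ltW.
  by apply: le_trans uN _; rewrite lee_fin ler_pXn2r ?nnegrE.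
move=> /le_trans /(_ h); rewrite lee_fin /v invrK => {}h.
rewrite -(ler_pXn2r (n := 2))// ?nnegrE ?mulr_ge0 ?exprn_ge0//.
rewrite real_normK ?num_real// (le_trans h)// exprMn -exprM mulnC exprM.
by rewrite (_ : 2 ^+ 2 = 4 :> R)//; ring.
Qed.

Lemma mul_indic_powR (q : R) (B : set (R * R)) u x : q != 0 ->
  `|(u \* \1_B) x| `^ q = \1_B x * `|u x| `^ q.
Proof.
move=> q0; rewrite /= indicE; case: (_ \in _); first by rewrite mulr1 mul1r.
by rewrite mulr0 mul0r normr0 powR0.
Qed.

(** The deviation from the averages over unit squares has a finite power integral on the whole
    plane, and these averages are bounded by [Znorm u], hence integrable to any power on a bounded
    set. *)
Lemma Zspace_Lloc p u : 0 <= p -> p < 2 -> Zspace u -> Lloc (p + 2) u.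
Proof.
move=> p0 p2 uZ B mB bB; have [mu' ui _ _] := Zspace_bound uZ.
have q0 : 0 < p + 2 by rewrite ltr_wpDl.
have [C [r [C0 r0 r1 uC]]] := Zspace_sub_cexp_powR_le (Znorm u) p0 p2.
have [k Bk] := bounded_hsquare bB.
have mE : measurable_fun setT (E 0%N u) by exact: (measurable_cexp mu2 v measurable_dyadic_cell).
have mI : measurable_fun setT (\1_B : R * R -> R) by exact: measurable_indic.
rewrite (_ : u \* \1_B = ((fun x => u x - E 0%N u x) \* \1_B) + (E 0%N u \* \1_B)); last first.
  by apply/funext => x /=; rewrite -mulrDl subrK.
have q1 : (1 <= (p + 2)%:E)%E by rewrite lee_fin; lra.
have [_ addL] := Lfun_addr_closed mu2 q1.
apply: addL.
- apply: Lfun_powR => //.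
    by apply: measurable_funM => //; exact: measurable_funB.
  apply: le_lt_trans (ltry (C * r ^+ 0)); apply: le_trans (uC u 0%N uZ (lexx _)).
  apply: ge0_le_integral => //.
  + apply/measurable_EFinP; apply: measurable_norm_powR; apply: measurable_funM => //.
    exact: measurable_funB.
  + by apply/measurable_EFinP; apply: measurable_norm_powR; exact: measurable_funB.
  move=> x _; rewrite lee_fin mul_indic_powR ?lt0r_neq0// indicE.
  by case: (_ \in _); rewrite ?mul1r// mul0r powR_ge0.
- apply: Lfun_powR => //; first exact: measurable_funM.
  apply: (@le_lt_trans _ _ (\int[mu2]_x ((Znorm u `^ (p + 2))%:E * (\1_(hsquare k) x)%:E))%E).
    apply: ge0_le_integral => //.
    + by apply/measurable_EFinP; apply: measurable_norm_powR; exact: measurable_funM.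
    + apply: measurable_funeM; apply/measurable_EFinP.
      by apply: measurable_indic; exact: measurable_hsquare.
    move=> x _; rewrite -EFinM lee_fin mul_indic_powR ?lt0r_neq0// !indicE.
    have [xB|_] := boolP (x \in B); last by rewrite mul0r mulr_ge0 ?powR_ge0.
    rewrite (_ : x \in hsquare k) ?mul1r ?mulr1; last by move: xB; rewrite !inE => /Bk.
    apply: ge0_ler_powR => //; rewrite ?nnegrE ?sqrtr_ge0 ?(ltW q0)//.
    by have := Zspace_average_le 0 (dyadic_cell 0 x) uZ (lexx _); rewrite expr0 mul1r.
  rewrite ge0_integralZl//; last 2 first.
  + by apply/measurable_EFinP; apply: measurable_indic; exact: measurable_hsquare.
  + by rewrite lee_fin powR_ge0.
  rewrite integral_indic ?setIT//; last exact: measurable_hsquare.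
  by rewrite lte_mul_pinfty ?lee_fin ?powR_ge0//; exact: hsquare_fin.
Qed.

Lemma Zspace_compact p (u_ : nat -> R * R -> R) M : 0 <= p -> p < 2 ->
  (forall n, Zspace (u_ n)) -> (forall n, Znorm (u_ n) <= M) ->
  exists2 phi : nat -> nat, {homo phi : m n / (m < n)%N} &
  exists2 u, Lloc (p + 2) u & cvg_Lloc (p + 2) (u_ \o phi) u.
Proof.
move=> p0 p2 uZ uM.
have q0 : 0 < p + 2 by rewrite ltr_wpDl.
have mu_ n : measurable_fun setT (u_ n) by have [] := Zspace_bound (uZ n).
have [C [r [C0 r0 r1 uC]]] := Zspace_sub_cexp_powR_le M p0 p2.
have [phi phiP [u mu' uphi]] : exists2 phi : nat -> nat, {homo phi : m n / (m < n)%N} &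
  exists2 u : R * R -> R, measurable_fun setT u & forall k,
    (\int[mu2]_x (\1_(hsquare k) x * `|u_ (phi k) x - u x| `^ (p + 2))%:E <=
     (3 `^ (p + 2) * (2 * C + 1) * r ^+ k)%:E)%E.
  apply: (exists_cvg_subseq (m := mu2) (c := dyadic_cell) (v := v) measurable_dyadic_cell) => //.
  - exact: measurable_hsquare.
  - exact: hsquare_le.
  - exact: hsquare_cover.
  - exact: hsquare_fin.
  - exact: hsquare_dyadic_cell_finite.
  - by lra.
  - by lra.
  - by move=> n j; exact: uC.
  - by move=> j i; exists (2 ^+ j * M) => n; exact: Zspace_average_le.
pose D := 3 `^ (p + 2) * (2 * C + 1) : R.
have mD n (B : set (R * R)) : measurable B -> measurable_fun setT ((u_ (phi n) \- u) \* \1_B).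
  by move=> mB; apply: measurable_funM; [exact: measurable_funB|exact: measurable_indic].
(* The estimate of index n lives on [hsquare n], which contains [B] as soon as n >= k. *)
have uB n k (B : set (R * R)) : measurable B -> B `<=` hsquare k -> (k <= n)%N ->
    (\int[mu2]_x (`|((u_ (phi n) \- u) \* \1_B) x| `^ (p + 2))%:E <= (D * r ^+ n)%:E)%E.
  move=> mB Bk kn; apply: le_trans (uphi n); apply: ge0_le_integral => //.
  - by apply/measurable_EFinP; apply: measurable_norm_powR; exact: mD.
  - apply/measurable_EFinP; apply: measurable_funM.
      by apply: measurable_indic; exact: measurable_hsquare.
    by apply: measurable_norm_powR; apply: measurable_funB; [exact: mu_|exact: mu'].
  move=> x _; rewrite lee_fin mul_indic_powR ?lt0r_neq0// !indicE.
  have [xB|_] := boolP (x \in B); last by rewrite mul0r mulr_ge0 ?powR_ge0.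
  by rewrite (_ : x \in hsquare n)//; move: xB; rewrite !inE => /Bk; exact: hsquare_le.
exists phi => //; exists u => B mB bB; have [k Bk] := bounded_hsquare bB.
  (* The limit inherits local integrability from [u_ (phi k)], from which it differs on [B] by a
     function with finite power integral. *)
  rewrite (_ : u \* \1_B = (u_ (phi k) \* \1_B) - ((u_ (phi k) \- u) \* \1_B)); last first.
    by apply/funext => x /=; rewrite -mulrBl opprB addrC subrK.
  have q1 : (1 <= (p + 2)%:E)%E by rewrite lee_fin; lra.
  have [_ addL] := Lfun_addr_closed mu2 q1.
  apply: addL; first exact: (Zspace_Lloc p0 p2 (uZ (phi k)) mB bB).
  apply: Lfun_oppr_closed; apply: Lfun_powR => //; first exact: mD.
  exact: le_lt_trans (uB k k B mB Bk (leqnn k)) (ltry _).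
have D0 : 0 <= D by rewrite mulr_ge0 ?powR_ge0// addr_ge0// mulr_ge0.
apply: cvge0_le => [n|e e0]; first exact: Lnorm_ge0.
have cr : D * r ^+ n @[n --> \oo] --> 0.
  rewrite -[X in _ --> X](mulr0 D); apply: cvgMr => //.
  by apply: cvg_expr; rewrite gtr0_norm.
have eq0 : 0 < e `^ (p + 2) by rewrite powR_gt0.
move/cvgrPdist_le : cr => /(_ _ eq0); apply: filterS2 (nbhs_infty_ge k) => n kn.
have Drn : 0 <= D * r ^+ n by apply: mulr_ge0 D0 _; rewrite exprn_ge0// ltW.
rewrite sub0r normrN (ger0_norm Drn) => hn.
apply: Lnorm_powR_le => //; first exact: ltW.
by apply: le_trans (uB n k B mB Bk kn) _; rewrite lee_fin.
Qed.

End compactness.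

Theorem lemma2p3 (R : realType) (p : R) (p_ge0 : 0 <= p) (p_lt2 : p < 2) :
  compact_embedding_Lloc (@Zspace R) (@Znorm R) (p + 2).
Proof.
split=> [u uZ|u_ uZ [M uM]]; first exact: Zspace_Lloc.
exact: (Zspace_compact p_ge0 p_lt2 uZ uM).
Qed.
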